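(* Let $L$ and $K$ be integers with $L\in[\alpha N,(1-\alpha)N]$ and $N^\delta\le K\le N^{1/4}$, and let $\xi,\alpha$ be any fixed positive constants. Then for $\mathbf y\in\mathcal R_{L,K}(\xi^2\delta/2,\alpha)$ we have the following estimates (with the convention $x_{L-K-1}:=y_{L-K-1}$, $x_{L+K+1}:=y_{L+K+1}$). (i) [Weak form of level repulsion] For any $s>0$ we have $$\mathbb P^{\mu_{\mathbf y}}[x_{i+1}-x_i\le s/N]\le C(Ns)^{\beta+1},\qquad i\in\{L-K-1,\ldots,L+K\},$$ and $$\mathbb P^{\mu_{\mathbf y}}[x_{i+2}-x_i\le s/N]\le C(Ns)^{2\beta+1},\qquad i\in\{L-K-1,\ldots,L+K-1\}.$$ (ii) [Strong form of level repulsion] Suppose that there exist positive constants $C,c$ such that the following rigidity estimate holds for any $k\in I$: $$\mathbb P^{\mu_{\mathbf y}}\Big(|x_k-\alpha_k|\ge CK^{\xi^2}N^{-1}\Big)\le C\exp(-K^c).$$ Then there exists a small constant $\theta$, depending on $C,c$ in this rigidity estimate, such that for any $s\ge\exp(-K^\theta)$ we have $$\mathbb P^{\mu_{\mathbf y}}[x_{i+1}-x_i\le s/N]\le C\big(K^\xi s\log N\big)^{\beta+1},\qquad i\in\{L-K-1,\ldots,L+K\},$$ and $$\mathbb P^{\mu_{\mathbf y}}[x_{i+2}-x_i\le s/N]\le C\big(K^\xi s\log N\big)^{2\beta+1},\qquad i\in\{L-K-1,\ldots,L+K-1\}.$$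
   Context: Global measure. $\beta>0$ is fixed and $V$ is a real analytic potential growing faster than $(2+\epsilon)\log|x|$ at infinity for some $\epsilon>0$ with $\inf V''>-\infty$. $\mu=\mu^{(N)}_{\beta,V}\propto e^{-N\beta\mathcal H(\lambda)}d\lambda$ on $\{\lambda_1<\dots<\lambda_N\}$, $\mathcal H(\lambda)=\frac12\sum_iV(\lambda_i)-\frac1N\sum_{i<j}\log|\lambda_j-\lambda_i|$. The equilibrium density $\varrho_V$ is the minimizer of $\int V\,d\nu-\iint\log|t-s|\,d\nu(t)d\nu(s)$ over probability measures; it is assumed to be supported on one compact interval $[A,B]$, $C^2$ on $(A,B)$, strictly positive on $(A,B)$ and vanishing as a square root at $A,B$. Classical locations $\gamma_k$: $\frac kN=\int_A^{\gamma_k}\varrho_V$. Local measure. Let $I=I_{L,K}=\{L-K,\ldots,L+K\}$, $\mathcal K=2K+1$; write a configuration as $(\lambda_1,\dots,\lambda_N)=(y_1,\dots,y_{L-K-1},x_{L-K},\dots,x_{L+K},y_{L+K+1},\dots,y_N)$ in increasing order. The local equilibrium measure $\mu_{\mathbf y}$ is the conditional law of $\mathbf x=(x_i)_{i\in I}$ given $\mathbf y=(y_j)_{j\notin I}$, i.e. the probability measure on ordered $\mathbf x$ in $J=J_{\mathbf y}=(y_{L-K-1},y_{L+K+1})$ with density proportional to $e^{-N\beta\mathcal H_{\mathbf y}}$, $\mathcal H_{\mathbf y}(\mathbf x)=\frac12\sum_{i\in I}V_{\mathbf y}(x_i)-\frac1N\sum_{i<j\in I}\log|x_j-x_i|$,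 $V_{\mathbf y}(x)=V(x)-\frac2N\sum_{j\notin I}\log|x-y_j|$. With $\bar y=\frac12(y_{L-K-1}+y_{L+K+1})$ set $\alpha_j=\bar y+\frac{j-L}{\mathcal K+1}|J|$ for $j\in I$. Good boundary conditions: $\mathcal R_{L,K}(\nu,\alpha)$ is the set of $\mathbf y$ such that (for indices $k\notin I$) $|y_k-\gamma_k|\le N^{-1+\nu}$ for all $k\in[\alpha N,(1-\alpha)N]\setminus I$; $|y_k-\gamma_k|\le N^{-4/15+\nu}$ for all $k\in[N^{3/5+\nu},N-N^{3/5+\nu}]$; and $|y_k-\gamma_k|\le1$ for all $k\in\{1,\dots,N\}\setminus I$. Standing conventions: results hold for any sufficiently small $\alpha,\delta>0$ and any sufficiently large $N\ge N_0$ ($N_0$ depending on $\alpha,\delta$ and the other parameters of the model); generic constants $C,c$ are independent of $K,N$ but may depend on $\alpha,\delta$ and may change from line to line.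
   Formalization: Assumes ξ²<2, and y∈R_{L,K}(ξ²δ/2,α') with some 0<α'<α (constants depend on α') instead of R_{L,K}(ξ²δ/2,α): otherwise J can be arbitrarily short (L=⌈αN⌉, or ξ²>2 with K≈N^δ) and both (i) and (ii) fail. *)

(* Defs.v *)
From HB Require Import structures.
From mathcomp Require Import all_boot all_order all_algebra.
From mathcomp Require Import all_classical all_reals all_analysis.
Set Implicit Arguments.
Unset Strict Implicit.
Unset Printing Implicit Defensive.
Import Order.TTheory GRing.Theory Num.Theory.
Import numFieldNormedType.Exports.
Local Open Scope classical_set_scope.
Local Open Scope ring_scope.

(** * Lebesgue measure on [n.-tuple R]

   The library has the product sigma-algebra on tuples, but only binary product
   measures; [lebesgue_tuple n.+1] is the image of the product of
   [lebesgue_measure] and [lebesgue_tuple n] under [cons]. *)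

Section tuple_cons.
Context {R : realType}.
Local Notation mR := (measurableTypeR R).

Definition cons_pair n (p : mR * n.-tuple mR) : n.+1.-tuple mR :=
  [tuple of p.1 :: p.2].

Lemma measurable_cons_pair n : measurable_fun [set: mR * n.-tuple mR] (@cons_pair n).
Proof. exact: measurable_cons. Qed.

Definition uncons_pair n (x : n.+1.-tuple mR) : mR * n.-tuple mR :=
  (thead x, [tuple of behead x]).

Lemma measurable_uncons_pair n :
  measurable_fun [set: n.+1.-tuple mR] (@uncons_pair n).
Proof.
apply: measurable_fun_pair.
  exact: (@measurable_tnth _ mR n.+1 ord0).
exact: (@measurable_behead _ mR n).
Qed.

Lemma cons_pairK n : cancel (@cons_pair n) (@uncons_pair n).
Proof.
by move=> [a t]; rewrite /uncons_pair theadE; congr pair; exact/val_inj.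
Qed.

Definition cons_measure n (m : {sigma_finite_measure set (n.-tuple mR) -> \bar R}) :
    set (n.+1.-tuple mR) -> \bar R :=
  pushforward (lebesgue_measure \x m)%E (@cons_pair n).

End tuple_cons.

Section cons_measure.
Context {R : realType} (n : nat).
Variable m : {sigma_finite_measure set (n.-tuple (measurableTypeR R)) -> \bar R}.
Local Open Scope ereal_scope.

Let cm0 : cons_measure m set0 = 0.
Proof. by rewrite /cons_measure /pushforward preimage_set0 measure0. Qed.

Let cm_ge0 A : 0 <= cons_measure m A.
Proof. by rewrite /cons_measure /pushforward measure_ge0. Qed.

Let cm_additive : semi_sigma_additive (cons_measure m).
Proof.
move=> F mF tF mUF; rewrite /cons_measure /pushforward preimage_bigcup.
have mp X : measurable X -> measurable (@cons_pair R n @^-1` X).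
  by move=> mX; rewrite -[X in measurable X]setTI; exact: measurable_cons_pair.
apply: measure_semi_sigma_additive.
- by move=> k; exact: mp.
- apply/trivIsetP => /= i j _ _ ij; rewrite -preimage_setI.
  by move/trivIsetP : tF => /(_ _ _ _ _ ij) ->//; rewrite preimage_set0.
- by rewrite -preimage_bigcup; exact: mp.
Qed.

HB.instance Definition _ :=
  isMeasure.Build _ _ _ (cons_measure m) cm0 cm_ge0 cm_additive.

Let cm_sigma_finite : sigma_finite setT (cons_measure m).
Proof.
have /sigma_finiteP[F [FT ndF Foo]] := sigma_finiteT (@lebesgue_measure R).
have /sigma_finiteP[G [GT ndG Goo]] := sigma_finiteT m.
exists (fun k => @uncons_pair R n @^-1` (F k `*` G k)).
  rewrite -preimage_bigcup -[LHS](preimage_setT (@uncons_pair R n)).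
  congr (_ @^-1` _); apply/seteqP; split=> // -[a t] _.
  have [i _ Fi] : (\bigcup_k F k) a by rewrite -FT.
  have [j _ Gj] : (\bigcup_k G k) t by rewrite -GT.
  exists (maxn i j) => //; split.
    by move: a Fi; exact/subsetPset/ndF/leq_maxl.
  by move: t Gj; exact/subsetPset/ndG/leq_maxr.
move=> k; have [mF Fk] := Foo k; have [mG Gk] := Goo k; split.
  rewrite -[X in measurable X]setTI.
  by apply: measurable_uncons_pair => //; exact: measurableX.
rewrite /cons_measure /pushforward -comp_preimage.
rewrite (_ : _ \o _ = id) ?preimage_id; last first.
  by apply/funext => p; exact: cons_pairK.
by rewrite product_measure1E// lte_mul_pinfty// ge0_fin_numE.
Qed.

HB.instance Definition _ :=
  Measure_isSigmaFinite.Build _ _ _ (cons_measure m) cm_sigma_finite.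

End cons_measure.

Section lebesgue_tuple.
Context {R : realType}.

Fixpoint lebesgue_tuple (n : nat) :
    {sigma_finite_measure set (n.-tuple (measurableTypeR R)) -> \bar R} :=
  match n with
  | 0 => dirac [tuple]
  | n'.+1 => cons_measure (lebesgue_tuple n')
  end.

End lebesgue_tuple.

(** * Potential and equilibrium measure *)

Section equilibrium.
Context {R : realType}.
Implicit Types (V rho : R -> R) (A B : R).

Definition real_analytic V : Prop :=
  forall x0, exists2 r : R, 0 < r &
  exists a : nat -> R, forall x, `|x - x0| < r ->
    (\sum_(0 <= k < n) a k * (x - x0) ^+ k) @[n --> \oo] --> V x.

Definition admissible_potential V : Prop :=
  [/\ real_analytic V,
      exists eps M : R, 0 < eps /\
        forall x, M < `|x| -> (2 + eps) * ln `|x| <= V x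
    & exists m : R, forall x, m <= V^`(2)%classic x].

(* [lne 0 = -oo], so the logarithmic energy of a measure with atoms is
   [+oo]; the real-valued [ln] has [ln 0 = 0] and would not do here. *)
Definition log_energy V
    (nu : probability (measurableTypeR R) R) : \bar R :=
  (\int[nu]_t (V t)%:E - \int[nu \x nu]_p lne `|p.1 - p.2|%:E)%E.

Definition has_density (nu : probability (measurableTypeR R) R) rho : Prop :=
  forall E : set (measurableTypeR R), measurable E ->
    nu E = (\int[lebesgue_measure]_(x in E) (rho x)%:E)%E.

(* The comparison measures are those with [V] integrable.  For the others
   [\int V = +oo] and, by the growth of [V], the energy is [+oo] by convention,
   but the difference of the two integrals can be [+oo - +oo], which the
   library evaluates to [-oo]. *)
Definition energy_minimizer V (nu : probability (measurableTypeR R) R) : Prop :=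
  nu.-integrable setT (EFin \o V) /\
  forall nu' : probability (measurableTypeR R) R,
    nu'.-integrable setT (EFin \o V) ->
    (log_energy V nu <= log_energy V nu')%E.

Definition equilibrium_density V rho A B : Prop :=
  A < B /\
  (exists2 nu : probability (measurableTypeR R) R,
      energy_minimizer V nu & has_density nu rho) /\
  (forall x, A < x < B -> 0 < rho x) /\
  (forall x, ~~ (A < x < B) -> rho x = 0) /\
  (forall x, A < x < B ->
     [/\ derivable rho x 1, derivable rho^`()%classic x 1
       & {for x, continuous rho^`(2)%classic}]) /\
  (exists2 cA : R, 0 < cA & rho x / Num.sqrt (x - A) @[x --> A^'+] --> cA) /\
  (exists2 cB : R, 0 < cB & rho x / Num.sqrt (B - x) @[x --> B^'-] --> cB).

Definition classical_locations rho A B (N : nat) (gamma : nat -> R) : Prop :=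
  forall k, (1 <= k <= N)%N ->
    A <= gamma k <= B /\
    (\int[lebesgue_measure]_(x in `[A, gamma k]) (rho x)%:E)%E
      = (k%:R / N%:R)%:E.

End equilibrium.

(** * Local measure

   Particles are numbered from 1 to [N].  A boundary condition is a function
   [y : nat -> R] of which only the values at the indices [j] with
   [out_window N L K j] are ever used, and a configuration of the particles in
   [I = {L - K, ..., L + K}] is a tuple whose entry number [m] (from 0) is
   [x_(L - K + m)].  The definitions are meant for [K + 1 < L] and
   [L + K < N], where no subtraction on [nat] is truncated. *)

Unset Implicit Arguments.

Section local_measure.
Context {R : realType}.
Implicit Types (V : R -> R) (beta : R) (N L K : nat) (y gamma : nat -> R).

Definition in_window L K (j : nat) : bool := (L - K <= j <= L + K)%N.

Definition out_window N L K (j : nat) : bool := (1 <= j <= N)%N && ~~ in_window L K j.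

Definition ordered_outside N L K y : Prop :=
  forall j k, out_window N L K j -> out_window N L K k -> (j < k)%N -> y j < y k.

Definition good_boundary N L K gamma (nu alpha : R) y : Prop :=
  [/\ ordered_outside N L K y,
      forall k, out_window N L K k ->
        alpha * N%:R <= k%:R <= (1 - alpha) * N%:R ->
        `|y k - gamma k| <= N%:R `^ (-1 + nu),
      forall k, out_window N L K k ->
        N%:R `^ (3 / 5 + nu) <= k%:R <= N%:R - N%:R `^ (3 / 5 + nu) ->
        `|y k - gamma k| <= N%:R `^ (- (4 / 15) + nu)
    & forall k, out_window N L K k -> `|y k - gamma k| <= 1].

(* The full configuration; on [y] it implements the convention
   [x_(L-K-1) = y_(L-K-1)] and [x_(L+K+1) = y_(L+K+1)]. *)
Definition full_config L K y (x : K.*2.+1.-tuple R) (j : nat) : R :=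
  if in_window L K j then nth 0 x (j - (L - K)) else y j.

Definition V_loc V N L K y (t : R) : R :=
  V t - 2 / N%:R * \sum_(1 <= j < N.+1 | out_window N L K j) ln `|t - y j|.

Definition H_loc V N L K y (x : K.*2.+1.-tuple R) : R :=
  2^-1 * \sum_(i < K.*2.+1) V_loc V N L K y (tnth x i)
  - N%:R^-1 * \sum_(i < K.*2.+1) \sum_(j < K.*2.+1 | (i < j)%N)
                ln `|tnth x j - tnth x i|.

(* y_(L-K-1) < x_(L-K) < ... < x_(L+K) < y_(L+K+1) *)
Definition ordered_in_J L K y : set (K.*2.+1.-tuple (measurableTypeR R)) :=
  [set x | forall j, (L - K.+1 <= j <= L + K)%N ->
             full_config L K y x j < full_config L K y x j.+1].

Definition equidistant L K y (j : nat) : R :=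
  (y (L - K.+1)%N + y (L + K.+1)%N) / 2
  + (j%:R - L%:R) / (K.*2.+1%:R + 1) * (y (L + K.+1)%N - y (L - K.+1)%N).

Definition deviation_event L K y (k : nat) (r : R) :
    set (K.*2.+1.-tuple (measurableTypeR R)) :=
  [set x | r <= `|full_config L K y x k - equidistant L K y k|].

Definition gap_event L K y (i d : nat) (r : R) :
    set (K.*2.+1.-tuple (measurableTypeR R)) :=
  [set x | full_config L K y x (i + d)%N - full_config L K y x i <= r].

Definition mass_loc V beta N L K y
    (E : set (K.*2.+1.-tuple (measurableTypeR R))) : \bar R :=
  (\int[lebesgue_tuple K.*2.+1]_(x in ordered_in_J L K y `&` E)
     (expR (- (N%:R * beta * H_loc V N L K y x)))%:E)%E.

(* The probability of the (measurable) event [E] under the local equilibrium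
   measure: the law with density proportional to [expR (- N beta H_loc)] on the
   ordered configurations in [J]. *)
Definition P_loc V beta N L K y
    (E : set (K.*2.+1.-tuple (measurableTypeR R))) : R :=
  fine (mass_loc V beta N L K y E) / fine (mass_loc V beta N L K y setT).

End local_measure.

(* Main.v *)
(* Let z be the ordered configuration of all N particles, o an index, and let
   the particles strictly between o and another index p (the window) be moved
   towards z_p by the map x -> z_p + (1 - phi) (x - z_p).  This opens the gap at
   z_o by phi |z_p - z_o| and changes Lebesgue measure by a constant factor.
   Distances to the particles on the side of o increase, those inside the window
   shrink by 1 - phi, and those to the particles beyond z_p shrink by at most
   1 - phi |z_p - z_o| / |z_j - z_o|; so, apart from the factor coming from the
   gap itself, the density decreases at most by exp(- D u), where u is the new
   gap and D is of order N M log N for a window of M particles of length at least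
   of order M / N.  Hence under the density divided by the beta-th powers of the
   first d gaps, the event that a gap is below u has probability at most D u, and
   putting these powers back gives (2 D u)^(d beta + 1).

   Without rigidity the pivot p is the end of J farther from the gap, so that M
   is of order K; as K log N = O(N), this gives (i), and also (ii) if xi >= 1.
   For xi < 1 the window has about K^xi particles, and rigidity controls its
   length and the particles beyond it. *)

Require Import Defs.
From mathcomp Require Import all_boot all_order all_algebra.
From mathcomp Require Import all_classical all_reals all_analysis.
From mathcomp Require Import measurable_realfun ring lra zify.
Import Order.TTheory GRing.Theory Num.Theory.
Import numFieldNormedType.Exports.
Set Implicit Arguments.
Unset Strict Implicit.
Unset Printing Implicit Defensive.
Local Open Scope classical_set_scope.
Local Open Scope ring_scope.

(** * Linear changes of variables for Lebesgue measure on tuples *)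

(** The single power of u beyond d beta comes from conservation of mass: the contraction carries
    everything into the event that the gaps at z_o exceed u and loses only a fraction D u, so at
    most that fraction was outside. The division by powers of the gaps is truncated, each gap being
    replaced by its maximum with u, so that integrability of the quotient follows from that of the
    density. To compare the mass of the quotient with that of the density, the contraction is used
    again at the scale 1 / (2 D), where at least half of the mass survives.

    Two requirements shape the geometry. The contraction must preserve the event on which it is
    estimated, so rigidity may be imposed only on the unmoved particles. And its cost must be summed
    over all N particles: one beyond z_p at index distance k is about k / N away, which yields a
    harmonic sum and is the origin of log N.

    For d = 2 both gaps are measured from z_o, so that they open together; the repulsion between the
    two moved particles is not exploited, which is why the exponent is 2 beta + 1. *)

Section change_of_variables.
Context {R : realType}.
Local Notation mR := (measurableTypeR R).
Local Notation mu := (@lebesgue_measure R).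
Local Open Scope ereal_scope.

(** As a function of [A] the right-hand side is a measure, and it gives []a, b]] the value [b - a]
    because the preimage has length [(b - a) / c]; uniqueness of Lebesgue measure concludes. *)
Lemma lebesgue_measure_affine (c q : R) (A : set mR) : (0 < c)%R -> measurable A ->
  mu A = c%:E * pushforward mu ((fun t => c * t + q)%R : mR -> mR) A.
Proof.
move=> c0 mA.
have mf : measurable_fun [set: mR] ((fun t => c * t + q)%R : mR -> mR).
  by apply: measurable_funD => //; exact: measurable_funM.
pose m0 : {measure set mR -> \bar R} :=
  mscale (NngNum (ltW c0)) (pushforward mu ((fun t => c * t + q)%R : mR -> mR)).
pose m := m0 mf.
rewrite [RHS](_ : _ = m A)//.
apply: lebesgue_measure_unique => // _ [[a b]] _ <-.
rewrite [RHS](_ : _ = c%:E * mu `](a - q) / c, (b - q) / c]%classic%R); last first.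
  congr (_ * mu _); apply/seteqP; split => t /=;
    by rewrite !in_itv/= ltr_pdivrMr// ler_pdivlMr// ltrBlDr lerBrDr mulrC.
rewrite !lebesgue_measure_itv/= !lte_fin ltr_pM2r ?invr_gt0// ltrD2r.
case: ifP => ab; last by rewrite mule0.
rewrite -EFinM; congr EFin; field; exact: lt0r_neq0.
Qed.

Lemma integral_affine (c q : R) (F : mR -> \bar R) : (0 < c)%R ->
  measurable_fun setT F -> (forall t, 0 <= F t) ->
  \int[mu]_t F t = c%:E * \int[mu]_t F (c * t + q)%R.
Proof.
move=> c0 mF F0.
have mf : measurable_fun [set: mR] ((fun t => c * t + q)%R : mR -> mR).
  by apply: measurable_funD => //; exact: measurable_funM.
pose m0 : {measure set mR -> \bar R} :=
  mscale (NngNum (ltW c0)) (pushforward mu ((fun t => c * t + q)%R : mR -> mR)).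
pose m := m0 mf.
transitivity (\int[m]_t F t).
  by apply: eq_measure_integral => A mA _; exact: lebesgue_measure_affine.
rewrite ge0_integral_mscale//= ge0_integral_pushforward//.
Qed.

(** The shift [q] is a function of the tuple since the pivot of a contraction may itself be an
    integration variable; the Jacobian is a power of [c] provided that [q] ignores the moved
    coordinates. *)
Definition tuple_affine n (w : pred 'I_n) (c : R) (q : n.-tuple mR -> R)
    (x : n.-tuple mR) : n.-tuple mR :=
  [tuple if w k then (c * tnth x k + q x)%R else tnth x k | k < n].

Lemma measurable_tuple_affine n (w : pred 'I_n) c q :
  measurable_fun [set: n.-tuple mR] q ->
  measurable_fun [set: n.-tuple mR] (tuple_affine w c q).
Proof.
move=> mq; apply/measurable_fun_tnthP => k.
rewrite (_ : _ \o _ = if w k then (fun x => c * tnth x k + q x)%R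
   else (fun x => tnth x k)); last first.
  by apply/funext => x /=; rewrite tnth_mktuple; case: ifP.
case: ifP => _; last exact: measurable_tnth.
by apply: measurable_funD => //; apply: measurable_funM => //; exact: measurable_tnth.
Qed.

Lemma integral_lebesgue_tupleS n (F : n.+1.-tuple mR -> \bar R) :
  measurable_fun setT F -> (forall x, 0 <= F x) ->
  \int[lebesgue_tuple n.+1]_x F x =
  \int[mu \x lebesgue_tuple n]_p F (cons_pair p).
Proof.
move=> mF F0; rewrite /= /cons_measure.
by rewrite ge0_integral_pushforward//; exact: measurable_cons_pair.
Qed.

(** Induction on [n] with Tonelli: the first coordinate is integrated last when another one is
    moved, and first when it is the moved one, so that the one-dimensional formula applies with the
    others frozen. *)
Lemma integral_tuple_affine1 n (j : 'I_n) (c : R) (q : n.-tuple mR -> R)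
    (F : n.-tuple mR -> \bar R) : (0 < c)%R ->
  measurable_fun setT q ->
  (forall x y, (forall k, k != j -> tnth x k = tnth y k) -> q x = q y) ->
  measurable_fun setT F -> (forall x, 0 <= F x) ->
  \int[lebesgue_tuple n]_x F x =
  c%:E * \int[lebesgue_tuple n]_x F (tuple_affine (pred1 j) c q x).
Proof.
move=> c0; elim: n j q F => [[]//|n IH] j q F mq qj mF F0.
have mT : measurable_fun [set: n.+1.-tuple mR] (F \o tuple_affine (pred1 j) c q).
  by apply: measurableT_comp => //; exact: measurable_tuple_affine.
rewrite (integral_lebesgue_tupleS mF F0).
rewrite (@integral_lebesgue_tupleS _ (fun x => F (tuple_affine (pred1 j) c q x)) mT (fun x => F0 _)).
have mFc : measurable_fun [set: (mR * n.-tuple mR)%type] (fun p => F (cons_pair p)).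
  by apply: measurableT_comp => //; exact: measurable_cons_pair.
have mTc : measurable_fun [set: (mR * n.-tuple mR)%type]
   (fun p => F (tuple_affine (pred1 j) c q (cons_pair p))).
  by apply: (measurableT_comp mT); exact: measurable_cons_pair.
case: (unliftP ord0 j) => [k jk|j0].
- rewrite (fubini_tonelli1 (fun p => F (cons_pair p)) mFc (fun p => F0 _)).
  rewrite (fubini_tonelli1 (fun p => F (tuple_affine (pred1 j) c q (cons_pair p))) mTc (fun p => F0 _)).
  rewrite -ge0_integralZl//; last 3 first.
  + exact: measurable_fun_fubini_tonelli_F.
  + by move=> t _; apply: integral_ge0 => x _; exact: F0.
  + by rewrite lee_fin ltW.
  apply: eq_integral => t _; rewrite /fubini_F.
  have mct : measurable_fun [set: n.-tuple mR] (fun x => cons_pair (t, x) : n.+1.-tuple mR).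
    by apply: (measurableT_comp (@measurable_cons_pair R n)); exact: measurable_pair1.
  rewrite (IH k (fun x => q (cons_pair (t, x))) (fun x => F (cons_pair (t, x)))); last 4 first.
  + exact: (measurableT_comp mq).
  + move=> x y xy; apply: qj => i; case: (unliftP ord0 i) => [i' ->|-> _]; last by [].
    rewrite jk => ii.
    by rewrite !tnthS xy//; apply: contra ii => /eqP ->.
  + exact: (measurableT_comp mF).
  + by move=> x; exact: F0.
  congr (_ * _); apply: eq_integral => x _; congr F.
  apply: eq_from_tnth => i; rewrite tnth_mktuple; case: (unliftP ord0 i) => [i' ->|->].
    by rewrite !tnthS tnth_mktuple /= jk (inj_eq (@lift_inj _ ord0)).
  by rewrite /= jk (negbTE (neq_lift _ _)) !tnth0.
- rewrite (fubini_tonelli2 (fun p => F (cons_pair p)) mFc (fun p => F0 _)).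
  rewrite (fubini_tonelli2 (fun p => F (tuple_affine (pred1 j) c q (cons_pair p))) mTc (fun p => F0 _)).
  rewrite -ge0_integralZl//; last 3 first.
  + exact: measurable_fun_fubini_tonelli_G.
  + by move=> t _; apply: integral_ge0 => x _; exact: F0.
  + by rewrite lee_fin ltW.
  apply: eq_integral => x _; rewrite /fubini_G.
  have mct : measurable_fun [set: mR] (fun t => cons_pair (t, x) : n.+1.-tuple mR).
    by apply: (measurableT_comp (@measurable_cons_pair R n)); exact: measurable_pair2.
  (* The [0] is a placeholder: by [qj] the shift is the same for every value of the first
     coordinate. *)
  rewrite (@integral_affine c (q (cons_pair (0%R, x))) (fun t => F (cons_pair (t, x))) c0
    (measurableT_comp mF mct) (fun t => F0 _)).
  congr (_ * _); apply: eq_integral => t _; congr F.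
  apply: eq_from_tnth => i; rewrite tnth_mktuple; case: (unliftP ord0 i) => [i' ->|->].
    by rewrite /= j0 eq_sym (negbTE (neq_lift _ _)) !tnthS.
  rewrite /= j0 eqxx !tnth0; congr (_ + _)%R; apply: qj => i'.
  by rewrite j0; case: (unliftP ord0 i') => [i'' -> _|->//]; rewrite !tnthS.
Qed.

(** The coordinates are moved one at a time. Each move leaves [q] unchanged, so the successive maps
    compose to the simultaneous one, and each contributes a factor [c]. *)
Lemma integral_tuple_affine n (w : seq 'I_n) (c : R) (q : n.-tuple mR -> R)
    (F : n.-tuple mR -> \bar R) : (0 < c)%R -> uniq w ->
  measurable_fun setT q ->
  (forall x y, (forall k, k \notin w -> tnth x k = tnth y k) -> q x = q y) ->
  measurable_fun setT F -> (forall x, 0 <= F x) ->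
  \int[lebesgue_tuple n]_x F x =
  (c ^+ size w)%:E * \int[lebesgue_tuple n]_x F (tuple_affine (mem w) c q x).
Proof.
move=> c0; elim: w F => [|j w IH] F.
  move=> _ mq qj mF F0; rewrite expr0 mul1e; apply: eq_integral => x _; congr F.
  by apply: eq_from_tnth => i; rewrite tnth_mktuple.
move=> /= /andP[jw uw] mq qj mF F0.
rewrite (@integral_tuple_affine1 _ j c q)//; last first.
  move=> x y xy; apply: qj => k; rewrite inE negb_or => /andP[kj _]; exact: xy.
rewrite exprS EFinM -muleA; congr (_ * _).
have mFT : measurable_fun [set: n.-tuple mR] (fun x => F (tuple_affine (pred1 j) c q x)).
  by apply: (measurableT_comp mF); exact: measurable_tuple_affine.
rewrite (IH _ uw mq _ mFT (fun x => F0 _)); last first.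
  by move=> x y xy; apply: qj => k; rewrite inE negb_or => /andP[_]; exact: xy.
congr (_ * _); apply: eq_integral => x _; congr F.
have qw : q (tuple_affine (mem w) c q x) = q x.
  apply: qj => k; rewrite inE negb_or => /andP[_ kw].
  by rewrite tnth_mktuple /= (negbTE kw).
apply: eq_from_tnth => k; rewrite !tnth_mktuple /= qw inE.
by case: eqP => //= ->; rewrite (negbTE jw).
Qed.

End change_of_variables.

(** * From contractions to repulsion *)

Lemma measurable_set_le d (X : measurableType d) (R : realType) (f g : X -> R) :
  measurable_fun setT f -> measurable_fun setT g -> measurable [set x | f x <= g x].
Proof. by move=> mf mg; rewrite -[X in measurable X]setTI; exact: measurable_fun_le. Qed.

Lemma measurable_set_lt d (X : measurableType d) (R : realType) (f g : X -> R) :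
  measurable_fun setT f -> measurable_fun setT g -> measurable [set x | f x < g x].
Proof.
move=> mf mg; rewrite (_ : [set x | _] = ~` [set x | g x <= f x]).
  by apply: measurableC; exact: measurable_set_le.
by apply/seteqP; split => x /=; [move/lt_geF => ->|move/negP; rewrite -ltNge].
Qed.

Section repulsion_of_contraction.
Context d (X : measurableType d) {R : realType}.
Variables (mu : {measure set X -> \bar R}) (f : X -> R) (Om : set X).
Variables (g : nat -> X -> R) (m : nat) (beta D : R).
Hypotheses (mf : measurable_fun setT f) (f0 : forall x, 0 <= f x).
Hypotheses (mOm : measurable Om) (fin : (\int[mu]_(x in Om) (f x)%:E < +oo)%E).
Hypotheses (mg : forall k, (k < m)%N -> measurable_fun setT (g k)).
Hypotheses (m0 : (0 < m)%N) (beta0 : 0 <= beta) (D0 : 0 < D).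
Hypothesis g0 : forall x k, Om x -> (k < m)%N -> 0 < g k x.
(** [a] is the Jacobian of [T] and [kap] a lower bound for the change of density. The density
    compared is [f] divided by the [beta]-th powers of the gaps, written without quotients. *)
Hypothesis contraction : forall u : R, 0 < u -> 2 * D * u <= 1 ->
  exists (T : X -> X) (a kap : R), [/\ 0 <= a /\ 0 <= kap, 1 - D * u <= a * kap,
    measurable_fun setT T,
    forall F : X -> \bar R, measurable_fun setT F -> (forall x, 0 <= F x)%E ->
      (\int[mu]_x F x = a%:E * \int[mu]_x F (T x))%E &
    forall x, Om x -> [/\ Om (T x),
      forall k, (k < m)%N -> g k x <= g k (T x) /\ u < g k (T x) &
      kap * f x * (\prod_(k < m) g k (T x)) `^ beta
        <= f (T x) * (\prod_(k < m) g k x) `^ beta]].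

Let far (v : R) : set X := [set x | forall k, (k < m)%N -> v < g k x].
Let near (u : R) : set X := [set x | forall k, (k < m)%N -> g k x <= u].

Let measurable_near v : measurable (near v).
Proof.
rewrite (_ : near v = \bigcap_(k in `I_m) [set x | g k x <= v]); last first.
  by apply/seteqP; split => x /= h k; [move=> km; exact: h|exact: h].
apply: fin_bigcap_measurable => // k km.
by apply: measurable_set_le => //; exact: mg.
Qed.

Let measurable_far v : measurable (far v).
Proof.
rewrite (_ : far v = \bigcap_(k in `I_m) [set x | v < g k x]); last first.
  by apply/seteqP; split => x /= h k; [move=> km; exact: h|exact: h].
apply: fin_bigcap_measurable => // k km.
by apply: measurable_set_lt => //; exact: mg.
Qed.

(** Let [f1] be [f] divided by the truncated gaps to the power [beta], with mass [Z]. The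
    contraction at scale [u] leaves at most [D * u * Z] outside [far u]; at scale [v = 1 / (2 * D)]
    it puts at least [Z / 2] on [far v], where [f1] is at most [v ^ (- m * beta) * f]. Restoring the
    factor [u ^ (m * beta)] on [near u] gives [2 * D * u * (u / v) ^ (m * beta)]. *)
Lemma repulsion_of_contraction (u : R) : 0 < u ->
  (\int[mu]_(x in Om `&` [set x | forall k, (k < m)%N -> (g k x <= u)%R]) (f x)%:E
   <= ((2 * D * u) `^ (m%:R * beta + 1))%R%:E * \int[mu]_(x in Om) (f x)%:E)%E.
Proof.
move=> u0; have fE0 x : (0 <= (f x)%:E)%E by rewrite lee_fin.
have mfE : measurable_fun setT (fun x => (f x)%:E) by exact/measurable_EFinP.
have p0 : 0 <= m%:R * beta + 1 by rewrite addr_ge0// mulr_ge0.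
have mE : measurable (Om `&` near u) by apply: measurableI.
(* For [2 * D * u > 1] the constant in front of the total mass is at least 1. *)
have [Du|Du] := leP (2 * D * u) 1; last first.
  apply: (@le_trans _ _ (\int[mu]_(x in Om) (f x)%:E)%E).
    by apply: ge0_subset_integral => //; exact: measurable_funTS.
  rewrite lee_pemull ?integral_ge0// lee_fin.
  by rewrite -[leLHS](powRr0 (2 * D * u)) ler_powR// ltW.
have prodE (v : R) : v ^+ m = \prod_(k < m) v by rewrite prodr_const card_ord.
(* The product of the gaps truncated below at [u]: it is the product of the gaps on [far u] and
   equals [u ^ m] on [near u]. *)
pose M x := \prod_(k < m) Num.max (g k x) u.
have M0 x : 0 < M x by apply: prodr_gt0 => k _; rewrite lt_max u0 orbT.
have mM : measurable_fun setT M.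
  apply: measurable_prod => k _; apply: measurable_maxr => //; exact: mg.
pose f1 x := f x / (M x) `^ beta.
have f10 x : 0 <= f1 x by rewrite divr_ge0// powR_ge0.
have mf1 : measurable_fun setT f1.
  apply: measurable_funM => //.
  rewrite (_ : (fun _ => _) = (fun x => x `^ (- beta)) \o M); last first.
    by apply/funext => x /=; rewrite powRN.
  by apply: measurableT_comp => //; exact: measurable_powR.
have mf1E : measurable_fun setT (fun x => (f1 x)%:E) by exact/measurable_EFinP.
have ff1 x : f x = f1 x * (M x) `^ beta.
  by rewrite /f1 divfK// gt_eqF// powR_gt0.
pose Z := (\int[mu]_(x in Om) (f1 x)%:E)%E.
have um0 : 0 < u ^+ m by rewrite exprn_gt0.
(* The weight is at least [u ^ m] and [f] is integrable. *)
have Zfin : Z \is a fin_num.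
  rewrite ge0_fin_numE; last by apply: integral_ge0 => x _; rewrite lee_fin.
  apply: (@le_lt_trans _ _ (((u ^+ m) `^ beta)^-1%:E * \int[mu]_(x in Om) (f x)%:E)%E).
    rewrite -ge0_integralZl_EFin//; last 2 first.
    - exact: measurable_funTS.
    - by rewrite invr_ge0 powR_ge0.
    apply: ge0_le_integral => //.
    - by move=> x _; rewrite lee_fin.
    - exact: measurable_funTS.
    - by apply: measurable_funeM; exact: measurable_funTS.
    - move=> x _; rewrite -EFinM lee_fin mulrC ler_wpM2l// lef_pV2 ?posrE ?powR_gt0//.
      apply: ge0_ler_powR; rewrite ?nnegrE ?(ltW um0) ?(ltW (M0 _))// prodE.
      by apply: ler_prod => k _; rewrite (ltW u0) le_max lexx orbT.
  by rewrite lte_mul_pinfty// lee_fin invr_ge0 powR_ge0.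
have splitZ v : Z = (\int[mu]_(x in Om `&` far v) (f1 x)%:E +
    \int[mu]_(x in Om `&` ~` far v) (f1 x)%:E)%E.
  rewrite /Z; have {1}-> : Om = (Om `&` far v) `|` (Om `&` ~` far v) by rewrite -setIUr setUv setIT.
  rewrite ge0_integral_setU//.
  - exact: measurableI.
  - by apply: measurableI => //; exact: measurableC.
  - exact: measurable_funTS.
  - by move=> x _; rewrite lee_fin.
  - by rewrite disj_set2E setIACA setICr setI0.
(* [T] maps [Om] into [far v], so the integral over [far v], pulled back by [T], is at least
   [a * kap] times the whole mass of [f1]. *)
have farZ v : 0 < v -> 2 * D * v <= 1 -> u <= v ->
    ((1 - D * v)%:E * Z <= \int[mu]_(x in Om `&` far v) (f1 x)%:E)%E.
  move=> v0 Dv uv; have [T [a [kap [[a0 kap0] Dak mT TF TOm]]]] := contraction v0 Dv.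
  have Z0 : (0 <= Z)%E by apply: integral_ge0 => x _; rewrite lee_fin.
  apply: (@le_trans _ _ ((a * kap)%:E * Z)%E).
    by rewrite lee_wpmul2r// lee_fin.
  rewrite integral_mkcond TF; last 2 first.
  - by apply/(measurable_restrictT _ _).1; [exact: measurableI|exact: measurable_funTS].
  - by move=> x; rewrite patchE; case: ifPn => // _; rewrite lee_fin.
  rewrite EFinM -muleA lee_wpmul2l// /Z -ge0_integralZl_EFin//; last 2 first.
  - by move=> x _; rewrite lee_fin.
  - exact: measurable_funTS.
  rewrite integral_mkcond; apply: ge0_le_integral => //.
  - by move=> x _; rewrite patchE; case: ifPn => // _; rewrite mule_ge0// lee_fin.
  - apply/(measurable_restrictT _ _).1 => //.
    by apply: measurable_funeM; exact: measurable_funTS.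
  - apply: measurableT_comp => //.
    by apply/(measurable_restrictT _ _).1; [exact: measurableI|exact: measurable_funTS].
  move=> x _; rewrite !patchE; case: ifPn => [|_]; last first.
    by case: ifPn => // _; rewrite lee_fin.
  rewrite inE => xOm; have [TxOm gT fT] := TOm _ xOm.
  rewrite ifT; last by rewrite inE; split => // k /gT[].
  rewrite -EFinM lee_fin /f1.
  pose P x := \prod_(k < m) g k x.
  have P0 : 0 < P x by apply: prodr_gt0 => k _; exact: g0.
  have PT0 : 0 < P (T x) by apply: prodr_gt0 => k _; exact: g0.
  (* At [T x] all gaps exceed [v >= u], so the truncation is inactive there, while at [x] it can
     only increase the product. The comparison for the raw gaps thus passes to [f1]. *)
  have key : M (T x) `^ beta * P x `^ beta <= M x `^ beta * P (T x) `^ beta.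
    rewrite -!powRM ?(ltW (M0 _)) ?(ltW P0) ?(ltW PT0)//.
    apply: ge0_ler_powR; rewrite ?nnegrE ?mulr_ge0 ?(ltW (M0 _)) ?(ltW P0) ?(ltW PT0)//.
    rewrite -!big_split/=; apply: ler_prod => k _.
    have [gg ug] := gT k (ltn_ord k).
    have gk0 := g0 xOm (ltn_ord k); apply/andP; split.
      by rewrite mulr_ge0// ?(ltW gk0)// le_max (ltW u0) orbT.
    rewrite (max_idPl (le_trans uv (ltW ug))) [leRHS]mulrC.
    by rewrite ler_wpM2l ?(ltW (lt_le_trans gk0 gg))// le_max lexx.
  have p0' : 0 < P x `^ beta by rewrite powR_gt0.
  have MT0 : 0 < M (T x) `^ beta by rewrite powR_gt0.
  have Mx0 : 0 < M x `^ beta by rewrite powR_gt0.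
  have h1 : kap * f x * (M (T x) `^ beta * P x `^ beta) <=
      M x `^ beta * (f (T x) * P x `^ beta).
    apply: (@le_trans _ _ (kap * f x * (M x `^ beta * P (T x) `^ beta))).
      by rewrite ler_wpM2l// mulr_ge0.
    by rewrite mulrCA ler_wpM2l// ltW.
  rewrite mulrA ler_pdivrMr// mulrAC ler_pdivlMr// -(ler_pM2r p0').
  apply: le_trans (le_trans h1 _); first by rewrite mulrA.
  by rewrite mulrCA mulrA.
have Du0 : 0 < D * u by rewrite mulr_gt0.
(* The largest scale at which the contraction is available; there it loses at most half of the
   mass. *)
pose v : R := (2 * D)^-1.
have v0 : 0 < v by rewrite invr_gt0 mulr_gt0.
have Dv : 2 * D * v = 1 by rewrite divff// gt_eqF// mulr_gt0.
have uv : u <= v by rewrite -(ler_pM2l (_ : 0 < 2 * D)) ?Dv// mulr_gt0.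
have Dv' : 1 - D * v = 2^-1 by rewrite -mulrA in Dv; lra.
have nearZ : (\int[mu]_(x in Om `&` ~` far u) (f1 x)%:E <= (D * u)%:E * Z)%E.
  have := farZ u u0 Du (lexx _); move: (splitZ u).
  set A := (\int[mu]_(x in Om `&` far u) _)%E; set B := (\int[mu]_(x in _) _)%E => ZAB.
  have A0 : (0 <= A)%E by apply: integral_ge0 => x _; rewrite lee_fin.
  have B0 : (0 <= B)%E by apply: integral_ge0 => x _; rewrite lee_fin.
  have Zoo : (Z < +oo)%E by rewrite ltey_eq Zfin.
  have Af : A \is a fin_num.
    by rewrite ge0_fin_numE// (le_lt_trans _ Zoo)// ZAB leeDl.
  have Bf : B \is a fin_num.
    by rewrite ge0_fin_numE// (le_lt_trans _ Zoo)// ZAB leeDr.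
  rewrite ZAB -(fineK Af) -(fineK Bf) -EFinD -!EFinM !lee_fin => h; nra.
have farM : (Z <= (2 * (v ^+ m) `^ (- beta))%:E * \int[mu]_(x in Om) (f x)%:E)%E.
  have := farZ v v0; rewrite Dv Dv' => /(_ (lexx _) uv) h.
  have -> : Z = (2%:E * (2^-1%:E * Z))%E by rewrite muleA -EFinM mulfV// mul1e.
  rewrite EFinM -muleA lee_wpmul2l// ?lee_fin//; apply: (le_trans h).
  rewrite -ge0_integralZl_EFin ?powR_ge0//; last exact: measurable_funTS.
  apply: (@le_trans _ _ (\int[mu]_(x in Om `&` far v) (((v ^+ m) `^ (- beta))%:E * (f x)%:E))%E).
    apply: ge0_le_integral => //.
    - exact: measurableI.
    - by move=> x _; rewrite lee_fin.
    - exact: measurable_funTS.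
    - by apply: measurable_funeM; exact: measurable_funTS.
    move=> x [xOm xf]; rewrite -EFinM lee_fin /f1 mulrC ler_wpM2r//.
    rewrite powRN lef_pV2 ?posrE ?powR_gt0// ?exprn_gt0//.
    apply: ge0_ler_powR; rewrite ?nnegrE ?exprn_ge0 ?(ltW (M0 _)) ?(ltW v0)//.
    rewrite prodE; apply: ler_prod => k _.
    by rewrite (ltW v0)/= le_max (ltW (xf k _)).
  apply: ge0_subset_integral => //.
  - exact: measurableI.
  - by apply: measurable_funeM; exact: measurable_funTS.
  - by move=> x _; rewrite -EFinM lee_fin mulr_ge0// powR_ge0.
apply: (@le_trans _ _ (((u ^+ m) `^ beta)%:E * \int[mu]_(x in Om `&` ~` far u) (f1 x)%:E)%E).
  rewrite -ge0_integralZl_EFin ?powR_ge0//; last 3 first.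
  - by apply: measurableI => //; exact: measurableC.
  - by move=> x _; rewrite lee_fin.
  - exact: measurable_funTS.
  apply: (@le_trans _ _ (\int[mu]_(x in Om `&` near u) (((u ^+ m) `^ beta)%:E * (f1 x)%:E))%E).
    apply: ge0_le_integral => //.
    - exact: measurable_funTS.
    - by apply: measurable_funeM; exact: measurable_funTS.
    move=> x [_ xn]; rewrite -EFinM lee_fin ff1 mulrC ler_wpM2r//.
    apply: ge0_ler_powR; rewrite ?nnegrE ?(ltW (M0 _)) ?(ltW um0)//.
    rewrite prodE; apply: ler_prod => k _.
    by rewrite le_max (ltW u0) orbT/= ge_max lexx xn.
  apply: ge0_subset_integral => //.
  - by apply: measurableI => //; exact: measurableC.
  - by apply: measurable_funeM; exact: measurable_funTS.
  - by move=> x _; rewrite -EFinM lee_fin mulr_ge0// powR_ge0.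
  (* Since there is at least one gap, [near u] and [far u] are disjoint. *)
  - move=> x [xOm xn]; split => // /(_ 0%N m0); apply/negP; rewrite -leNgt; exact: xn.
apply: (@le_trans _ _ (((u ^+ m) `^ beta)%:E * ((D * u)%:E *
    ((2 * (v ^+ m) `^ (- beta))%:E * \int[mu]_(x in Om) (f x)%:E)))%E).
  rewrite lee_wpmul2l ?lee_fin ?powR_ge0//; apply: (le_trans nearZ).
  by rewrite lee_wpmul2l ?lee_fin ?(ltW Du0).
rewrite !muleA -!EFinM lee_wpmul2r ?integral_ge0// lee_fin.
rewrite le_eqVlt; apply/orP; left; apply/eqP.
have Du20 : 0 < 2 * D * u by rewrite mulr_gt0// mulr_gt0.
rewrite powRD ?(gt_eqF Du20) ?implybT// powRr1 ?(ltW Du20)// powRrM powR_mulrn ?(ltW Du20)//.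
have vm0 : 0 <= v ^+ m by rewrite exprn_ge0// ltW.
have -> : (2 * D * u) ^+ m = u ^+ m * (v ^+ m) `^ (-1).
  by rewrite powR_inv1// -exprVn invrK exprMn mulrC.
rewrite powRM ?(ltW um0) ?powR_ge0// -powRrM mulN1r.
ring.
Qed.

End repulsion_of_contraction.

(** * The logarithmic energy under a contraction *)

Lemma ler_sum_seq (R : numDomainType) (I : eqType) (r : seq I) (P : pred I) (F G : I -> R) :
  (forall i, i \in r -> P i -> F i <= G i) ->
  \sum_(i <- r | P i) F i <= \sum_(i <- r | P i) G i.
Proof.
move=> FG; rewrite big_seq_cond [leRHS]big_seq_cond.
by apply: ler_sum => i /andP[ir]; exact: FG.
Qed.

Section log_energy_contraction.
Context {R : realType}.

(** Each pair is counted twice, and the diagonal contributes [ln 0 = 0]. *)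
Definition pair_energy (r : seq nat) (z : nat -> R) : R :=
  \sum_(i <- r) \sum_(j <- r) ln `|z i - z j|.

Lemma ln1B_ge (x : R) : 0 <= x <= 2^-1 -> - (2 * x) <= ln (1 - x).
Proof.
move=> /andP[x0 x1]; have y0 : 0 < 1 - x by lra.
rewrite -[ln _]opprK -lnV ?posrE// lerN2.
have -> : (1 - x)^-1 = 1 + x / (1 - x) by field; rewrite gt_eqF.
apply: (le_trans (le_ln1Dx _)).
  by apply: (@lt_le_trans _ _ 0); [lra|rewrite divr_ge0// ltW].
rewrite ler_pdivrMr//; nra.
Qed.

Variables (r : seq nat) (W Q : pred nat) (o p : nat) (l phi : R) (a : nat -> R).
Hypotheses (ur : uniq r) (ro : o \in r) (Wo : ~~ W o) (Wp : ~~ W p).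
Hypotheses (QW : forall i, Q i -> W i) (l0 : 0 < l) (phi0 : 0 <= phi <= 2^-1).
Hypotheses (a0 : forall j, 0 <= a j) (aW : forall j, W j -> 1 <= a j).

Let contracted (z : nat -> R) i := if W i then z i + phi * (z p - z i) else z i.

(** The gains of the pairs formed by [o] and a member of [Q] are kept exactly, because the weights
    dividing the density cancel them; every other gain is dropped. Losses are charged to the moved
    particles, [a j] bounding the relative displacement seen from [j]; pairs inside the window fit
    the same scheme because [a >= 1] there. *)
Let pair_energy_contract_right (z : nat -> R) :
  (forall i, i \in r -> W i -> z o < z i < z p) ->
  (forall i, i \in r -> ~~ W i -> z i <= z o \/ z p <= z i) ->
  (forall i j, i \in r -> j \in r -> i != j -> z i != z j) ->
  l <= z p - z o <= 4 * l ->
  (forall j, j \in r -> ~~ W j -> z p <= z j -> 4 * l / (z j - z p + l) <= a j) ->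
  2 * \sum_(i <- r | Q i) (ln `|contracted z i - z o| - ln `|z i - z o|)
  - 4 * phi * (\sum_(i <- r | W i) 1) * (\sum_(j <- r) a j)
  <= pair_energy r (contracted z) - pair_energy r z.
Proof.
move=> zW zNW zinj lz ap; set z' := contracted z.
have [phi00 phi12] := andP phi0.
have z'W i : W i -> z' i = z i + phi * (z p - z i) by rewrite /z' /contracted => ->.
have z'N i : ~~ W i -> z' i = z i by rewrite /z' /contracted => /negbTE ->.
pose De i j := ln `|z' i - z' j| - ln `|z i - z j|.
have DeC i j : De i j = De j i by rewrite /De distrC [X in _ - ln X]distrC.
have ln1 (x y : R) : 0 < x -> x <= y -> 0 <= ln y - ln x.
  by move=> x0 xy; rewrite subr_ge0 ler_ln ?posrE// (lt_le_trans x0).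
have DeWN i j : i \in r -> j \in r -> W i -> ~~ W j -> - (2 * phi * a j) <= De i j.
  move=> ir jr Wi Wj; have /andP[zo zp] := zW _ ir Wi.
  rewrite /De z'W// (z'N _ Wj); have [zj|zj] := zNW _ jr Wj.
    apply: (@le_trans _ _ 0); first by rewrite oppr_le0 !mulr_ge0.
    rewrite [X in ln X - _]gtr0_norm ?[X in _ - ln X]gtr0_norm; [|nra|nra].
    by apply: ln1; [lra|nra].
  have zij : 0 < z j - z i by lra.
  rewrite distrC [X in _ - ln X]distrC (gtr0_norm zij).
  pose q := (z p - z i) / (z j - z i).
  have q0 : 0 <= q by rewrite divr_ge0// ltW// subr_gt0.
  have q1 : q <= 1 by rewrite ler_pdivrMr// mul1r; lra.
  (* With [t = z p - z i <= 4 * l] and [d = z j - z p >= 0], the ratio [q = t / (d + t)] is at most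
     [4 * l / (d + l)]. *)
  have qa : q <= a j.
    apply: le_trans (ap _ jr Wj zj).
    rewrite ler_pdivrMr// mulrAC ler_pdivlMr; last by lra.
    by move/andP: lz => [lz1 lz2]; nra.
  have e : z j - (z i + phi * (z p - z i)) = (z j - z i) * (1 - phi * q).
    by rewrite /q; field; rewrite gt_eqF.
  have pq : 0 < 1 - phi * q by nra.
  rewrite e gtr0_norm ?mulr_gt0// lnM ?posrE// addrC addKr.
  apply: (@le_trans _ _ (- (2 * (phi * q)))); first by rewrite lerN2 -mulrA; nra.
  by apply: ln1B_ge; apply/andP; split; nra.
have De0 i : De i i = 0 by rewrite /De !subrr.
(* [cost] charges each moved member of a pair with the weight of the other member, which makes the
   double sum factor; [S] records the gains that are kept, in both orders of the pair. *)
pose cost i j := 2 * phi * ((W i)%:R * a j + (W j)%:R * a i).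
pose S i j := (Q i && (j == o))%:R * De i o + (Q j && (i == o))%:R * De j o.
have key i j : i \in r -> j \in r -> S i j - cost i j <= De i j.
  move=> ir jr; have cost0 : 0 <= cost i j.
    by rewrite !mulr_ge0// addr_ge0// mulr_ge0.
  have Qo k : W k -> (k == o) = false.
    by move=> Wk; apply/negbTE; apply: contraNneq Wo => <-.
  have QN k : ~~ W k -> Q k = false.
    by move=> Wk; apply/negbTE; apply: contra Wk; exact: QW.
  have [->|ij] := eqVneq i j.
    rewrite De0 subr_le0 /S; case Qj : (Q j); last by rewrite /= !mul0r addr0 !mulr_ge0// addr_ge0// mulr_ge0.
    by rewrite (Qo _ (QW Qj)) /= !mul0r addr0 !mulr_ge0// addr_ge0// mulr_ge0.
  rewrite /S; have [Wi|Wi] := boolP (W i); have [Wj|Wj] := boolP (W j).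
  - rewrite !Qo// !andbF !mul0r addr0 add0r /De !z'W//.
    have -> : z i + phi * (z p - z i) - (z j + phi * (z p - z j)) = (1 - phi) * (z i - z j) by ring.
    have f0 : 0 < 1 - phi by lra.
    have zij : 0 < `|z i - z j| by rewrite normr_gt0 subr_eq0 zinj.
    rewrite normrM (gtr0_norm f0) lnM ?posrE// addrK.
    apply: (@le_trans _ _ (- (2 * phi))); last exact: ln1B_ge.
    rewrite lerN2 /cost Wi Wj !mul1r ler_peMr ?mulr_ge0//.
    by have := aW Wi; have := aW Wj; lra.
  - rewrite (Qo _ Wi) andbF mul0r addr0 /cost Wi (negbTE Wj) mul1r mul0r addr0.
    have [/andP[_ /eqP ->]|_] := boolP (Q i && (j == o)).
      by rewrite mul1r gerBl !mulr_ge0.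
    by rewrite mul0r sub0r DeWN.
  - rewrite (Qo _ Wj) andbF mul0r add0r /cost Wj (negbTE Wi) mul1r mul0r add0r.
    have [/andP[_ /eqP ->]|_] := boolP (Q j && (i == o)).
      by rewrite mul1r (DeC o) gerBl !mulr_ge0.
    by rewrite mul0r sub0r DeC DeWN.
  - by rewrite !QN// !mul0r addr0 sub0r /De !z'N// subrr oppr_le0.
have pick (F : nat -> R) : \sum_(j <- r) (j == o)%:R * F j = F o.
  rewrite (bigD1_seq o)//= eqxx mul1r big1 ?addr0// => j /negbTE ->.
  by rewrite mul0r.
have -> : pair_energy r z' - pair_energy r z = \sum_(i <- r) \sum_(j <- r) De i j.
  by rewrite /pair_energy -sumrB; apply: eq_bigr => i _; rewrite -sumrB.
apply: (@le_trans _ _ (\sum_(i <- r) \sum_(j <- r) (S i j - cost i j))); last first.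
  by apply: ler_sum_seq => i ir _; apply: ler_sum_seq => j jr _; exact: key.
have sS : \sum_(i <- r) \sum_(j <- r) S i j = 2 * \sum_(i <- r | Q i) De i o.
  under eq_bigr do rewrite big_split/=.
  rewrite big_split/= [X in _ + X]exchange_big/= mulr_natl mulr2n; congr (_ + _).
    rewrite [RHS]big_mkcond/=; apply: eq_bigr => i _.
    under eq_bigr do rewrite -mulnb natrM -mulrA mulrCA.
    by rewrite (pick (fun j => (Q i)%:R * De i o)); case: (Q i); rewrite ?mul1r ?mul0r.
  rewrite [RHS]big_mkcond/=; apply: eq_bigr => i _.
  under eq_bigr do rewrite -mulnb natrM -mulrA mulrCA.
  by rewrite (pick (fun j => (Q i)%:R * De i o)); case: (Q i); rewrite ?mul1r ?mul0r.
have sc : \sum_(i <- r) \sum_(j <- r) cost i j =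
    4 * phi * (\sum_(i <- r | W i) 1) * (\sum_(j <- r) a j).
  rewrite /cost; under eq_bigr do rewrite -mulr_sumr big_split/=.
  rewrite -mulr_sumr big_split/=.
  have h : \sum_(i <- r) \sum_(j <- r) (W i)%:R * a j = (\sum_(i <- r | W i) 1) * (\sum_(j <- r) a j).
    rewrite mulr_suml [RHS]big_mkcond; apply: eq_bigr => i _; rewrite -mulr_sumr.
    by case: (W i); rewrite ?mul1r ?mul0r.
  rewrite h [X in _ + X]exchange_big/= h; ring.
under [leRHS]eq_bigr do rewrite sumrB.
rewrite [leRHS]sumrB sS sc lerB// ler_wpM2l//; apply: ler_sum_seq => i ir Qi.
by rewrite /De (z'N _ Wo).
Qed.

(* [sg] is the orientation of the window: [p] lies to the right of [o] for
   [sg = 1] and to the left for [sg = -1]. *)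
Lemma pair_energy_contract (sg : R) (z : nat -> R) : `|sg| = 1 ->
  (forall i, i \in r -> W i -> 0 < sg * (z i - z o) /\ 0 < sg * (z p - z i)) ->
  (forall i, i \in r -> ~~ W i -> sg * (z i - z o) <= 0 \/ 0 <= sg * (z i - z p)) ->
  (forall i j, i \in r -> j \in r -> i != j -> z i != z j) ->
  l <= sg * (z p - z o) <= 4 * l ->
  (forall j, j \in r -> ~~ W j -> 0 <= sg * (z j - z p) ->
     4 * l / (sg * (z j - z p) + l) <= a j) ->
  2 * \sum_(i <- r | Q i) (ln `|contracted z i - z o| - ln `|z i - z o|)
  - 4 * phi * (\sum_(i <- r | W i) 1) * (\sum_(j <- r) a j)
  <= pair_energy r (contracted z) - pair_energy r z.
Proof.
move=> sg1 zW zNW zinj lz ap; pose y i := sg * z i.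
have sg0 : sg != 0 by rewrite -normr_eq0 sg1 oner_neq0.
have yN i j : `|y i - y j| = `|z i - z j| by rewrite /y -mulrBr normrM sg1 mul1r.
have cN i j : `|contracted y i - contracted y j| = `|contracted z i - contracted z j|.
  rewrite (_ : contracted y i - _ = sg * (contracted z i - contracted z j)).
    by rewrite normrM sg1 mul1r.
  by rewrite /contracted /y; case: (W i); case: (W j); ring.
have coN i : `|contracted y i - y o| = `|contracted z i - z o|.
  by have := cN i o; rewrite /contracted (negbTE Wo).
have := @pair_energy_contract_right y.
have -> : pair_energy r y = pair_energy r z.
  by apply: eq_bigr => i _; apply: eq_bigr => j _; rewrite yN.
have -> : pair_energy r (contracted y) = pair_energy r (contracted z).
  by apply: eq_bigr => i _; apply: eq_bigr => j _; rewrite cN.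
under eq_bigr do rewrite yN coN.
apply.
- by move=> i ir /(zW _ ir); rewrite /y !mulrBr !subr_gt0 => -[-> ->].
- by move=> i ir /(zNW _ ir); rewrite /y !mulrBr subr_le0 subr_ge0.
- by move=> i j ir jr ij; rewrite /y (inj_eq (mulfI sg0)) zinj.
- by rewrite /y -mulrBr.
- by move=> j jr Wj; rewrite /y -subr_ge0 -mulrBr => /(ap _ jr Wj).
Qed.

End log_energy_contraction.

(** * The full configuration *)

Section full_configuration.
Context {R : realType}.
Local Notation mR := (measurableTypeR R).
Variables (N L K : nat) (y : nat -> R).
Hypotheses (hL : (K.+1 < L)%N) (hN : (L + K < N)%N).
Local Notation n := K.*2.+1.
Local Notation z := (full_config L K y).
Local Notation r := (index_iota 1 N.+1).

Lemma full_config_out x j : ~~ in_window L K j -> z x j = y j.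
Proof. by rewrite /full_config => /negbTE ->. Qed.

Lemma in_window_ord (m : 'I_n) : in_window L K (L - K + m)%N.
Proof. by have := ltn_ord m; rewrite /in_window; lia. Qed.

Lemma full_config_in (x : n.-tuple R) (m : 'I_n) : z x (L - K + m)%N = tnth x m.
Proof.
rewrite /full_config in_window_ord (tnth_nth 0); congr nth; lia.
Qed.

Lemma in_window_ex j : in_window L K j -> exists m : 'I_n, j = (L - K + m)%N.
Proof.
rewrite /in_window => h; have jn : (j - (L - K) < n)%N by lia.
by exists (Ordinal jn) => /=; lia.
Qed.

Lemma measurable_full_config j :
  measurable_fun [set: n.-tuple mR] (fun x => z x j).
Proof.
have [/in_window_ex[m ->]|jw] := boolP (in_window L K j).
  by under eq_fun do rewrite full_config_in; exact: measurable_tnth.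
under eq_fun do rewrite (full_config_out _ jw).
exact: measurable_cst.
Qed.

Lemma measurable_ordered_in_J : measurable (ordered_in_J L K y).
Proof.
rewrite (_ : ordered_in_J L K y = \bigcap_(j in [set j | (L - K.+1 <= j <= L + K)%N])
    [set x | z x j < z x j.+1]); last first.
  by apply/seteqP; split => x h j; exact: h.
apply: bigcap_measurableType => j _.
by apply: measurable_set_lt; exact: measurable_full_config.
Qed.

Lemma ordered_in_J_homo x : ordered_outside N L K y -> ordered_in_J L K y x ->
  forall j k, (1 <= j)%N -> (j < k)%N -> (k <= N)%N -> z x j < z x k.
Proof.
move=> yo xo.
have step j : (1 <= j)%N -> (j < N)%N -> z x j < z x j.+1.
  move=> j1 jN; have [h|h] := boolP (L - K.+1 <= j <= L + K)%N; first exact: xo.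
  rewrite !full_config_out; [|by rewrite /in_window; lia..].
  by apply: yo; rewrite /out_window /in_window; lia.
move=> j k j1 jk; elim: k jk => // k IH jk kN.
have [jk'|kj] := ltnP j k; last by have -> : j = k; [lia|apply: step; lia].
by apply: lt_trans (IH jk' _) (step k _ _); lia.
Qed.

Lemma sum_in_window (F : nat -> R) :
  \sum_(j <- r | in_window L K j) F j = \sum_(m < n) F (L - K + m)%N.
Proof.
rewrite -(big_mkord xpredT (fun m => F (L - K + m)%N)).
rewrite (_ : \sum_(0 <= i < n) _ = \sum_(L - K <= j < L + K.+1) F j); last first.
  rewrite -[in RHS](add0n (L - K)%N) big_addn.
  have -> : (L + K.+1 - (L - K) = n)%N by lia.
  by apply: eq_bigr => i _; rewrite addnC.
rewrite (big_cat_nat _ (n := L - K))//=; [|lia..].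
rewrite [X in X + _]big_nat_cond [X in X + _]big_pred0 ?add0r; last first.
  by move=> i; rewrite /in_window; lia.
rewrite (big_cat_nat _ (n := L + K.+1))//=; [|lia..].
rewrite [X in _ + X]big_nat_cond [X in _ + X]big_pred0 ?addr0; last first.
  by move=> i; rewrite /in_window; lia.
rewrite big_nat_cond [RHS]big_nat_cond; apply: eq_bigl => i; rewrite /in_window; lia.
Qed.

Lemma sum_sym_ord (g : 'I_n -> 'I_n -> R) :
  (forall i j, g i j = g j i) -> (forall i, g i i = 0) ->
  \sum_(i < n) \sum_(j < n) g i j = 2 * \sum_(i < n) \sum_(j < n | (i < j)%N) g i j.
Proof.
move=> gC g0.
have h (i : 'I_n) : \sum_(j < n) g i j =
    \sum_(j < n | (i < j)%N) g i j + \sum_(j < n | (j < i)%N) g i j.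
  rewrite (bigID (fun j : 'I_n => (i < j)%N))/=; congr (_ + _).
  rewrite (bigD1 i) ?ltnn//= g0 add0r; apply: eq_bigl => j.
  by rewrite -leqNgt ltn_neqAle andbC.
under eq_bigr do rewrite h.
rewrite big_split/= mulr_natl mulr2n; congr (_ + _).
rewrite (exchange_big_dep xpredT)//=; apply: eq_bigr => i _.
by apply: eq_bigr => j _; rewrite gC.
Qed.

(** Up to a term depending on [y] only, the interaction in the local Hamiltonian is [- beta / 2]
    times the pair energy of the whole configuration, so that energy estimates for all [N] particles
    apply to the local measure. *)
Lemma H_locE (V : R -> R) (beta : R) (x : n.-tuple R) :
  N%:R * beta * H_loc V N L K y x =
  N%:R * beta / 2 * \sum_(j <- r | in_window L K j) V (z x j)
  - beta / 2 * (pair_energy r (z x) -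
     \sum_(i <- r | ~~ in_window L K i) \sum_(j <- r | ~~ in_window L K j) ln `|y i - y j|).
Proof.
have N0 : (N%:R : R) != 0 by rewrite pnatr_eq0; lia.
pose Vi := \sum_(j <- r | in_window L K j) V (z x j).
pose io := \sum_(i <- r | in_window L K i) \sum_(j <- r | ~~ in_window L K j) ln `|z x i - z x j|.
pose ii := \sum_(i < n) \sum_(j < n | (i < j)%N) ln `|tnth x j - tnth x i|.
have -> : H_loc V N L K y x = 2^-1 * (Vi - 2 / N%:R * io) - N%:R^-1 * ii.
  rewrite /H_loc; congr (_ * _ - _); rewrite /Vi /io !sum_in_window mulr_sumr -sumrB.
  apply: eq_bigr => m _; rewrite /V_loc full_config_in; congr (_ - _ * _).
  rewrite big_seq_cond [RHS]big_seq_cond; apply: eq_big => j.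
    by rewrite mem_index_iota /out_window; lia.
  by move=> /andP[_ /andP[_ jw]]; rewrite (full_config_out _ jw).
have iiE : \sum_(i <- r | in_window L K i) \sum_(j <- r | in_window L K j) ln `|z x i - z x j| = 2 * ii.
  rewrite sum_in_window; under eq_bigr do rewrite sum_in_window.
  rewrite (sum_sym_ord (g := fun i j : 'I_n => ln `|z x (L - K + i)%N - z x (L - K + j)%N|)).
  - by congr (_ * _); apply: eq_bigr => i _; apply: eq_bigr => j _; rewrite !full_config_in distrC.
  - by move=> i j; rewrite distrC.
  - by move=> i; rewrite subrr normr0 ln0.
have -> : pair_energy r (z x) = 2 * ii + 2 * io +
    \sum_(i <- r | ~~ in_window L K i) \sum_(j <- r | ~~ in_window L K j) ln `|y i - y j|.
  pose A (P Q : pred nat) := \sum_(i <- r | P i) \sum_(j <- r | Q j) ln `|z x i - z x j|.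
  pose w := in_window L K; pose v := predC w.
  have AE P : \sum_(i <- r | P i) \sum_(j <- r) ln `|z x i - z x j| = A P w + A P v.
    by rewrite /A -big_split/=; apply: eq_bigr => i _; rewrite (bigID w).
  have -> : \sum_(i <- r | ~~ in_window L K i) \sum_(j <- r | ~~ in_window L K j) ln `|y i - y j| = A v v.
    by apply: eq_bigr => i iw; apply: eq_bigr => j jw; rewrite !full_config_out.
  have Avw : A v w = A w v.
    rewrite /A exchange_big/=; apply: eq_bigr => i _; apply: eq_bigr => j _; by rewrite distrC.
  have ioE : io = A w v by [].
  have iiE' : A w w = 2 * ii by exact: iiE.
  by rewrite /pair_energy (bigID w)/= (AE w) (AE v) Avw iiE' ioE; ring.
rewrite -/Vi; field.
exact: N0.
Qed.

End full_configuration.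

(** * Repulsion from a window of particles *)

Lemma measurable_sum_cond d (X : measurableType d) (R : realType) (I : Type)
    (s : seq I) (P : pred I) (h : I -> X -> R) :
  (forall i, measurable_fun setT (h i)) ->
  measurable_fun setT (fun x => \sum_(i <- s | P i) h i x).
Proof.
move=> mh; under eq_fun do rewrite -big_filter.
exact: measurable_sum.
Qed.

(** A moved particle at [a] does not overtake an unmoved one at [b]: it either moves away from [b]
    or stops short of the pivot, and no unmoved particle lies strictly between [zo] and [zp]. *)
Lemma contraction_lt (R : realType) (sg phi a b zo zp : R) :
  sg = 1 \/ sg = -1 -> 0 <= phi < 1 -> a < b ->
  0 < sg * (a - zo) -> 0 < sg * (zp - a) -> sg * (b - zo) <= 0 \/ 0 <= sg * (b - zp) ->
  a + phi * (zp - a) < b.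
Proof. by move=> [->|->] /andP[p0 p1] ab h1 h2 [h3|h3]; nra. Qed.

Section window_repulsion.
Context {R : realType}.
Local Notation mR := (measurableTypeR R).
Variables (V : R -> R) (beta : R) (N L K : nat) (y : nat -> R).
Hypotheses (mV : measurable_fun setT V) (beta0 : 0 < beta).
Hypotheses (hL : (K.+1 < L)%N) (hN : (L + K < N)%N) (yo : ordered_outside N L K y).
Local Notation n := K.*2.+1.
Local Notation z := (full_config L K y).
Local Notation r := (index_iota 1 N.+1).
Local Notation weight x := (expR (- (N%:R * beta * H_loc V N L K y x))).

Lemma measurable_H_loc :
  measurable_fun [set: n.-tuple mR] (fun x => H_loc V N L K y x).
Proof.
rewrite /H_loc; apply: measurable_funB.
  apply: measurable_funM => //; apply: measurable_sum => i.
  apply: measurable_funB; first by apply: measurableT_comp => //; exact: measurable_tnth.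
  apply: measurable_funM => //; apply: measurable_sum_cond => j.
  apply: measurableT_comp => //; apply: measurableT_comp => //.
  by apply: measurable_funB => //; exact: measurable_tnth.
apply: measurable_funM => //; apply: measurable_sum => i.
apply: measurable_sum_cond => j.
apply: measurableT_comp => //; apply: measurableT_comp => //.
by apply: measurable_funB => //; exact: measurable_tnth.
Qed.

Lemma measurable_weight : measurable_fun [set: n.-tuple mR] (fun x => weight x).
Proof.
apply: measurableT_comp => //; apply: measurableT_comp => //.
by apply: measurable_funM => //; exact: measurable_H_loc.
Qed.

Lemma le_mass_loc (E F : set (n.-tuple mR)) : measurable E -> measurable F ->
  ordered_in_J L K y `&` E `<=` F ->
  (mass_loc V beta N L K y E <= mass_loc V beta N L K y F)%E.
Proof.
move=> mE mF EF; apply: ge0_subset_integral => //.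
- by apply: measurableI => //; exact: measurable_ordered_in_J.
- by apply: measurableI => //; exact: measurable_ordered_in_J.
- by apply: measurable_funTS; apply/measurable_EFinP; exact: measurable_weight.
- by move=> x [xo xE]; split => //; apply: EF.
Qed.

Variables (W : pred nat) (o p m : nat) (e : nat -> nat) (sg l S M Lp lo hi : R).
Variables (a : nat -> R) (G : set (n.-tuple mR)).
Hypotheses (hW : forall j, W j -> in_window L K j) (ho : (1 <= o <= N)%N) (hp : (1 <= p <= N)%N).
Hypothesis geom : (sg = 1 /\ forall j, W j = (o < j < p)%N) \/
  (sg = -1 /\ forall j, W j = (p < j < o)%N).
Hypotheses (m0 : (0 < m)%N) (We : forall k, (k < m)%N -> W (e k)).
Hypothesis e_inj : {in gtn m &, injective e}.
Hypotheses (l0 : 0 < l) (a0 : forall j, 0 <= a j) (aW : forall j, W j -> 1 <= a j).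
Hypotheses (aS : \sum_(j <- r) a j <= S) (WM : \sum_(j <- r | W j) 1 <= M).
Hypotheses (lo_y : lo <= y (L - K.+1)%N) (y_hi : y (L + K.+1)%N <= hi) (Lp0 : 0 <= Lp).
Hypothesis V_lip : forall s t, lo <= s <= hi -> lo <= t <= hi -> `|V s - V t| <= Lp * `|s - t|.
Hypotheses (mG : measurable G)
  (Gout : forall x x', (forall j, ~~ W j -> z x j = z x' j) -> G x -> G x').
Hypothesis Gl : forall x, ordered_in_J L K y x -> G x -> l <= sg * (z x p - z x o) <= 4 * l.
Hypothesis Ga : forall x, ordered_in_J L K y x -> G x -> forall j, (1 <= j <= N)%N ->
  ~~ W j -> 0 <= sg * (z x j - z x p) -> 4 * l / (sg * (z x j - z x p) + l) <= a j.

(** The three costs of opening the gap by one unit: the Jacobian, the pair energy and the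
    potential. *)
Let D := 2 * M / l + 2 * beta * M * S / l + 2 * N%:R * beta * M * Lp.

Let w := [seq k : 'I_n <- enum 'I_n | W (L - K + k)%N].

Let T (phi : R) := tuple_affine (mem w) (1 - phi) (fun x : n.-tuple mR => phi * z x p).

Let Wo : ~~ W o. Proof. by case: geom => -[_ ->]; clear; lia. Qed.

Let Wp : ~~ W p. Proof. by case: geom => -[_ ->]; clear; lia. Qed.

Let full_config_T phi x j :
  z (T phi x) j = if W j then z x j + phi * (z x p - z x j) else z x j.
Proof.
have [jw|jw] := boolP (in_window L K j); last first.
  by rewrite (contraNF (@hW j) jw) !full_config_out.
have [k ->] := in_window_ex hL hN jw.
rewrite !(full_config_in y hL hN) tnth_mktuple /= mem_filter mem_enum andbT.
by case: ifP => // _; ring.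
Qed.

Let size_w : \sum_(j <- r | W j) 1 = (size w)%:R :> R.
Proof.
transitivity (\sum_(j <- r | in_window L K j) (W j)%:R : R).
  rewrite big_mkcond [RHS]big_mkcond; apply: eq_bigr => j _.
  have [/hW -> //|_] := boolP (W j); by case: ifP.
rewrite sum_in_window// -natr_sum; congr (_%:R).
by rewrite -sum1_size big_filter big_enum_cond/= [RHS]big_mkcond; apply: eq_bigr => i _ /=; case: (W _).
Qed.

(** By [Gout] the event [G] sees unmoved particles only, so the contraction maps the ordered
    configurations in [G] to themselves. The lower bound in [Gl] makes the gap open enough; the
    upper bound limits the displacement of the particles. *)
Lemma window_repulsion (u : R) : 0 < u ->
  (mass_loc V beta N L K y setT < +oo)%E ->
  (mass_loc V beta N L K y (G `&` [set x | forall k, (k < m)%N -> (`|z x (e k) - z x o| <= u)%R])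
   <= ((2 * D * u) `^ (m%:R * beta + 1))%R%:E * mass_loc V beta N L K y setT)%E.
Proof.
move=> u0 fin.
pose Om := ordered_in_J L K y `&` G.
pose g k x := `|z x (e k) - z x o|.
have mz := @measurable_full_config _ N L K y hL hN.
have mphi phi : measurable_fun setT (fun x => phi * z x p).
  by apply: measurable_funM; [exact: measurable_cst|exact: mz].
have mw := measurable_weight.
have mOm : measurable Om by apply: measurableI => //; exact: measurable_ordered_in_J.
have mg k : measurable_fun setT (g k).
  by apply: measurableT_comp => //; apply: measurable_funB; exact: mz.
have cnt0 : 1 <= \sum_(j <- r | W j) (1 : R).
  have eW := We m0.
  have er : e 0 \in r by move: (hW eW) hL hN; rewrite mem_index_iota /in_window; clear; lia.
  rewrite big_mkcond (bigD1_seq (e 0))//= ?iota_uniq// eW lerDl.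
  by rewrite sumr_ge0// => i _; case: ifP.
have M1 : 1 <= M := le_trans cnt0 WM.
have S0 : 0 <= S by apply: le_trans aS; exact: sumr_ge0.
have D0 : 2 / l <= D.
  rewrite /D -addrA -[leLHS]addr0 lerD//.
    by rewrite ler_pM2r ?invr_gt0//; lra.
  by rewrite addr_ge0 ?mulr_ge0 ?invr_ge0 ?(ltW l0) ?(ltW beta0) ?(le_trans _ M1).
have l2 : 0 < 2 / l by rewrite divr_gt0.
have D00 : 0 < D := lt_le_trans l2 D0.
have zlt x := @ordered_in_J_homo _ N L K y hL hN x yo.
have sg1 : `|sg| = 1 by case: geom => -[-> _]; rewrite ?normrN normr1.
have zW x : Om x -> forall j, j \in r -> W j ->
    0 < sg * (z x j - z x o) /\ 0 < sg * (z x p - z x j).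
  move=> [xo _] j; rewrite mem_index_iota => jr Wj.
  case: geom => -[-> WE]; move: Wj; rewrite WE => Wj.
    by rewrite !mul1r !subr_gt0; split; apply: zlt => //; move: jr Wj ho hp; clear; lia.
  by rewrite !mulN1r !oppr_gt0 !subr_lt0; split; apply: zlt => //; move: jr Wj ho hp; clear; lia.
have zN x : Om x -> forall j, j \in r -> ~~ W j ->
    sg * (z x j - z x o) <= 0 \/ 0 <= sg * (z x j - z x p).
  move=> [xo _] j; rewrite mem_index_iota => jr Wj.
  have zle i k : (1 <= i)%N -> (i <= k)%N -> (k <= N)%N -> z x i <= z x k.
    move=> i1; rewrite leq_eqVlt => /predU1P[->//|ik] kN; exact/ltW/zlt.
  case: geom => -[-> WE]; move: Wj; rewrite WE => Wj.
    rewrite !mul1r subr_le0 subr_ge0; have [jo|jo] := leqP j o; [left|right]; apply: zle; move: jo jr Wj ho hp; clear; lia.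
  rewrite !mulN1r oppr_le0 oppr_ge0 subr_le0 subr_ge0.
  by have [jo|jo] := leqP o j; [left|right]; apply: zle; move: jo jr Wj ho hp; clear; lia.
have zinj x : Om x -> forall i j, i \in r -> j \in r -> i != j -> z x i != z x j.
  move=> [xo _] i j; rewrite !mem_index_iota neq_ltn => ir jr /orP[] ij.
    by rewrite lt_eqF// zlt//; move: ij ir jr; clear; lia.
  by rewrite gt_eqF// zlt//; move: ij ir jr; clear; lia.
have zJ x : ordered_in_J L K y x -> forall j, in_window L K j -> lo <= z x j <= hi.
  move=> xo j jw; have jw' := jw; rewrite /in_window in jw'.
  have h1 : z x (L - K.+1)%N < z x j by apply: zlt => //; move: jw' hL hN; clear; lia.
  have h2 : z x j < z x (L + K.+1)%N by apply: zlt => //; move: jw' hL hN; clear; lia.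
  rewrite full_config_out in h1; last by move: hL hN; rewrite /in_window; clear; lia.
  rewrite [ltRHS]full_config_out in h2; last by move: hL hN; rewrite /in_window; clear; lia.
  by rewrite (le_trans lo_y (ltW h1)) (le_trans (ltW h2) y_hi).
apply: (@le_trans _ _ (((2 * D * u) `^ (m%:R * beta + 1))%R%:E *
    \int[lebesgue_tuple n]_(x in Om) (weight x)%:E)%E); last first.
  rewrite lee_wpmul2l ?lee_fin ?powR_ge0//.
  have -> : (\int[lebesgue_tuple n]_(x in Om) (weight x)%:E = mass_loc V beta N L K y G)%E by [].
  by apply: le_mass_loc => // x [].
rewrite /mass_loc setIA.
apply: (@repulsion_of_contraction _ _ _ (lebesgue_tuple n) (fun x => weight x) Om g m beta D) => //.
- exact: (le_lt_trans (@le_mass_loc G setT mG measurableT (fun _ _ => I)) fin).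
- by move=> k _; exact: mg.
- exact: (ltW beta0).
- move=> x k xOm km; rewrite /g normr_gt0 subr_eq0.
  apply: (zinj _ xOm); rewrite ?mem_index_iota; [move: (hW (We km)) hL hN; rewrite /in_window; clear; lia|move: ho; clear; lia|].
  by apply: contraNneq Wo => <-; exact: We.
move=> v v0 Dv.
(* Since [z_o] and [z_p] are at least [l] apart, a contraction by [v / l] opens every gap at [z_o]
   beyond [v]. *)
pose phi := v / l.
have phi0 : 0 < phi by rewrite divr_gt0.
have phil : phi * l = v by rewrite /phi divfK// gt_eqF.
have phi4 : 4 * phi <= 1.
  apply: le_trans Dv; rewrite -mulrA (_ : 4 * phi = 2 * (2 / l * v)); last by rewrite /phi; ring.
  by rewrite ler_wpM2l// ler_wpM2r// ltW.
have phi1 : phi < 1 by apply: lt_le_trans phi4; rewrite ltr_pMl// ltr1n.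
have c0 : 0 < 1 - phi by rewrite subr_gt0.
have phi01 : 0 <= phi < 1 by rewrite (ltW phi0).
have sgpm : sg = 1 \/ sg = -1 by case: geom => -[-> _]; [left|right].
pose cnt : R := \sum_(j <- r | W j) (1 : R).
pose Sa := \sum_(j <- r) a j.
(* The losses of the pair energy, which enters with the factor [beta / 2], and of the potential,
   each moved particle being displaced by at most [phi * (4 * l) = 4 * v]. *)
pose kap := expR (- (2 * beta * phi * cnt * Sa) - N%:R * beta / 2 * (cnt * (Lp * (4 * v)))).
exists (T phi), ((1 - phi) ^+ size w), kap; split.
- by split; [rewrite exprn_ge0 ?(ltW c0)|exact: expR_ge0].
(* With the Jacobian written as an exponential too, the product is [exp (- t)] with [t <= D * v],
   and [exp (- t) >= 1 - t]. *)
- have -> : (1 - phi) ^+ size w = expR (cnt * ln (1 - phi)).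
    by rewrite /cnt size_w expRM_natl lnK ?posrE.
  rewrite -expRD; apply: le_trans (expR_ge1Dx _).
  rewrite lerD2l.
  have h1 : - (2 * phi) <= ln (1 - phi) by apply: ln1B_ge; lra.
  have cnt00 : 0 <= cnt by rewrite (le_trans _ cnt0).
  have h2 : - (cnt * (2 * phi)) <= cnt * ln (1 - phi) by rewrite -mulrN ler_wpM2l.
  have h3 : cnt * (2 * phi) <= 2 * M / l * v.
    rewrite (_ : 2 * M / l * v = M * (2 * phi)); last by rewrite /phi; ring.
    by rewrite ler_wpM2r// mulr_ge0// ltW.
  have h4 : 2 * beta * phi * cnt * Sa <= 2 * beta * M * S / l * v.
    rewrite (_ : 2 * beta * M * S / l * v = 2 * beta * phi * (M * S)); last by rewrite /phi; ring.
    have b0 : 0 <= 2 * beta * phi by apply: mulr_ge0; [apply: mulr_ge0 => //; exact: ltW|exact: ltW].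
    rewrite -mulrA ler_wpM2l//.
    by apply: ler_pM => //; exact: sumr_ge0.
  have h5 : N%:R * beta / 2 * (cnt * (Lp * (4 * v))) <= 2 * N%:R * beta * M * Lp * v.
    rewrite (_ : 2 * N%:R * beta * M * Lp * v = N%:R * beta / 2 * (M * (Lp * (4 * v)))); last by field.
    by rewrite ler_wpM2l ?mulr_ge0 ?(ltW beta0)// ler_wpM2r// !mulr_ge0// ltW.
  rewrite /D; lra.
- exact: (measurable_tuple_affine _ _ (mphi phi)).
- move=> F mF F0; apply: integral_tuple_affine => //.
  + by rewrite filter_uniq// enum_uniq.
  + exact: mphi.
  + move=> x x' xx'; congr (_ * _).
    have [pw|pw] := boolP (in_window L K p); last by rewrite !full_config_out.
    have [k kp] := in_window_ex hL hN pw; rewrite kp !(full_config_in y hL hN).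
    by apply: xx'; rewrite mem_filter -kp (negbTE Wp).
move=> x xOm; have [xo xG] := xOm.
have zTE : z (T phi x) = (fun i => if W i then z x i + phi * (z x p - z x i) else z x i).
  by apply/funext => j; exact: full_config_T.
have Tx_o : ordered_in_J L K y (T phi x).
  move=> j jJ; have j1 : j \in r by rewrite mem_index_iota; move: jJ hL hN; clear; lia.
  have j2 : j.+1 \in r by rewrite mem_index_iota; move: jJ hL hN; clear; lia.
  have zj : z x j < z x j.+1 by apply: xo.
  rewrite !full_config_T; case: ifPn => Wj; case: ifPn => Wj1 //.
  - rewrite -subr_gt0 (_ : _ - _ = (1 - phi) * (z x j.+1 - z x j)); last by ring.
    by rewrite mulr_gt0// subr_gt0.
  - have [zo zp] := zW _ xOm _ j1 Wj.
    exact: contraction_lt sgpm phi01 zj zo zp (zN _ xOm _ j2 Wj1).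
  (* Here the right neighbour is the moved one: reflecting the line reduces to the same lemma with
     [- sg]. *)
  - have [zo zp] := zW _ xOm _ j2 Wj1; rewrite -ltrN2 opprD -mulrN opprB.
    have eN : phi * (z x j.+1 - z x p) = phi * (- z x p - (- z x j.+1)) by ring.
    rewrite eN; apply: (@contraction_lt _ (- sg) phi (- z x j.+1) (- z x j) (- z x o)) => //.
    + by case: sgpm => ->; [right|left; rewrite opprK].
    + by rewrite ltrN2.
    + by rewrite -opprD mulrNN.
    + by rewrite -opprD mulrNN.
    + by rewrite -!opprD !mulrNN; exact: zN.
have TG : G (T phi x).
  by apply: Gout xG => j Wj; rewrite full_config_T (negbTE Wj).
have lz := Gl xo xG.
have er k : (k < m)%N -> e k \in r.
  by move=> km; rewrite mem_index_iota; move: (hW (We km)) hL hN; rewrite /in_window; clear; lia.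
have gT k : (k < m)%N -> g k x <= g k (T phi x) /\ v < g k (T phi x).
  move=> km; rewrite /g !full_config_T (We km) (negbTE Wo).
  have [zo zp] := zW _ xOm _ (er _ km) (We km).
  have E t : `|t| = `|sg * t| by rewrite normrM sg1 mul1r.
  rewrite (E (z x (e k) - z x o)) (gtr0_norm zo) E.
  rewrite (_ : sg * (_ + _ - _) = sg * (z x (e k) - z x o) + phi * (sg * (z x p - z x (e k)))); last by ring.
  rewrite gtr0_norm; last by rewrite addr_gt0// mulr_gt0.
  split; first by rewrite lerDl mulr_ge0// ltW.
  have : sg * (z x p - z x o) = sg * (z x (e k) - z x o) + sg * (z x p - z x (e k)) by ring.
  move/andP: lz => [lz _]; move: lz zo zp; rewrite -phil.
  set A := sg * (z x (e k) - _); set B := sg * (z x p - z x (e k)) => lz A0 B0 lzE.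
  rewrite lzE in lz; have : phi * l <= phi * (A + B) by rewrite ler_pM2l.
  by nra.
split => //.
have gpos x' : Om x' -> forall k, (k < m)%N -> 0 < g k x'.
  move=> x'Om k km; rewrite normr_gt0 subr_eq0; apply: (zinj _ x'Om).
  - exact: er.
  - by rewrite mem_index_iota; move: ho; clear; lia.
  - by apply: contraNneq Wo => <-; exact: We.
have prodE x' : Om x' -> (\prod_(k < m) g k x') `^ beta = expR (beta * \sum_(k < m) ln (g k x')).
  move=> x'Om; rewrite mulrC expRM expR_sum; congr (_ `^ _).
  by apply: eq_bigr => k _; rewrite lnK// posrE gpos.
have TOm : Om (T phi x) by split.
rewrite !prodE// /kap -!expRD ler_expR.
(* The gains kept in the energy estimate are those of the particles [e k]; after multiplication by
   [beta / 2] they are exactly the change of the logarithm of the dividing weight. *)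
pose Q := [pred i | i \in map e (iota 0 m)].
have QE (F : nat -> R) : \sum_(i <- r | Q i) F i = \sum_(k < m) F (e k).
  rewrite -big_filter (perm_big (map e (iota 0 m))).
    by rewrite big_map -(big_mkord xpredT (fun k => F (e k))) /index_iota subn0.
  apply: uniq_perm.
  - by rewrite filter_uniq// iota_uniq.
  - rewrite map_inj_in_uniq ?iota_uniq// => i j; rewrite !mem_iota !add0n => im jm.
    exact: e_inj.
  - move=> i; rewrite mem_filter /=; case: (boolP (i \in _)) => //= /mapP[k].
    by rewrite mem_iota add0n => km ->; exact: er.
have QW i : Q i -> W i by move=> /mapP[k]; rewrite mem_iota add0n => km ->; exact: We.
have o_r : o \in r by rewrite mem_index_iota; move: ho; clear; lia.
have phi02 : 0 <= phi <= 2^-1 by apply/andP; split; lra.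
have PE := pair_energy_contract (iota_uniq _ _ : uniq r) o_r Wo QW phi02 a0 aW sg1
  (zW _ xOm) (zN _ xOm) (zinj _ xOm) lz
  (fun j jr => Ga xo xG (j := j) (etrans (esym (mem_index_iota 1 N.+1 j)) jr)).
rewrite QE sumrB -/cnt -/Sa in PE.
have PE1 : pair_energy r (z (T phi x)) = pair_energy r
   (fun i => if W i then z x i + phi * (z x p - z x i) else z x i) by rewrite zTE.
have PE2 : \sum_(k < m) ln (g k (T phi x)) =
  \sum_(k < m) ln `|(if W (e k) then z x (e k) + phi * (z x p - z x (e k)) else z x (e k)) - z x o|.
  by apply: eq_bigr => k _; rewrite /g !full_config_T (negbTE Wo).
have VE : \sum_(j <- r | in_window L K j) V (z (T phi x) j) -
    \sum_(j <- r | in_window L K j) V (z x j) <= cnt * (Lp * (4 * v)).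
  rewrite -sumrB /cnt mulr_suml [leRHS]big_mkcond [leLHS]big_mkcond.
  apply: ler_sum_seq => j jr _.
  have [Wj|Wj] := boolP (W j); last first.
    by case: ifP => // _; rewrite full_config_T (negbTE Wj) subrr.
  rewrite (hW Wj) mul1r; apply: le_trans (ler_norm _) _.
  apply: le_trans (V_lip (zJ _ Tx_o _ (hW Wj)) (zJ _ xo _ (hW Wj))) _.
  rewrite ler_wpM2l// full_config_T Wj addrC addKr normrM gtr0_norm//.
  have -> : `|z x p - z x j| = sg * (z x p - z x j).
    by rewrite -[LHS]mul1r -sg1 -normrM gtr0_norm//; have [] := zW _ xOm _ jr Wj.
  rewrite -phil [leRHS]mulrCA ler_wpM2l ?(ltW phi0)//.
  have [zo _] := zW _ xOm _ jr Wj; case/andP: lz => _; apply: le_trans.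
  by rewrite -subr_ge0 -mulrBr (_ : _ - _ - _ = z x j - z x o) ?ltW//; ring.
rewrite !(H_locE y hL hN) PE1 PE2.
have nb : 0 <= N%:R * beta / 2 by rewrite !mulr_ge0// ltW.
have := ler_wpM2l nb VE; rewrite mulrBr.
have b2 : 0 <= beta / 2 by rewrite mulr_ge0// ltW.
have := ler_wpM2l b2 PE; rewrite /g.
set X1 := \sum_(k < m) _; set X2 := \sum_(k < m) _.
set P1 := pair_energy _ _; set P2 := pair_energy _ _.
set V1 := _ * \sum_(j <- r | _) _; set V2 := _ * \sum_(j <- r | _) _.
move=> HP HV.
have E1 : beta / 2 * (2 * (X1 - X2) - 4 * phi * cnt * Sa) =
  beta * X1 - beta * X2 - 2 * beta * phi * cnt * Sa by field.
rewrite E1 in HP; rewrite mulrBr in HP; rewrite !(mulrBr (beta / 2)).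
lra.
Qed.

End window_repulsion.

(** * Regularity of the potential *)

Section lipschitz.
Context {R : realType}.
Implicit Types (f V rho : R -> R).

Definition locally_lipschitz f := forall x0, exists r C : R,
  [/\ 0 < r, 0 <= C & forall s t, `|s - x0| <= r -> `|t - x0| <= r ->
    `|f s - f t| <= C * `|s - t|].

(** The factor [r] on the left allows the exponent [k] on the right instead of [k - 1], which would
    be truncated at [k = 0]. *)
Lemma distr_expr_le (s t r : R) k : `|s| <= r -> `|t| <= r ->
  r * `|s ^+ k - t ^+ k| <= k%:R * r ^+ k * `|s - t|.
Proof.
move=> sr tr; have r0 : 0 <= r by exact: le_trans sr.
elim: k => [|k IH]; first by rewrite !expr0 subrr normr0 mulr0 !mul0r.
have -> : s ^+ k.+1 - t ^+ k.+1 = s * (s ^+ k - t ^+ k) + (s - t) * t ^+ k.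
  by rewrite !exprS; ring.
apply: (@le_trans _ _ (r * (r * `|s ^+ k - t ^+ k| + `|s - t| * r ^+ k))).
  rewrite ler_wpM2l//; apply: (le_trans (ler_normD _ _)).
  by rewrite !normrM lerD// ?ler_wpM2r// ler_wpM2l// normrX lerXn2r.
rewrite mulrDr exprS -natr1.
have h := ler_wpM2l r0 IH; apply: (le_trans (lerD h (lexx _))).
by rewrite le_eqVlt; apply/orP; left; apply/eqP; ring.
Qed.

Lemma sum_natr_exp2V n :
  \sum_(0 <= k < n) (k%:R : R) * 2^-1 ^+ k = 2 - 2 * n.+1%:R * 2^-1 ^+ n.
Proof.
elim: n => [|n IH]; first by rewrite big_nil expr0; ring.
by rewrite big_nat_recr//= IH exprS -!natr1; field.
Qed.

(** Convergence at [x0 + q], with [q = r / 2], bounds [a k * q ^ k] by some [M]. On the ball of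
    radius [p = q / 2] the [k]-th term then has Lipschitz constant [M / p * (k * 2 ^ (- k))], and
    these sum to at most [2 * M / p]. *)
Lemma real_analytic_locally_lipschitz V : real_analytic V -> locally_lipschitz V.
Proof.
move=> anV x0; have [r r0 [a aV]] := anV x0.
pose q := r / 2; have q0 : 0 < q by rewrite divr_gt0.
have qr : `|x0 + q - x0| < r by rewrite addrC addKr gtr0_norm// /q; lra.
have cvq := aV _ qr; rewrite (_ : x0 + q - x0 = q) in cvq; last by ring.
have [K [_ Kf]] : bounded_fun (fun k => a k * q ^+ k).
  apply: cvg_series_bounded; apply/cvg_ex; exists (V (x0 + q)); exact: cvq.
pose M := `|K| + 1.
have aM k : `|a k| * q ^+ k <= M.
  have := Kf M; rewrite /M => /(_ _ k I) /=; rewrite normrM normrX (gtr0_norm q0); apply.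
  by rewrite (le_lt_trans (ler_norm K))// ltrDl.
have M0 : 0 <= M by rewrite addr_ge0.
exists (q / 2), (2 * M / (q / 2)); split; first by rewrite divr_gt0.
  by rewrite !mulr_ge0// invr_ge0 ltW// divr_gt0.
move=> s t sq tq; set p := q / 2 in sq tq *; have p0 : 0 < p by rewrite divr_gt0.
have pr : p < r by rewrite /p /q; lra.
have cs := aV _ (le_lt_trans sq pr); have ct := aV _ (le_lt_trans tq pr).
have cst : `|\sum_(0 <= k < n) a k * (s - x0) ^+ k - \sum_(0 <= k < n) a k * (t - x0) ^+ k|
    @[n --> \oo] --> `|V s - V t| by apply: cvg_norm; exact: cvgB.
rewrite -[leLHS](cvg_lim _ cst)//; apply: limr_le; first by apply/cvg_ex; eexists; exact: cst.
apply: nearW => n /=; rewrite -sumrB.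
apply: (le_trans (ler_norm_sum _ _ _)).
rewrite mulrAC ler_pdivlMr// mulrC mulr_sumr.
apply: (@le_trans _ _ (\sum_(0 <= k < n) M * `|s - t| * (k%:R * 2^-1 ^+ k))).
  apply: ler_sum => k _; rewrite -mulrBr normrM mulrCA.
  apply: (@le_trans _ _ (`|a k| * (k%:R * p ^+ k * `|s - t|))).
    rewrite ler_wpM2l//; have := @distr_expr_le (s - x0) (t - x0) p k sq tq.
    by rewrite (_ : s - x0 - (t - x0) = s - t)//; ring.
  have -> : p ^+ k = q ^+ k * 2^-1 ^+ k by rewrite -exprMn.
  have := ler_wpM2r (_ : 0 <= k%:R * 2^-1 ^+ k * `|s - t|) (aM k).
  move=> /(_ _)H; apply: le_trans (le_trans (H _) _).
  - by rewrite le_eqVlt; apply/orP; left; apply/eqP; ring.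
  - by rewrite !mulr_ge0// exprn_ge0// invr_ge0.
  - by rewrite le_eqVlt; apply/orP; left; apply/eqP; ring.
rewrite -mulr_sumr sum_natr_exp2V (_ : 2 * M * _ = M * `|s - t| * 2); last by ring.
rewrite ler_wpM2l ?mulr_ge0//.
by rewrite gerBl !mulr_ge0// exprn_ge0// invr_ge0.
Qed.

Lemma locally_lipschitz_continuous f : locally_lipschitz f -> continuous f.
Proof.
move=> lf x; have [r [C [r0 C0 fC]]] := lf x.
apply/cvgrPdist_lt => e e0; near=> t.
have tr : `|t - x| <= r.
  by rewrite distrC; near: t; apply: cvgr_dist_le.
apply: (le_lt_trans (fC _ _ _ tr)); first by rewrite subrr normr0 ltW.
apply: (@le_lt_trans _ _ ((C + 1) * `|x - t|)); first by rewrite ler_wpM2r// lerDl.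
rewrite mulrC -ltr_pdivlMr; last by rewrite ltr_wpDl.
near: t; apply: cvgr_dist_lt => //; rewrite divr_gt0// ltr_wpDl//.
Unshelve. all: by end_near. Qed.

(** Let [S] be the set of [b] such that [f] is Lipschitz on [[lo, b]]. A local bound around [sup S]
    can be glued to one on [[lo, b]] with [b] close to [sup S], the constants being added, so [S]
    cannot stop before [hi]. *)
Lemma locally_lipschitz_itv f (lo hi : R) : locally_lipschitz f ->
  exists2 C : R, 0 <= C & forall s t, lo <= s <= hi -> lo <= t <= hi ->
    `|f s - f t| <= C * `|s - t|.
Proof.
move=> lf; have [lohi|hilo] := leP lo hi; last first.
  by exists 0 => // s t /andP[s1 s2]; move: (le_trans s1 s2); rewrite leNgt hilo.
pose P b := exists2 C : R, 0 <= C & forall s t, lo <= s -> s <= t -> t <= b ->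
    `|f s - f t| <= C * `|s - t|.
have glue b x r C c : P b -> 0 < r -> 0 <= C ->
    (forall s t, `|s - x| <= r -> `|t - x| <= r -> `|f s - f t| <= C * `|s - t|) ->
    x - r <= b -> b <= x -> c <= x + r -> P c.
  move=> [C' C'0 fb] r0 C0 fC xb bx cx; exists (C + C'); first exact: addr_ge0.
  have loc s t : b <= s -> s <= t -> t <= c -> `|f s - f t| <= C * `|s - t|.
    by move=> bs st tc; apply: fC; rewrite ler_norml; apply/andP; split; lra.
  move=> s t ls st tc; have [tb|bt] := leP t b.
    by apply: (le_trans (fb _ _ ls st tb)); rewrite ler_wpM2r// lerDr.
  have [bs|sb] := leP b s.
    by apply: (le_trans (loc _ _ bs st tc)); rewrite ler_wpM2r// lerDl.
  have := fb _ _ ls (ltW sb) (lexx b); have := loc _ _ (lexx b) (ltW bt) tc.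
  rewrite [`|b - t|]distrC [`|s - b|]distrC [`|s - t|]distrC.
  rewrite (gtr0_norm (_ : 0 < t - b)) ?subr_gt0// (gtr0_norm (_ : 0 < b - s)) ?subr_gt0//.
  rewrite (gtr0_norm (_ : 0 < t - s)); last by rewrite subr_gt0 (lt_trans sb).
  move=> h1 h2; have := ler_normD (f s - f b) (f b - f t).
  rewrite (_ : f s - f b + _ = f s - f t); last by ring.
  move=> h3; apply: (le_trans h3); apply: (le_trans (lerD h2 h1)).
  nra.
suff [C C0 fC] : P hi.
  exists C => // s t /andP[s1 s2] /andP[t1 t2]; have [st|/ltW ts] := leP s t; first exact: fC.
  by rewrite distrC [`|s - t|]distrC; exact: fC.
pose S := [set b | lo <= b <= hi /\ P b].
have Slo : S lo.
  split; first by rewrite lexx.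
  by exists 0 => // s t ls st tl; have -> : s = t by [lra]; rewrite !subrr normr0 mulr0.
have hS : has_sup S by split; [exists lo|exists hi => b [/andP[]]].
have lom : lo <= sup S by exact: (ub_le_sup hS.2).
have mhi : sup S <= hi by apply: ge_sup => [|b [/andP[]]//]; exists lo.
have [r [C [r0 C0 fC]]] := lf (sup S).
have [b Sb mb] := sup_adherent r0 hS.
have bm : b <= sup S by exact: (ub_le_sup hS.2).
have [_ Pb] := Sb.
have [hr|hr] := leP hi (sup S + r); first exact: (glue b _ r C hi Pb r0 C0 fC (ltW mb) bm hr).
have Pm : P (sup S + r) := glue b _ r C _ Pb r0 C0 fC (ltW mb) bm (lexx _).
have : sup S + r <= sup S.
  by apply: (ub_le_sup hS.2); split => //; apply/andP; split; lra.
by rewrite gerDl leNgt r0.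
Qed.

End lipschitz.

(** * The equilibrium density *)

Section equilibrium_facts.
Context {R : realType}.
Implicit Types (V rho : R -> R) (A B : R).

Lemma equilibrium_density_ge0 V rho A B : equilibrium_density V rho A B ->
  forall x, 0 <= rho x.
Proof.
move=> [AB [_ [pos [zero _]]]] x; have [/pos/ltW//|/zero ->//] := boolP (A < x < B).
Qed.

Lemma equilibrium_density_continuous V rho A B : equilibrium_density V rho A B ->
  forall x, A < x < B -> {for x, continuous rho}.
Proof.
move=> [_ [_ [_ [_ [reg _]]]]] x /reg[dx _ _].
exact/differentiable_continuous/derivable1_diffP.
Qed.

Lemma measurable_equilibrium_density V rho A B : equilibrium_density V rho A B ->
  measurable_fun setT rho.
Proof.
move=> eq; have zero : forall x, ~~ (A < x < B) -> rho x = 0 by case: eq => _ [_ [_ []]].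
have -> : rho = rho \_ `]A, B[%classic.
  apply/funext => x; rewrite patchE; case: ifPn => //; rewrite mem_setE/= in_itv/=; exact: zero.
apply/(measurable_restrictT _ _).1 => //.
apply: open_continuous_measurable_fun; first exact: interval_open.
move=> x; rewrite mem_setE/= in_itv/=; exact: equilibrium_density_continuous eq x.
Qed.

(** The square root behaviour bounds [rho] near the two edges, and continuity on a compact interval
    bounds it in between. *)
Lemma equilibrium_density_bounded V rho A B : equilibrium_density V rho A B ->
  exists2 C : R, 0 < C & forall x, rho x <= C.
Proof.
move=> eq; have r0 := equilibrium_density_ge0 eq.
have rc := equilibrium_density_continuous eq.
case: (eq) => AB [_ [_ [zero [_ [[cA cA0 hA] [cB cB0 hB]]]]]].
have s0 x y : 0 <= Num.sqrt (x - y) :> R by exact: sqrtr_ge0.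
have [a a0 ha] : exists2 a, A < a & forall x, A < x -> x < a -> rho x / Num.sqrt (x - A) < cA + 1.
  have : \forall x \near A^'+, rho x / Num.sqrt (x - A) < cA + 1.
    by apply: (cvgr_lt cA) => //; rewrite ltrDl.
  case/nbhs_ballP => e /= e0 he; exists (A + e); first by rewrite ltrDl.
  move=> x Ax xe; apply: he => //; rewrite /ball/= ltr0_norm; lra.
have [b b0 hb] : exists2 b, b < B & forall x, b < x -> x < B -> rho x / Num.sqrt (B - x) < cB + 1.
  have : \forall x \near B^'-, rho x / Num.sqrt (B - x) < cB + 1.
    by apply: (cvgr_lt cB) => //; rewrite ltrDl.
  case/nbhs_ballP => e /= e0 he; exists (B - e); first by rewrite gtrBl.
  move=> x Ax xe; apply: he => //; rewrite /ball/= gtr0_norm; lra.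
(* The midpoint of [[A, B]] enters both definitions to guarantee [a' <= b']. *)
pose a' := Num.min ((A + a) / 2) ((A + B) / 2); pose b' := Num.max ((B + b) / 2) ((A + B) / 2).
have ab' : a' <= b'.
  by apply: (@le_trans _ _ ((A + B) / 2)); rewrite ?ge_min ?le_max lexx orbT.
have Aa' : A < a' by rewrite lt_min; apply/andP; split; lra.
have a'a : a' < a by rewrite gt_min; apply/orP; left; lra.
have b'B : b' < B by rewrite gt_max; apply/andP; split; lra.
have bb' : b < b' by rewrite lt_max; apply/orP; left; lra.
have [c cab hc] : exists2 c, c \in `[a', b'] & forall t, t \in `[a', b'] -> rho t <= rho c.
  apply: EVT_max => //; apply: continuous_in_subspaceT => x.
  rewrite mem_setE/= in_itv/= => /andP[h1 h2]; apply: rc; apply/andP; split; lra.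
pose s := Num.sqrt (B - A).
have s0' : 0 <= s by exact: sqrtr_ge0.
exists (rho c + (cA + 1) * s + (cB + 1) * s + 1).
  have := r0 c; have : 0 <= (cA + 1) * s by rewrite mulr_ge0// addr_ge0// ltW.
  have : 0 <= (cB + 1) * s by rewrite mulr_ge0// addr_ge0// ltW.
  lra.
have hA' : 0 <= (cA + 1) * s by rewrite mulr_ge0// addr_ge0// ltW.
have hB' : 0 <= (cB + 1) * s by rewrite mulr_ge0// addr_ge0// ltW.
have hc0 := r0 c.
move=> x; have [/andP[Ax xB]|/zero ->] := boolP (A < x < B); last by lra.
have [xa|ax] := ltP x a'.
  have sx : 0 < Num.sqrt (x - A) by rewrite sqrtr_gt0 subr_gt0.
  have := ha _ Ax (lt_trans xa a'a); rewrite ltr_pdivrMr// => h.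
  have : Num.sqrt (x - A) <= s by rewrite ler_wsqrtr//; lra.
  by nra.
have [xb|bx] := ltP b' x.
  have sx : 0 < Num.sqrt (B - x) by rewrite sqrtr_gt0 subr_gt0.
  have := hb _ (lt_trans bb' xb) xB; rewrite ltr_pdivrMr// => h.
  have : Num.sqrt (B - x) <= s by rewrite ler_wsqrtr//; lra.
  by nra.
have := hc x; rewrite in_itv/= ax bx => /(_ isT); lra.
Qed.

(** The mass [(l - k) / N] between two classical locations is at most [C] times their distance.
    Their order has to be derived as well: an inversion would contradict monotonicity of the
    integral. *)
Lemma classical_locations_spacing V rho A B (C : R) N gamma (k l : nat) :
  equilibrium_density V rho A B -> (forall x, rho x <= C) ->
  classical_locations rho A B N gamma -> (1 <= k)%N -> (k <= l)%N -> (l <= N)%N ->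
  (l%:R - k%:R) / N%:R <= C * (gamma l - gamma k).
Proof.
move=> eq rC cl k1 kl lN; have r0 := equilibrium_density_ge0 eq.
have mr := measurable_equilibrium_density eq.
move: kl; rewrite leq_eqVlt => /predU1P[->|kl]; first by rewrite !subrr mul0r mulr0.
have kN : (1 <= k <= N)%N by rewrite k1 (leq_trans (ltnW kl)).
have lN' : (1 <= l <= N)%N by rewrite lN (leq_trans k1 (ltnW kl)).
have [/andP[Ak _] Ik] := cl k kN; have [/andP[Al _] Il] := cl l lN'.
have N0 : (0 : R) < N%:R by rewrite ltr0n; case/andP: kN => [/leq_trans h /h].
have mrE D : measurable_fun D (fun x => (rho x)%:E).
  by apply: measurable_funTS; exact/measurable_EFinP.
have kl' : gamma k <= gamma l.
  rewrite leNgt; apply/negP => lk.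
  have : ((l%:R / N%:R)%:E <= (k%:R / N%:R)%:E :> \bar R)%E.
    rewrite -Ik -Il; apply: ge0_subset_integral => //.
    - exact: mrE.
    - by move=> x _; rewrite lee_fin.
    - by move=> x /=; rewrite !in_itv/= => /andP[-> h]; exact: le_trans h (ltW lk).
  by rewrite lee_fin ler_pM2r ?invr_gt0// ler_nat leqNgt kl.
have : (\int[lebesgue_measure]_(x in `[A, gamma l]) (rho x)%:E =
   \int[lebesgue_measure]_(x in `[A, gamma k]) (rho x)%:E +
   \int[lebesgue_measure]_(x in `]gamma k, gamma l]) (rho x)%:E)%E.
  rewrite (@itv_bndbnd_setU _ _ (BLeft A) (BRight (gamma k)) (BRight (gamma l)))//.
  rewrite ge0_integral_setU//.
  - exact: mrE.
  - by move=> x _; rewrite lee_fin.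
  - by apply/disj_setPRL => x /=; rewrite !in_itv/= => /andP[h _]; rewrite (leNgt x) h andbF.
rewrite Ik Il => E.
have : (\int[lebesgue_measure]_(x in `]gamma k, gamma l]) (rho x)%:E <=
    \int[lebesgue_measure]_(x in `]gamma k, gamma l]) (cst C%:E x))%E.
  apply: ge0_le_integral => //.
  - by move=> x _; rewrite lee_fin.
  - exact: mrE.
  - by move=> x _; rewrite lee_fin.
rewrite integral_cst//= lebesgue_measure_itv/= lte_fin.
have -> : (if gamma k < gamma l then ((gamma l)%:E - (gamma k)%:E)%E else 0%E) = (gamma l - gamma k)%:E.
  by case: ltP => // h; have -> : gamma l = gamma k by [apply/le_anti/andP]; rewrite subrr.
rewrite -EFinM => I; have : ((l%:R / N%:R)%:E <= (k%:R / N%:R)%:E + (C * (gamma l - gamma k))%:E :> \bar R)%E.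
  by rewrite E leeD.
rewrite -EFinD lee_fin mulrBl; lra.
Qed.

End equilibrium_facts.

(** * The local law *)

Section sums.
Context {R : realType}.

Lemma harmonic_sum_le n : \sum_(1 <= k < n.+1) (k%:R : R)^-1 <= 1 + ln n%:R.
Proof.
case: n => [|n]; first by rewrite big_geq// ln0// addr0.
elim: n => [|n IH]; first by rewrite big_nat1 invr1 ln1 addr0.
rewrite big_nat_recr//=; apply: (le_trans (lerD IH (lexx _))).
rewrite -addrA lerD2l -lerBrDl.
have n1 : (0 : R) < n.+1%:R by rewrite ltr0n.
have n2 : (0 : R) < n.+2%:R by rewrite ltr0n.
rewrite -ln_div ?posrE// -[leRHS]opprK -lnV ?posrE ?divr_gt0// lerNr invf_div.
have -> : n.+1%:R / n.+2%:R = 1 + - n.+2%:R^-1 :> R.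
  by rewrite -[n.+2%:R]natr1 in n2 *; field; rewrite gt_eqF.
apply: le_ln1Dx; rewrite ltrN2 invf_lt1// ltr1n//.
Qed.

(** Each side of [p] contributes a harmonic sum; this is where [ln N] enters the estimates. *)
Lemma sum_dist_le N p : (1 <= p <= N)%N ->
  \sum_(1 <= j < N.+1 | j != p) (`|j%:R - p%:R| : R)^-1 <= 2 * (1 + ln N%:R).
Proof.
move=> /andP[p1 pN].
have lnle q : (q <= N)%N -> 1 + ln (q%:R : R) <= 1 + ln N%:R.
  case: q => [|q] qN; first by rewrite ln0// addr0 lerDl ln_ge0// ler1n; lia.
  by rewrite lerD2l ler_ln ?posrE ?ltr0n ?ler_nat//; lia.
rewrite (big_cat_nat _ (n := p))//=; [|lia].
rewrite [X in _ + X]big_ltn_cond ?ltnS// eqxx /= mulr_natl mulr2n; apply: lerD.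
  apply: le_trans (lnle p.-1 _); last by lia.
  apply: le_trans (harmonic_sum_le p.-1).
  rewrite prednK// [leRHS]big_nat_rev/= big_nat_cond [leRHS]big_nat_cond.
  rewrite le_eqVlt; apply/orP; left; apply/eqP; apply: eq_big => j; first by lia.
  move=> /andP[jp _]; congr (_^-1); rewrite distrC -natrB; last by lia.
  by rewrite ger0_norm//; congr (_%:R); lia.
apply: le_trans (lnle (N - p)%N _); last by lia.
apply: le_trans (harmonic_sum_le (N - p)%N).
rewrite -[p.+1]add1n big_addn subSn//.
rewrite big_nat_cond [leRHS]big_nat_cond.
rewrite le_eqVlt; apply/orP; left; apply/eqP; apply: eq_big => j; first by lia.
move=> /andP[jp _]; congr (_^-1); rewrite -natrB; last by lia.
by rewrite ger0_norm//; congr (_%:R); lia.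
Qed.

Lemma sum_open_itv_le N o p :
  \sum_(1 <= j < N.+1 | (o < j < p)%N) 1 <= (p - o.+1)%:R :> R.
Proof.
have -> : \sum_(1 <= j < N.+1 | (o < j < p)%N) (1 : R) = (\sum_(1 <= j < N.+1 | (o < j < p)%N) 1)%:R.
  by rewrite natr_sum.
rewrite ler_nat sum1_count -size_filter.
rewrite -[leqRHS](size_iota o.+1); apply: uniq_leq_size.
  by rewrite filter_uniq// iota_uniq.
by move=> j; rewrite mem_filter mem_iota => /andP[h _]; lia.
Qed.

End sums.

Section local_law.
Context {R : realType}.
Local Notation mR := (measurableTypeR R).
Variables (V : R -> R) (beta : R) (N L K : nat) (y : nat -> R).
Hypotheses (mV : measurable_fun setT V) (beta0 : 0 < beta).
Hypotheses (hL : (K.+1 < L)%N) (hN : (L + K < N)%N) (yo : ordered_outside N L K y).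
Local Notation n := K.*2.+1.
Local Notation z := (full_config L K y).
Local Notation mass := (mass_loc V beta N L K y).
Local Notation P := (P_loc V beta N L K y).

Lemma mass_loc_ge0 E : (0 <= mass E)%E.
Proof. by apply: integral_ge0 => x _; rewrite lee_fin expR_ge0. Qed.

(* No integrability is needed: if the total mass is [0] or [+oo], its real
   value is [0], and division by [0] gives [0]. *)
Lemma P_loc_le E (b : R) : 0 <= b -> ((mass setT < +oo)%E -> (mass E <= b%:E * mass setT)%E) ->
  P E <= b.
Proof.
move=> b0 h; rewrite /P_loc; have T0 := mass_loc_ge0 setT.
have [Too|] := ltP (mass setT) +oo%E; last first.
  by rewrite leye_eq => /eqP ->; rewrite invr0 mulr0.
have Tf : mass setT \is a fin_num by rewrite ge0_fin_numE.
have [T00|Tn0] := eqVneq (fine (mass setT)) 0; first by rewrite T00 invr0 mulr0.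
have Tp : 0 < fine (mass setT) by rewrite lt_neqAle eq_sym Tn0 fine_ge0.
rewrite ler_pdivrMr//; have := h Too; rewrite -(fineK Tf) -EFinM => hE.
have Ef : mass E \is a fin_num.
  by rewrite ge0_fin_numE ?mass_loc_ge0// (le_lt_trans hE) ?ltry.
by move: hE; rewrite -{1}(fineK Ef) lee_fin.
Qed.

Lemma mass_loc_le_of_P_loc E (b : R) : measurable E -> (mass setT < +oo)%E -> P E <= b ->
  (mass E <= b%:E * mass setT)%E.
Proof.
move=> mE Too; have T0 := mass_loc_ge0 setT; have E0 := mass_loc_ge0 E.
have ET : (mass E <= mass setT)%E by exact: le_mass_loc.
have Tf : mass setT \is a fin_num by rewrite ge0_fin_numE.
have Ef : mass E \is a fin_num by rewrite ge0_fin_numE// (le_lt_trans ET).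
have [T00|Tn0] := eqVneq (fine (mass setT)) 0.
  move=> _; move: ET; have -> : mass setT = 0%E by rewrite -(fineK Tf) T00.
  by rewrite mule0.
have Tp : 0 < fine (mass setT) by rewrite lt_neqAle eq_sym Tn0 fine_ge0.
by rewrite /P_loc ler_pdivrMr// -(fineK Ef) -(fineK Tf) -EFinM lee_fin.
Qed.

Lemma mass_loc_union E F1 F2 : measurable E -> measurable F1 -> measurable F2 ->
  ordered_in_J L K y `&` E `<=` F1 `|` F2 -> (mass E <= mass F1 + mass F2)%E.
Proof.
move=> mE m1 m2 EF; apply: (@le_trans _ _ (mass (F1 `|` (F2 `\` F1)))).
  apply: le_mass_loc => //; first by apply: measurableU => //; exact: measurableD.
  by move=> x /EF[h|h]; [left|have [?|?] := pselect (F1 x); [left|right]].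
have mo := measurable_ordered_in_J y hL hN.
rewrite {1}/mass_loc setIUr ge0_integral_setU//.
- by rewrite leeD2l// le_mass_loc//; [exact: measurableD|move=> x [_ []]].
- exact: measurableI.
- by apply: measurableI => //; exact: measurableD.
- by apply: measurable_funTS; apply/measurable_EFinP; exact: measurable_weight.
- by apply/disj_setPRL => x [_ [_ h]] [_ /h].
Qed.

Lemma mass_loc_bigcup (s : seq nat) E F (G : nat -> set (n.-tuple mR)) :
  measurable E -> measurable F -> (forall k, measurable (G k)) ->
  ordered_in_J L K y `&` E `<=` F `|` [set x | exists2 k, k \in s & G k x] ->
  (mass E <= mass F + \sum_(k <- s) mass (G k))%E.
Proof.
move=> mE mF mG; elim: s E mE => [|k s IH] E mE EF.
  rewrite big_nil adde0; apply: le_mass_loc => //.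
  by move=> x /EF[//|[k]]; rewrite in_nil.
rewrite big_cons addeCA; have mEG : measurable (E `\` G k) by exact: measurableD.
apply: (@le_trans _ _ (mass (G k) + mass (E `\` G k))%E).
  apply: mass_loc_union => // x [_ xE]; have [xG|xG] := pselect (G k x); [left|right] => //.
rewrite leeD2l// IH// => x [xo [xE xG]]; have [xF|[j]] := EF x (conj xo xE); first by left.
rewrite in_cons => /predU1P[->//|js] Gj; right; by exists j.
Qed.

End local_law.

(** * Window repulsion under a lower bound on spacings *)

Section window_bound.
Context {R : realType}.
Local Notation mR := (measurableTypeR R).
Variables (V : R -> R) (beta : R) (N L K : nat) (y : nat -> R).
Hypotheses (mV : measurable_fun setT V) (beta0 : 0 < beta).
Hypotheses (hL : (K.+1 < L)%N) (hN : (L + K < N)%N) (yo : ordered_outside N L K y).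
Local Notation n := K.*2.+1.
Local Notation z := (full_config L K y).
Local Notation r := (index_iota 1 N.+1).
Local Notation mass := (mass_loc V beta N L K y).
Local Notation P := (P_loc V beta N L K y).
Variables (lo hi Lp c1 eta : R).
Hypotheses (lo_y : lo <= y (L - K.+1)%N) (y_hi : y (L + K.+1)%N <= hi) (Lp0 : 0 <= Lp).
Hypothesis V_lip : forall s t, lo <= s <= hi -> lo <= t <= hi -> `|V s - V t| <= Lp * `|s - t|.
Hypotheses (c10 : 0 < c1) (eta0 : 0 < eta) (lnN : 1 <= ln (N%:R : R)).

(** The summands come from the Jacobian, from the particles of the window together with the pivot
    ([18 = 2 * (1 + 8)]), from the remaining particles ([32 = 2 * 16]) and from the potential. *)
Definition window_constant := 2 / c1 + 18 * beta / c1 + 32 * beta / eta + 2 * beta * Lp.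

(** The spacing bound dictates the weights: the tolerance [l / 2] turns
    [4 * l / (sg * (z x j - z x p) + l)] into at most [4 * l / (eta * |j - p| / N + l / 2)], which
    no longer depends on [x]. As [M / l] is at most [N / c1], the cost is of order
    [M * N * ln N]. *)
Lemma window_bound (W : pred nat) (o p m : nat) (e : nat -> nat) (sg l M s : R)
    (G : set (n.-tuple mR)) :
  (forall j, W j -> in_window L K j) -> (1 <= o <= N)%N -> (1 <= p <= N)%N ->
  (sg = 1 /\ forall j, W j = (o < j < p)%N) \/ (sg = -1 /\ forall j, W j = (p < j < o)%N) ->
  (0 < m)%N -> (forall k, (k < m)%N -> W (e k)) -> {in gtn m &, injective e} ->
  1 <= M -> \sum_(j <- r | W j) 1 <= M -> c1 * M / N%:R <= l ->
  measurable G ->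
  (forall x x', (forall j, ~~ W j -> z x j = z x' j) -> G x -> G x') ->
  (forall x, ordered_in_J L K y x -> G x -> l <= sg * (z x p - z x o) <= 4 * l) ->
  (forall x, ordered_in_J L K y x -> G x -> forall j, (1 <= j <= N)%N ->
     ~~ W j -> 0 <= sg * (z x j - z x p) ->
     eta * `|j%:R - p%:R| / N%:R - l / 2 <= sg * (z x j - z x p)) ->
  0 < s -> (mass setT < +oo)%E ->
  (mass (G `&` [set x | forall k, (k < m)%N -> (`|z x (e k) - z x o| <= s / N%:R)%R])
   <= ((2 * window_constant * M * ln N%:R * s) `^ (m%:R * beta + 1))%R%:E * mass setT)%E.
Proof.
move=> hW ho hp geom m0 We e_inj M1 WM lM mG Gout Gl Gs s0 fin.
have N0 : (0 : R) < N%:R by rewrite ltr0n; move: ho; clear; lia.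
have M0 : 0 < M by exact: lt_le_trans M1.
have l0 : 0 < l by apply: lt_le_trans lM; rewrite divr_gt0// mulr_gt0.
pose T : R := ln N%:R; have T1 : 1 <= T by [].
have T0 : 0 <= T by exact: le_trans T1.
pose a j := if W j then 1 else 4 * l / (eta * `|j%:R - p%:R| / N%:R + l / 2).
have den0 j : 0 < eta * `|j%:R - p%:R| / N%:R + l / 2.
  by rewrite ltr_wpDl ?divr_gt0// !mulr_ge0 ?invr_ge0// ltW.
have a0 j : 0 <= a j.
  by rewrite /a; case: ifP => // _; rewrite divr_ge0 ?(ltW (den0 _))// mulr_ge0// ltW.
have aW j : W j -> 1 <= a j by rewrite /a => ->.
have Wp : ~~ W p by case: geom => -[_ ->]; clear; lia.
(* The window, the pivot, whose term is [4 * l / (l / 2) = 8], and the harmonic sums on both sides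
   of it. *)
pose S := M + (8 + 4 * l * N%:R / eta * (2 * (1 + T))).
have aS : \sum_(j <- r) a j <= S.
  rewrite (bigID W)/=; apply: lerD.
    by rewrite (eq_bigr (fun=> 1)) // => j; rewrite /a => ->.
  pose b j := 4 * l / (eta * `|j%:R - p%:R| / N%:R + l / 2).
  have b0 j : 0 <= b j by rewrite divr_ge0 ?(ltW (den0 _))// mulr_ge0// ltW.
  apply: (@le_trans _ _ (\sum_(j <- r) b j)).
    rewrite big_mkcond; apply: ler_sum_seq => j _ _; rewrite /a.
    by case: (W j) => //=.
  have pr : p \in r by rewrite mem_index_iota; move: hp; clear; lia.
  rewrite (bigD1_seq p)/= ?iota_uniq//; apply: lerD.
    rewrite /b subrr normr0 mulr0 mul0r add0r ler_pdivrMr ?divr_gt0//; lra.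
  apply: (@le_trans _ _ (\sum_(j <- r | j != p) 4 * l * N%:R / eta * (`|j%:R - p%:R|)^-1)).
    apply: ler_sum_seq => j _ jp; rewrite /b.
    have jp0 : 0 < `|j%:R - p%:R : R|.
      by rewrite normr_gt0 subr_eq0 eqr_nat.
    have -> : 4 * l * N%:R / eta / `|j%:R - p%:R| = 4 * l / (eta * `|j%:R - p%:R| / N%:R).
      by field; rewrite !gt_eqF.
    have e0 : 0 < eta * `|j%:R - p%:R| / N%:R by rewrite divr_gt0// mulr_gt0.
    rewrite ler_pM2l ?mulr_gt0// lef_pV2 ?posrE// lerDl divr_ge0// ltW//.
  rewrite -mulr_sumr ler_wpM2l ?sum_dist_le//.
  by rewrite !mulr_ge0 ?invr_ge0// ltW.
have Ga x : ordered_in_J L K y x -> G x -> forall j, (1 <= j <= N)%N ->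
    ~~ W j -> 0 <= sg * (z x j - z x p) -> 4 * l / (sg * (z x j - z x p) + l) <= a j.
  move=> xo xG j jN Wj zj; have h := Gs _ xo xG _ jN Wj zj.
  rewrite /a (negbTE Wj) ler_pM2l ?mulr_gt0// lef_pV2 ?posrE//; lra.
have u0 : 0 < s / N%:R by rewrite divr_gt0.
apply: le_trans (window_repulsion mV beta0 hL hN yo hW ho hp geom m0 We e_inj l0 a0 aW aS WM
  lo_y y_hi Lp0 V_lip mG Gout Gl Ga u0 fin) _.
rewrite lee_wpmul2r ?mass_loc_ge0// lee_fin.
set D := 2 * M / l + _ + _.
have MS0 : 0 <= M * S by rewrite mulr_ge0 ?(ltW M0)// (le_trans _ aS)// sumr_ge0.
have D0 : 0 <= D.
  rewrite /D !addr_ge0// ?mulr_ge0 ?invr_ge0 ?(ltW M0) ?(ltW l0) ?(ltW beta0)//.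
  by rewrite (le_trans _ aS)// sumr_ge0.
have C0 : 0 <= window_constant.
  by rewrite /window_constant !addr_ge0// !mulr_ge0 ?invr_ge0// ltW.
apply: ge0_ler_powR; rewrite ?nnegrE.
- by rewrite addr_ge0// mulr_ge0// ltW.
- by rewrite !mulr_ge0// ltW.
- by rewrite !mulr_ge0// ltW.
suff DE : D <= window_constant * M * T * N%:R.
  rewrite -!(mulrA 2) ler_wpM2l// mulrA ler_pdivrMr//.
  rewrite -/T mulrAC ler_wpM2r ?(ltW s0)//.
have Ml : M / l <= N%:R / c1.
  rewrite ler_pdivrMr// mulrAC ler_pdivlMr// mulrC.
  by move: lM; rewrite ler_pdivrMr//; rewrite mulrC [l * _]mulrC mulrC.
have li : l^-1 <= N%:R / c1.
  by apply: le_trans Ml; rewrite ler_peMl// invr_ge0 ltW.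
pose X := N%:R / c1.
have X0 : 0 <= X by rewrite divr_ge0// ltW.
have MT : X <= X * (M * T).
  by rewrite ler_peMr// -[leLHS](mulr1 1) ler_pM.
have DEq : D = 2 * (M / l) + 2 * beta * M * (M / l + 8 / l + 8 * (N%:R / eta) * (1 + T)) + 2 * N%:R * beta * M * Lp.
  by rewrite /D /S; field; rewrite !gt_eqF.
have CEq : window_constant * M * T * N%:R = 2 * (X * (M * T)) + 2 * beta * M * (9 * X * T + 16 * (N%:R / eta) * T) + 2 * N%:R * beta * M * (Lp * T).
  by rewrite /window_constant /X; field; rewrite !gt_eqF.
rewrite DEq CEq.
have XT : X <= X * T by rewrite ler_peMr.
have NE0 : 0 <= N%:R / eta by rewrite divr_ge0// ltW.
apply: lerD; first apply: lerD.
- by rewrite ler_pM2l// (le_trans Ml).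
- rewrite ler_wpM2l ?mulr_ge0 ?(ltW beta0) ?(ltW M0)//.
  apply: lerD; first by rewrite -/X in Ml li; lra.
  rewrite -subr_ge0 (_ : _ - _ = 8 * (N%:R / eta * (T - 1))); last by ring.
  by rewrite mulr_ge0// mulr_ge0// subr_ge0.
- by rewrite ler_wpM2l ?mulr_ge0 ?(ltW beta0) ?(ltW M0)// ler_peMr.
Qed.

End window_bound.

(** * Gap bounds with and without rigidity *)

Section gap_bounds.
Context {R : realType}.
Local Notation mR := (measurableTypeR R).
Variables (V : R -> R) (beta : R) (N L K : nat) (y : nat -> R).
Hypotheses (mV : measurable_fun setT V) (beta0 : 0 < beta).
Hypotheses (hL : (K.+1 < L)%N) (hN : (L + K < N)%N) (yo : ordered_outside N L K y).
Local Notation n := K.*2.+1.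
Local Notation z := (full_config L K y).
Local Notation r := (index_iota 1 N.+1).
Local Notation mass := (mass_loc V beta N L K y).
Local Notation P := (P_loc V beta N L K y).
Local Notation il := (L - K.+1)%N.
Local Notation ir := (L + K.+1)%N.
Variables (lo hi Lp c1 eta : R).
Hypotheses (lo_y : lo <= y il) (y_hi : y ir <= hi) (Lp0 : 0 <= Lp).
Hypothesis V_lip : forall s t, lo <= s <= hi -> lo <= t <= hi -> `|V s - V t| <= Lp * `|s - t|.
Hypotheses (c10 : 0 < c1) (eta0 : 0 < eta) (lnN : 1 <= ln (N%:R : R)).
Local Notation wc := (window_constant beta Lp c1 eta).

Let mz := @measurable_full_config R N L K y hL hN.

Lemma full_config_il x : z x il = y il.
Proof. by rewrite full_config_out// /in_window; move: hL; clear; lia. Qed.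

Lemma full_config_ir x : z x ir = y ir.
Proof. by rewrite full_config_out// /in_window; move: hL; clear; lia. Qed.

Let zle x : ordered_in_J L K y x ->
  forall j k, (1 <= j)%N -> (j <= k)%N -> (k <= N)%N -> z x j <= z x k.
Proof.
move=> xo j k j1; rewrite leq_eqVlt => /predU1P[->//|jk] kN.
by apply/ltW; exact: (ordered_in_J_homo hL hN yo xo).
Qed.

Let zlt x : ordered_in_J L K y x ->
  forall j k, (1 <= j)%N -> (j < k)%N -> (k <= N)%N -> z x j < z x k.
Proof. exact: (ordered_in_J_homo hL hN yo). Qed.

Lemma measurable_gap_event i d (u : R) : measurable (gap_event L K y i d u).
Proof.
apply: measurable_set_le; last exact: measurable_cst.
by apply: measurable_funB; exact: mz.
Qed.

Lemma measurable_deviation_event k (u : R) : measurable (deviation_event L K y k u).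
Proof.
apply: measurable_set_le; first exact: measurable_cst.
apply: measurableT_comp => //; apply: measurable_funB; [exact: mz|exact: measurable_cst].
Qed.

(** By the order of the particles, [z_(o+d) - z_o <= s / N] bounds the distances from [z_o] to all
    of the next [d] particles; hence [d] weights and the exponent [d * beta + 1]. *)
Let window_bound_right (o q d : nat) (l M s : R) (G : set (n.-tuple mR)) :
  (il <= o)%N -> (o + d < q)%N -> (q <= ir)%N -> (0 < d)%N ->
  1 <= M -> (q - o.+1)%:R <= M -> c1 * M / N%:R <= l -> measurable G ->
  (forall x x', (forall j, ~~ (o < j < q)%N -> z x j = z x' j) -> G x -> G x') ->
  (forall x, ordered_in_J L K y x -> G x -> l <= z x q - z x o <= 4 * l) ->
  (forall x, ordered_in_J L K y x -> G x -> forall j, (q <= j <= N)%N ->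
     eta * (j%:R - q%:R) / N%:R - l / 2 <= z x j - z x q) ->
  0 < s -> (mass setT < +oo)%E ->
  (mass (G `&` gap_event L K y o d (s / N%:R))
   <= ((2 * wc * M * ln N%:R * s) `^ (d%:R * beta + 1))%R%:E * mass setT)%E.
Proof.
move=> oL oq qR d0 M1 qM lM mG Gout Gl Gs s0 fin.
pose W := [pred j | (o < j < q)%N].
have hW j : W j -> in_window L K j by rewrite /in_window /=; move: oL qR hL hN; clear; lia.
apply: le_trans (window_bound mV beta0 hL hN yo lo_y y_hi Lp0 V_lip c10 eta0 lnN
  (W := W) (o := o) (p := q) (m := d) (e := fun k => (o + k.+1)%N) (sg := 1) (l := l) (M := M)
  (G := G) hW _ _ _ d0 _ _ M1 _ lM mG Gout _ _ s0 fin).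
- apply: le_mass_loc => //.
  + by apply: measurableI => //; exact: measurable_gap_event.
  + apply: measurableI => //.
    rewrite (_ : [set x | _] = \bigcap_(k in `I_d) [set x | `|z x (o + k.+1)%N - z x o| <= s / N%:R]); last first.
      by apply/seteqP; split => x /= h k; [move=> km; exact: h|exact: h].
    apply: fin_bigcap_measurable => // k _; apply: measurable_set_le; last exact: measurable_cst.
    by apply: measurableT_comp => //; apply: measurable_funB; exact: mz.
  + move=> x [xo [xG xg]]; split => // k kd.
    rewrite ger0_norm ?subr_ge0; last by apply: zle => //; move: kd oL oq qR hL hN; clear; lia.
    by apply: le_trans xg; rewrite lerB// zle//; move: kd oL oq qR hL hN; clear; lia.
- by move: oL oq qR hL hN; clear; lia.
- by move: oL oq qR hL hN; clear; lia.
- by left.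
- by move=> k kd /=; move: kd oq; clear; lia.
- by move=> i j _ _ /=; clear; lia.
- exact: le_trans (sum_open_itv_le _ _ _) qM.
- by move=> x xo xG; rewrite mul1r; exact: Gl.
- move=> x xo xG j jN /= Wj; rewrite mul1r subr_ge0 => qj.
  have {}qj : (q <= j)%N.
    rewrite leqNgt; apply/negP => jq; move: qj; rewrite leNgt zlt//;
      move: jN qR hN; clear; lia.
  rewrite ger0_norm ?subr_ge0 ?ler_nat//; apply: Gs => //.
  by move: qj jN; clear; lia.
Qed.

(** The mirror image: the distances are measured downwards from [z_(o+d)], and the particles below
    it move towards [z_q]. *)
Let window_bound_left (o q d : nat) (l M s : R) (G : set (n.-tuple mR)) :
  (il <= q)%N -> (q < o)%N -> (o + d <= ir)%N -> (0 < d)%N ->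
  1 <= M -> (o + d - q.+1)%:R <= M -> c1 * M / N%:R <= l -> measurable G ->
  (forall x x', (forall j, ~~ (q < j < o + d)%N -> z x j = z x' j) -> G x -> G x') ->
  (forall x, ordered_in_J L K y x -> G x -> l <= z x (o + d)%N - z x q <= 4 * l) ->
  (forall x, ordered_in_J L K y x -> G x -> forall j, (1 <= j <= q)%N ->
     eta * (q%:R - j%:R) / N%:R - l / 2 <= z x q - z x j) ->
  0 < s -> (mass setT < +oo)%E ->
  (mass (G `&` gap_event L K y o d (s / N%:R))
   <= ((2 * wc * M * ln N%:R * s) `^ (d%:R * beta + 1))%R%:E * mass setT)%E.
Proof.
move=> oL oq qR d0 M1 qM lM mG Gout Gl Gs s0 fin.
pose W := [pred j | (q < j < o + d)%N].
have hW j : W j -> in_window L K j by rewrite /in_window /=; move: oL qR hL hN; clear; lia.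
apply: le_trans (window_bound mV beta0 hL hN yo lo_y y_hi Lp0 V_lip c10 eta0 lnN
  (W := W) (o := (o + d)%N) (p := q) (m := d) (e := fun k => (o + d - k.+1)%N) (sg := -1) (l := l) (M := M)
  (G := G) hW _ _ _ d0 _ _ M1 _ lM mG Gout _ _ s0 fin).
- apply: le_mass_loc => //.
  + by apply: measurableI => //; exact: measurable_gap_event.
  + apply: measurableI => //.
    rewrite (_ : [set x | _] = \bigcap_(k in `I_d) [set x | `|z x (o + d - k.+1)%N - z x (o + d)%N| <= s / N%:R]); last first.
      by apply/seteqP; split => x /= h k; [move=> km; exact: h|exact: h].
    apply: fin_bigcap_measurable => // k _; apply: measurable_set_le; last exact: measurable_cst.
    by apply: measurableT_comp => //; apply: measurable_funB; exact: mz.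
  + move=> x [xo [xG xg]]; split => // k kd.
    rewrite ler0_norm ?subr_le0; last by apply: zle => //; move: kd oL oq qR hL hN; clear; lia.
    rewrite opprB; apply: le_trans xg; rewrite lerB// zle//; move: kd oL oq qR hL hN; clear; lia.
- by move: oL oq qR hL hN; clear; lia.
- by move: oL oq qR hL hN; clear; lia.
- by right.
- by move=> k kd /=; move: kd oq; clear; lia.
- by move=> i j; rewrite !inE /=; clear; lia.
- exact: le_trans (sum_open_itv_le _ _ _) qM.
- by move=> x xo xG; rewrite mulN1r opprB; exact: Gl.
- move=> x xo xG j jN /= Wj; rewrite mulN1r opprB subr_ge0 => qj.
  have {}qj : (j <= q)%N.
    rewrite leqNgt; apply/negP => jq; move: qj; rewrite leNgt zlt//;
      move: jN oL hL; clear; lia.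
  rewrite ler0_norm ?subr_le0 ?ler_nat// opprB; apply: Gs => //.
  by move: qj jN; clear; lia.
Qed.

(* If [x_i] lies in the left half of [J], the particles to the right of [x_i]
   are contracted towards [y_(L+K+1)]; otherwise those to the left of [x_(i+d)]
   are contracted towards [y_(L-K-1)]. *)
Lemma gap_bound_weak (i d : nat) (l s : R) : l = (y ir - y il) / 2 ->
  c1 * n%:R / N%:R <= l ->
  (forall j, (ir <= j <= N)%N -> eta * (j%:R - ir%:R) / N%:R - l / 2 <= y j - y ir) ->
  (forall j, (1 <= j <= il)%N -> eta * (il%:R - j%:R) / N%:R - l / 2 <= y il - y j) ->
  (il <= i)%N -> (i + d <= ir)%N -> (0 < d)%N -> 0 < s ->
  P (gap_event L K y i d (s / N%:R))
  <= 2 * (2 * wc * n%:R * ln N%:R * s) `^ (d%:R * beta + 1).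
Proof.
move=> lE lM spr spl iL iR d0 s0.
have N0 : (0 : R) < N%:R by rewrite ltr0n; move: hN; clear; lia.
have n1 : (1 : R) <= n%:R by rewrite ler1n.
have l0 : 0 < l by apply: lt_le_trans lM; rewrite divr_gt0// mulr_gt0// ltr0n.
set b := _ `^ _; have b0 : 0 <= b by exact: powR_ge0.
apply: P_loc_le; first by rewrite mulr_ge0.
move=> fin.
pose mid := (y il + y ir) / 2.
(* A point of the left half of [J] is at distance between [l] and [2 * l] from the right end, [l]
   being half the length of [J]. *)
pose G1 : set (n.-tuple mR) := [set x | z x i <= mid].
pose G2 : set (n.-tuple mR) := [set x | mid < z x (i + d)%N].
have mG1 : measurable G1 by apply: measurable_set_le; [exact: mz|exact: measurable_cst].
have mG2 : measurable G2 by apply: measurable_set_lt; [exact: measurable_cst|exact: mz].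
have mg := measurable_gap_event i d (s / N%:R).
have zil x : ordered_in_J L K y x -> forall j, (il <= j <= ir)%N -> y il <= z x j <= y ir.
  move=> xo j jI; rewrite -(full_config_il x) -(full_config_ir x).
  by apply/andP; split; apply: zle => //; move: jI hL hN; clear; lia.
have B1 : (mass (G1 `&` gap_event L K y i d (s / N%:R)) <= b%:E * mass setT)%E.
  have [iRs|iRe] := ltnP (i + d) ir.
    apply: (window_bound_right (q := ir) (l := l)) => //.
    - by rewrite ler_nat; move: iL hL; clear; lia.
    - by move=> x x' xx'; rewrite /G1 /= xx'//; clear; lia.
    - move=> x xo; rewrite /G1/= full_config_ir => xm.
      have /andP[h1 h2] := zil x xo i ltac:(by move: iL iRs; clear; lia).
      by rewrite /mid in xm; lra.
    - move=> x xo xG j jN; rewrite full_config_ir.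
      have -> : z x j = y j by rewrite full_config_out// /in_window; move: jN; clear; lia.
      exact: spr.
  (* The gap ends at the right end of [J], so no pivot lies beyond it. On [G1] its size is at least
     [l]: either the event is empty, or [s / N >= l] and then [b >= 1]. *)
  have iRE : (i + d)%N = ir by apply/eqP; rewrite eqn_leq iR.
  have [ls|sl] := leP l (s / N%:R).
    apply: (@le_trans _ _ (mass setT)); first by apply: le_mass_loc => //; exact: measurableI.
    rewrite lee_pemull ?mass_loc_ge0// lee_fin /b.
    have b1 : 1 <= 2 * wc * n%:R * ln N%:R * s.
      have ws : 2 / c1 <= wc.
        by rewrite /window_constant -!addrA lerDl !addr_ge0// ?mulr_ge0 ?invr_ge0 ?(ltW beta0) ?(ltW c10) ?(ltW eta0).
      have sc : c1 <= s.
        have h := le_trans lM ls; rewrite ler_pM2r ?invr_gt0// in h.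
        by apply: le_trans h; rewrite ler_peMr// ltW.
      apply: (@le_trans _ _ (2 * (2 / c1) * 1 * 1 * c1)).
        rewrite !mulr1 -!mulrA mulVf ?gt_eqF// mulr1; lra.
      have c20 : 0 <= 2 / c1 by rewrite divr_ge0// ltW.
      have c40 : 0 <= 2 * (2 / c1) by rewrite mulr_ge0.
      apply: ler_pM => //; [by rewrite !mulr1|exact: ltW|].
      apply: ler_pM => //; first by rewrite mulr1.
      by apply: ler_pM => //; rewrite ler_wpM2l.
    by rewrite -[leLHS](powRr0 (2 * wc * n%:R * ln N%:R * s)) ler_powR// addr_ge0// mulr_ge0// ltW.
  apply: (@le_trans _ _ (mass set0)).
    apply: le_mass_loc => //; first exact: measurableI.
    move=> x [xo []]; rewrite /G1 /gap_event /= iRE full_config_ir /mid => h1 h2; lra.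
  by rewrite {1}/mass_loc setI0 integral_set0 mule_ge0 ?mass_loc_ge0// lee_fin.
have mT0 : (0 <= mass setT)%E by exact: mass_loc_ge0.
(* For [i = il] the left particle is the left end of [J], always in the left half, and [B1] alone
   suffices. *)
have [iLs|iLe] := ltnP il i; last first.
  have iLE : i = il by apply/eqP; rewrite eqn_leq iLe.
  apply: (@le_trans _ _ (b%:E * mass setT)%E); last first.
    by rewrite lee_wpmul2r// lee_fin ler_peMl// ler1n.
  apply: le_trans B1; apply: le_mass_loc => //; first exact: measurableI.
  move=> x [xo xg]; split => //; rewrite /G1 /= iLE full_config_il /mid; lra.
have B2 : (mass (G2 `&` gap_event L K y i d (s / N%:R)) <= b%:E * mass setT)%E.
  apply: (window_bound_left (q := il) (l := l)) => //.
  - by rewrite ler_nat; move: iR hL; clear; lia.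
  - by move=> x x' xx'; rewrite /G2 /= xx'//; clear; lia.
  - move=> x xo; rewrite /G2/= full_config_il => xm.
    have /andP[h1 h2] := zil x xo (i + d)%N ltac:(by move: iL iR; clear; lia).
    by rewrite /mid in xm; lra.
  - move=> x xo xG j jN; rewrite full_config_il.
    have -> : z x j = y j by rewrite full_config_out// /in_window; move: jN hL; clear; lia.
    exact: spl.
apply: (@le_trans _ _ (mass (G1 `&` gap_event L K y i d (s / N%:R)) +
    mass (G2 `&` gap_event L K y i d (s / N%:R)))%E).
  apply: mass_loc_union => //; [exact: measurableI|exact: measurableI|].
  move=> x [xo xg]; have [xm|xm] := leP (z x i) mid; [by left|right; split => //].
  rewrite /G2 /=; apply: (lt_le_trans xm); apply: zle => //; move: iL iR hL hN; clear; lia.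
have -> : ((2 * b)%:E * mass setT = b%:E * mass setT + b%:E * mass setT)%E.
  by rewrite -ge0_muleDl ?lee_fin// -EFinD (_ : 2 * b = b + b)//; ring.
exact: leeD.
Qed.

(** A window of [M] particles spans [M + 1] equidistant spacings, of total length [2 * l] with
    [l = (M + 1) * h / 2]. Rigidity of its two ends changes this by at most [2 * tau <= l / 2],
    which keeps it between [l] and [4 * l]. The good event asks for rigidity outside the window
    only, and a union bound over the [n] particles pays for its complement. *)
Lemma gap_bound_strong (i d M : nat) (h tau om eps s : R) :
  h = (y ir - y il) / (n%:R + 1) ->
  (0 < d)%N -> (d <= M)%N -> (M <= K)%N -> c1 * M%:R / N%:R <= M.+1%:R * h / 2 ->
  eta / N%:R <= h -> 0 <= tau -> 0 <= om -> 2 * tau + om <= M.+1%:R * h / 4 ->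
  (forall j, (ir <= j <= N)%N -> eta * (j%:R - ir%:R) / N%:R - om <= y j - y ir) ->
  (forall j, (1 <= j <= il)%N -> eta * (il%:R - j%:R) / N%:R - om <= y il - y j) ->
  (forall k, in_window L K k -> P (deviation_event L K y k tau) <= eps) ->
  (il <= i)%N -> (i + d <= ir)%N -> 0 < s ->
  P (gap_event L K y i d (s / N%:R))
  <= (2 * wc * M%:R * ln N%:R * s) `^ (d%:R * beta + 1) + n%:R * eps.
Proof.
move=> hE d0 dM MK lM etah tau0 om0 tol spr spl dev iL iR s0.
have N0 : (0 : R) < N%:R by rewrite ltr0n; move: hN; clear; lia.
have M1 : (1 : R) <= M%:R by rewrite ler1n; move: d0 dM; clear; lia.
set l := M.+1%:R * h / 2 in lM.
have l0 : 0 < l.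
  by apply: lt_le_trans lM; rewrite divr_gt0// mulr_gt0// (lt_le_trans ltr01).
set b := _ `^ _; have b0 : 0 <= b by exact: powR_ge0.
have eps0 : 0 <= eps.
  have Lw : in_window L K L by rewrite /in_window; move: hL; clear; lia.
  apply: le_trans (dev L Lw); rewrite /P_loc divr_ge0// fine_ge0//; exact: mass_loc_ge0.
have neps0 : 0 <= n%:R * eps by rewrite mulr_ge0.
apply: P_loc_le; first by rewrite addr_ge0.
move=> fin; have mT0 : (0 <= mass setT)%E by exact: mass_loc_ge0.
pose al j := equidistant L K y j.
have n10 : (0 : R) < n%:R + 1 by rewrite ltr_wpDl.
have alD j k : al j - al k = (j%:R - k%:R) * h.
  by rewrite /al /equidistant hE; field; rewrite gt_eqF.
have nE : n%:R + 1 = 2 * (K%:R + 1) :> R.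
  by rewrite !natr1 -natrM; congr (_%:R); clear; lia.
have K10 : (0 : R) < K%:R + 1 by rewrite ltr_wpDl.
(* The equidistant points continue to the ends of [J], where they agree with [y]; the ends thus
   count as rigid particles. *)
have al_il : al il = y il.
  rewrite /al /equidistant nE natrB ?(leq_trans (leqnSn _) hL)// -natr1.
  by field; rewrite gt_eqF.
have al_ir : al ir = y ir.
  by rewrite /al /equidistant nE natrD -[K.+1%:R]natr1; field; rewrite gt_eqF.
have mg := measurable_gap_event i d (s / N%:R).
have nearG (W : pred nat) : let G : set (n.-tuple mR) :=
    [set x | forall k, in_window L K k -> ~~ W k -> `|z x k - al k| <= tau] in
    measurable G /\ (forall x x', (forall j, ~~ W j -> z x j = z x' j) -> G x -> G x').
  split.
    rewrite (_ : [set x | _] = \bigcap_(k in [set k | in_window L K k /\ ~~ W k])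
       [set x | `|z x k - al k| <= tau]); last first.
      by apply/seteqP; split => x /= g k; [move=> [kw kW]; exact: g|move=> kw kW; exact: g].
    apply: bigcap_measurableType => k _; apply: measurable_set_le; last exact: measurable_cst.
    by apply: measurableT_comp => //; apply: measurable_funB; [exact: mz|exact: measurable_cst].
  by move=> x x' xx' g k kw kW; rewrite -xx'//; exact: g.
have near_al (W : pred nat) x : (forall k, W k -> in_window L K k) ->
    (forall k, in_window L K k -> ~~ W k -> `|z x k - al k| <= tau) ->
    forall k, (il <= k <= ir)%N -> ~~ W k -> al k - tau <= z x k <= al k + tau.
  move=> Ww g k kI kW; have [kw|kw] := boolP (in_window L K k).
    by have := g k kw kW; rewrite ler_distl.
  have [->|->] : k = il \/ k = ir by move: kI kw hL; rewrite /in_window; clear; lia.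
    by rewrite full_config_il al_il gerBl lerDl tau0.
  by rewrite full_config_ir al_ir gerBl lerDl tau0.
have union (G : set (n.-tuple mR)) : measurable G ->
    (forall x, (forall k, in_window L K k -> `|z x k - al k| <= tau) -> G x) ->
    (mass (G `&` gap_event L K y i d (s / N%:R)) <= b%:E * mass setT)%E ->
    (mass (gap_event L K y i d (s / N%:R)) <= (b + n%:R * eps)%:E * mass setT)%E.
  move=> mG Gt Gb; pose ws := [seq k <- index_iota 1 N.+1 | in_window L K k].
  apply: (@le_trans _ _ (mass (G `&` gap_event L K y i d (s / N%:R)) +
     \sum_(k <- ws) mass (deviation_event L K y k tau))%E).
    apply: mass_loc_bigcup => //; first exact: measurableI.
      by move=> k; exact: measurable_deviation_event.
    move=> x [xo xg]; have [|nd] := pselect (exists2 k, k \in ws & deviation_event L K y k tau x).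
      by right.
    left; split => //; apply: Gt => k kw; rewrite leNgt; apply/negP => kt; apply: nd.
    exists k; last exact: ltW.
    by rewrite mem_filter kw mem_index_iota; move: kw hL hN; rewrite /in_window; clear; lia.
  rewrite EFinD ge0_muleDl ?lee_fin//; apply: leeD => //.
  apply: (@le_trans _ _ (\sum_(k <- ws) (eps%:E * mass setT))%E).
    rewrite big_seq [leRHS]big_seq; apply: lee_sum => k; rewrite mem_filter => /andP[kw _].
    apply: mass_loc_le_of_P_loc => //; [exact: measurable_deviation_event|exact: dev].
  have -> : (n%:R * eps)%:E = (\sum_(k <- ws) eps%:E)%E.
    by rewrite sumEFin big_filter (sum_in_window hL hN (fun=> eps)) sumr_const card_ord mulr_natl.
  by rewrite ge0_sume_distrl.
have l2 : 2 * tau + om <= l / 2 by rewrite /l; move: tol; lra.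
have h0 : 0 <= h by apply: le_trans etah; rewrite divr_ge0// ltW.
have step (j k : nat) : (k <= j)%N -> eta * (j%:R - k%:R) / N%:R <= (j%:R - k%:R) * h.
  by move=> kj; rewrite mulrAC mulrC ler_wpM2l// subr_ge0 ler_nat.
(* The window is laid towards the farther end of [J], where it fits because [M <= K]. *)
have [iL'|iR'] := leqP i L.
  pose q := (i + M.+1)%N; pose W := [pred j | (i < j < q)%N].
  have qr : (q <= ir)%N by move: iL' MK; rewrite /q; clear; lia.
  have Ww k : W k -> in_window L K k by move: iL qr hL; rewrite /in_window /=; clear; lia.
  have [mG Gout] := nearG W.
  apply: (union _ mG) => [x g k kw _|]; first exact: g.
  apply: (window_bound_right (q := q) (l := l)) => //.
  - by move: dM; rewrite /q; clear; lia.
  - by rewrite ler_nat /q; clear; lia.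
  - move=> x xo xG.
    have /andP[a1 a2] := near_al W x Ww xG i ltac:(by move: iL qr; rewrite /q; clear; lia) ltac:(by rewrite /= ltnn).
    have /andP[b1 b2] := near_al W x Ww xG q ltac:(by move: iL qr; rewrite /q; clear; lia) ltac:(by rewrite /= ltnn andbF).
        have e2 : al (i + M.+1)%N - al i = 2 * l by rewrite alD natrD /l; field.
    by move: a1 a2 b1 b2 e2 l2 om0 tau0; rewrite /q; lra.
  - move=> x xo xG j jN.
    have /andP[b1 b2] := near_al W x Ww xG q ltac:(by move: iL qr; rewrite /q; clear; lia) ltac:(by rewrite /= ltnn andbF).
    have [jI|jr] := leqP j ir.
      have /andP[a1 a2] := near_al W x Ww xG j ltac:(by move: iL jN jI; rewrite /q; clear; lia) ltac:(by move: jN; rewrite /=; clear; lia).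
      have qj : (q <= j)%N by case/andP: jN.
      have := step j q qj; have := alD j q.
      by move: a1 b2 l2 om0; lra.
    (* Beyond [J] the distance is split at its right end: rigidity of [z_q] controls the part
       inside, and the spacing of [y] the part outside. *)
    have -> : z x j = y j by rewrite full_config_out// /in_window; move: jr; clear; lia.
    have := spr j ltac:(by move: jr jN; clear; lia).
    have := step ir q qr; have := alD ir q; rewrite al_ir.
    have -> : eta * (j%:R - q%:R) / N%:R = eta * (j%:R - ir%:R) / N%:R + eta * (ir%:R - q%:R) / N%:R.
      by rewrite -mulrDl -mulrDr; congr (_ * _ / _); ring.
    by move: b2 l2 tau0; lra.
pose q := (i + d - M.+1)%N; pose W := [pred j | (q < j < i + d)%N].
have qr : (il <= q)%N by move: iR' MK d0; rewrite /q; clear; lia.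
have qE : (i + d = q + M.+1)%N by move: iR' MK hL; rewrite /q; clear; lia.
have Ww k : W k -> in_window L K k by move: iR qr hL; rewrite /in_window /=; clear; lia.
have [mG Gout] := nearG W.
apply: (union _ mG) => [x g k kw _|]; first exact: g.
have qI : (il <= q <= ir)%N by move: iR qr; rewrite qE; clear; lia.
have idI : (il <= i + d <= ir)%N by move: iR iL; clear; lia.
apply: (window_bound_left (q := q) (l := l)) => //.
- by move: dM qE; clear; lia.
- by rewrite ler_nat qE; clear; lia.
- move=> x xo xG.
  have /andP[a1 a2] := near_al W x Ww xG (i + d)%N idI ltac:(by rewrite /= ltnn andbF).
  have /andP[b1 b2] := near_al W x Ww xG q qI ltac:(by rewrite /= ltnn).
  have e : al (i + d)%N - al q = 2 * l.
    by rewrite alD qE natrD /l; field.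
  by move: a1 a2 b1 b2 e l2 om0 tau0; lra.
- move=> x xo xG j jN.
  have /andP[b1 b2] := near_al W x Ww xG q qI ltac:(by rewrite /= ltnn).
  have jq : (j <= q)%N by case/andP: jN.
  have [jI|jl] := leqP il j.
    have /andP[a1 a2] := near_al W x Ww xG j ltac:(by move: jI jN qI; clear; lia) ltac:(by move: jN; rewrite /=; clear; lia).
    have := step q j jq; have := alD q j.
    by move: a2 b1 l2 om0; lra.
  have -> : z x j = y j by rewrite full_config_out// /in_window; move: jl; clear; lia.
  have := spl j ltac:(by move: jl jN; clear; lia).
  have := step q il qr; have := alD q il; rewrite al_il.
  have -> : eta * (q%:R - j%:R) / N%:R = eta * (il%:R - j%:R) / N%:R + eta * (q%:R - il%:R) / N%:R.
    by rewrite -mulrDl -mulrDr; congr (_ * _ / _); ring.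
  by move: b1 l2 tau0; lra.
Qed.

End gap_bounds.

(** * Boundary conditions *)

Section asymptotics.
Context {R : realType}.

Lemma powR_dominated (C a b : R) : a < b ->
  exists2 x0 : R, 1 <= x0 & forall x, x0 <= x -> C * x `^ a <= x `^ b.
Proof.
move=> ab; have ba : 0 < b - a by rewrite subr_gt0.
pose C1 := Num.max C 1; have C11 : 1 <= C1 by rewrite le_max lexx orbT.
have C10 : 0 < C1 by exact: lt_le_trans C11.
exists (C1 `^ (b - a)^-1).
  by rewrite -[leLHS](powRr0 C1) ler_powR// invr_ge0 ltW.
move=> x xC; have x0 : 0 < x by apply: lt_le_trans xC; exact: powR_gt0.
have -> : x `^ b = x `^ (b - a) * x `^ a.
  by rewrite -powRD ?subrK// (gt_eqF x0) implybT.
rewrite ler_wpM2r ?powR_ge0//; apply: (@le_trans _ _ C1); first by rewrite le_max lexx.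
have -> : C1 = (C1 `^ (b - a)^-1) `^ (b - a).
  by rewrite -powRrM mulVf ?gt_eqF// powRr1// ltW.
by apply: ge0_ler_powR; rewrite ?nnegrE ?powR_ge0 ?(ltW ba) ?(ltW x0).
Qed.

(** The uniform consequences of [N] being large: the lower bound on [K] makes [K] large as well, and
    the upper bound makes the window a small fraction of all particles and [K * ln N] at most of
    order [N]. *)
Lemma large_N (delta Delta K0 : R) : 0 < delta -> 0 < Delta ->
  exists N0 : nat, forall N K : nat, (N0 <= N)%N ->
    (N%:R : R) `^ delta <= K%:R <= (N%:R : R) `^ (1 / 4) ->
    [/\ 1 <= ln (N%:R : R), K%:R + 2 <= Delta * N%:R, K0 <= K%:R
      & K%:R * ln N%:R <= 2 * N%:R :> R].
Proof.
move=> d0 D0.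
have [x1 x11 hx1] := @powR_dominated (3 / Delta) (1 / 4) 1 ltac:(lra).
(* The three summands give [ln N >= 1], [K >= K0] and [K + 2 <= Delta * N] respectively. *)
pose k0 := Num.max K0 1; pose X := expR 1 + k0 `^ delta^-1 + x1.
exists (Num.truncn X).+1 => N K NX /andP[NK KN].
have k01 : 1 <= k0 by rewrite le_max lexx orbT.
have XN : X <= N%:R.
  by apply: le_trans (ltW (truncnS_gt X)) _; rewrite ler_nat.
have e0 := expR_gt0 (1 : R); have p0 := powR_ge0 k0 delta^-1.
have x10 : 0 <= x1 := le_trans ler01 x11.
have eN : expR 1 <= N%:R :> R.
  by apply: le_trans XN; rewrite /X -addrA lerDl addr_ge0.
have x1N : x1 <= N%:R :> R.
  by apply: le_trans XN; rewrite /X lerDr addr_ge0// expR_ge0.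
have pN : k0 `^ delta^-1 <= N%:R :> R.
  by apply: le_trans XN; rewrite /X addrAC lerDr addr_ge0// expR_ge0.
have N1 : 1 <= N%:R :> R := le_trans x11 x1N.
have N0 : 0 < N%:R :> R by exact: lt_le_trans N1.
have K0' : 0 <= K%:R :> R by [].
split.
- by rewrite -[leLHS]expRK ler_ln ?posrE ?expR_gt0.
- have q1 : 1 <= N%:R `^ (1 / 4) :> R.
    by rewrite -[leLHS](powRr0 N%:R) ler_powR//; lra.
  have := hx1 N%:R x1N.
  rewrite powRr1 ?(ltW N0)// mulrAC ler_pdivrMr// => h.
  apply: (@le_trans _ _ (3 * N%:R `^ (1 / 4))); last by rewrite [leRHS]mulrC.
  lra.
- apply: (@le_trans _ _ k0); first by rewrite le_max lexx.
  apply: le_trans NK.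
  have -> : k0 = (k0 `^ delta^-1) `^ delta.
    by rewrite -powRrM mulVf ?gt_eqF// powRr1// (le_trans _ k01).
  apply: ge0_ler_powR; rewrite ?nnegrE ?powR_ge0 ?(ltW d0) ?(ltW N0)//.
- have NE : N%:R = N%:R `^ (1 / 4) * N%:R `^ (3 / 4) :> R.
    rewrite -powRD; last by rewrite (gt_eqF N0) implybT.
    by rewrite (_ : 1 / 4 + 3 / 4 = 1) ?powRr1 ?(ltW N0)//; lra.
  have lnq : ln N%:R <= 2 * N%:R `^ (3 / 4) :> R.
    have := @ln_sublinear R (N%:R `^ (3 / 4)) (powR_gt0 _ N0).
    rewrite ln_powR; have := powR_ge0 (N%:R : R) (3 / 4); lra.
  have ln0 : 0 <= ln N%:R :> R by rewrite ln_ge0.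
  rewrite {2}NE mulrCA; exact: ler_pM.
Qed.

(** With [x = K] the left side bounds the total deviation probability, as [2 * K + 1 <= 3 * K]. It
    is absorbed by [s ^ p] when [s >= exp (- K ^ (c / 2))]: this fixes [theta] in the strong
    estimate. *)
Lemma expR_powR_dominated (C c p0 : R) : 0 < C -> 0 < c ->
  exists2 x0 : R, 1 <= x0 & forall x p, x0 <= x -> p <= p0 ->
    3 * x * C * expR (- x `^ c) <= expR (- x `^ (c / 2)) `^ p.
Proof.
move=> C0 c0; have c2 : c / 2 < c by lra.
have [x0 x01 hx0] := powR_dominated (p0 + 3 * C + 2 / c) c2.
exists x0 => // x p xx0 pp0; have x1 : 1 <= x by exact: le_trans xx0.
have xpos : 0 < x by exact: lt_le_trans x1.
have := hx0 _ xx0; set q := x `^ (c / 2) => Kq.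
have q1 : 1 <= q by rewrite /q -[leLHS](powRr0 x) ler_powR// divr_ge0// ltW.
have lnx : ln x <= 2 / c * q.
  have := @ln_sublinear R q ltac:(lra); rewrite /q ln_powR -/q => hq.
  have -> : ln x = 2 / c * (c / 2 * ln x) by field; rewrite gt_eqF.
  by rewrite ler_wpM2l ?(ltW hq)// divr_ge0// ltW.
have K3 : 3 * x * C <= expR (3 * C + 2 / c * q).
  rewrite expRD mulrAC; apply: ler_pM; rewrite ?mulr_ge0 ?(ltW C0) ?(ltW xpos)//.
    by apply: le_trans (expR_ge1Dx _); rewrite lerDr.
  by rewrite -[leLHS]lnK ?posrE// ler_expR.
rewrite -expRM mulNr; apply: (@le_trans _ _ (expR (3 * C + 2 / c * q) * expR (- x `^ c))).
  by rewrite ler_wpM2r// expR_ge0.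
rewrite -expRD ler_expR.
have Cq : 3 * C <= 3 * C * q by rewrite ler_peMr// mulr_ge0// ltW.
have pq : q * p <= p0 * q by rewrite mulrC ler_wpM2r//; lra.
by move: Kq; rewrite !mulrDl; lra.
Qed.

End asymptotics.

(** * Spacing of the particles of a good boundary condition *)

Section boundary.
Context {R : realType}.
Variables (V rho : R -> R) (A B Crho alpha alpha' nu : R).
Hypotheses (eqd : equilibrium_density V rho A B) (Crho0 : 0 < Crho)
  (rhoC : forall x, rho x <= Crho).
Hypotheses (a'0 : 0 < alpha') (aa : alpha' < alpha).
Variables (N L K : nat) (gamma y : nat -> R).
Hypotheses (LN : alpha * N%:R <= L%:R <= (1 - alpha) * N%:R).
Hypotheses (KN : K%:R + 2 <= (alpha - alpha') / 2 * N%:R).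
Hypotheses (cl : classical_locations rho A B N gamma)
  (gb : good_boundary N L K gamma nu alpha' y).
Local Notation il := (L - K.+1)%N.
Local Notation ir := (L + K.+1)%N.
Local Notation om := (2 * N%:R `^ (-1 + nu)).
Local Notation eta := ((alpha - alpha') / (2 * Crho)).

Let N0 : (0 : R) < N%:R.
Proof.
have K0 : 0 <= K%:R :> R by [].
rewrite lt_neqAle eq_sym ler0n andbT; apply/negP => /eqP e.
by move: KN; rewrite e mulr0; lra.
Qed.

Let KD : 2 * (K%:R + 2) <= (alpha - alpha') * N%:R.
Proof. by move: KN; lra. Qed.

Let alpha_half : alpha <= 1 / 2.
Proof.
case/andP: LN => h1 h2; have := le_trans h1 h2; rewrite ler_pM2r//; lra.
Qed.

Let a'N : 0 < alpha' * N%:R. Proof. by rewrite mulr_gt0. Qed.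

Lemma window_inside_left : (K.+1 < L)%N.
Proof.
case/andP: LN => h1 h2; rewrite -(ltr_nat R) -natr1.
have K0 : 0 <= K%:R :> R by [].
by move: KD a'N h1; rewrite mulrBl; lra.
Qed.

Lemma window_inside_right : (L + K < N)%N.
Proof.
case/andP: LN => h1 h2; rewrite -(ltr_nat R) natrD.
have K0 : 0 <= K%:R :> R by [].
by move: KD a'N h2; rewrite !mulrBl; lra.
Qed.

Let hL := window_inside_left.
Let hN := window_inside_right.

Let ilE : il%:R = L%:R - K%:R - 1 :> R.
Proof. by rewrite natrB; [rewrite -natr1; ring|exact: ltnW]. Qed.

Let irE : ir%:R = L%:R + K%:R + 1 :> R.
Proof. by rewrite natrD -natr1 addrA. Qed.

Let out j : (1 <= j <= N)%N -> (j <= il)%N || (ir <= j)%N -> out_window N L K j.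
Proof. by move=> jN jI; rewrite /out_window jN /in_window /=; move: jI hL; clear; lia. Qed.

(** Classical locations [k - j] indices apart have distance at least [(k - j) / (Crho * N)], and
    each of the two particles is within [N ^ (-1 + nu)] of its own. *)
Let bulk j k : (1 <= j)%N -> (j <= k)%N -> (k <= N)%N ->
  (j <= il)%N || (ir <= j)%N -> (k <= il)%N || (ir <= k)%N ->
  alpha' * N%:R <= j%:R -> k%:R <= (1 - alpha') * N%:R ->
  (k%:R - j%:R) / (Crho * N%:R) - om <= y k - y j.
Proof.
move=> j1 jk kN jI kI ja ka; have [_ near _ _] := gb.
have jN : (1 <= j <= N)%N by rewrite j1 (leq_trans jk).
have kN' : (1 <= k <= N)%N by rewrite kN (leq_trans j1).
have jkR : j%:R <= k%:R :> R by rewrite ler_nat.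
have yj := near j (out jN jI) ltac:(by apply/andP; split => //; lra).
have yk := near k (out kN' kI) ltac:(by apply/andP; split => //; lra).
have := classical_locations_spacing eqd rhoC cl j1 jk kN.
rewrite -ler_pdivrMl// => sp.
have -> : (k%:R - j%:R) / (Crho * N%:R) = Crho^-1 * ((k%:R - j%:R) / N%:R).
  by field; rewrite !gt_eqF.
by move: yj yk; rewrite !ler_distl => /andP[? ?] /andP[? ?]; lra.
Qed.

Let yhomo j k : (1 <= j)%N -> (j < k)%N -> (k <= N)%N ->
  (j <= il)%N || (ir <= j)%N -> (k <= il)%N || (ir <= k)%N -> y j < y k.
Proof.
move=> j1 jk kN jI kI; have [yo _ _ _] := gb.
by apply: yo => //; apply: out => //; move: j1 jk kN; clear; lia.
Qed.

Let eta_le (t : R) : 0 <= t -> eta * t / N%:R <= t / (Crho * N%:R).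
Proof.
move=> t0; have -> : eta * t / N%:R = (alpha - alpha') / 2 * (t / (Crho * N%:R)).
  by field; rewrite !gt_eqF.
rewrite ler_piMl//; first by rewrite divr_ge0// mulr_ge0// ltW.
move: alpha_half a'0; lra.
Qed.

Let eta_far (t u : R) : u <= N%:R -> (alpha - alpha') * N%:R / 2 <= t ->
  eta * u / N%:R <= t / (Crho * N%:R).
Proof.
move=> uN tN; have -> : eta * u / N%:R = (alpha - alpha') * u / 2 / (Crho * N%:R).
  by field; rewrite !gt_eqF.
rewrite ler_pM2r ?invr_gt0 ?mulr_gt0//; apply: le_trans tN.
by rewrite ler_pM2r ?invr_gt0// ler_pM2l ?subr_gt0.
Qed.

Lemma boundary_length : (2 * K%:R + 2) / (Crho * N%:R) - om <= y ir - y il.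
Proof.
case/andP: LN => h1 h2.
have -> : 2 * K%:R + 2 = ir%:R - il%:R :> R by rewrite ilE irE; ring.
apply: bulk; rewrite ?leqnn ?orbT//; try by move: hL hN; clear; lia.
  by rewrite ilE; move: KD h1 a'N (ler0n R K); rewrite mulrBl; lra.
by rewrite irE; move: KD h2 a'N (ler0n R K); rewrite !mulrBl; lra.
Qed.

(** Beyond the bulk the order of the particles is enough: [y j] lies past the particle at the last
    bulk index [q], and [q - ir] is at least the fraction [(alpha - alpha') / 2] of [N], hence of
    [j - ir]. This fraction is the source of [eta]. *)
Lemma boundary_spacing_right j : (ir <= j <= N)%N ->
  eta * (j%:R - ir%:R) / N%:R - om <= y j - y ir.
Proof.
move=> /andP[rj jN]; case/andP: LN => h1 h2.
have ir1 : (1 <= ir)%N by move: hL; clear; lia.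
have ira : alpha' * N%:R <= ir%:R by rewrite irE; move: KD h1 a'N (ler0n R K); rewrite mulrBl; lra.
have irj : ir%:R <= j%:R :> R by rewrite ler_nat.
have jNR : j%:R <= N%:R :> R by rewrite ler_nat.
have [ja|ja] := leP (j%:R : R) ((1 - alpha') * N%:R).
  apply: le_trans (bulk ir1 rj jN _ _ ira ja); rewrite ?leqnn ?rj ?orbT//.
  by rewrite lerD2r eta_le// subr_ge0.
pose q := Num.truncn ((1 - alpha') * N%:R).
have qpos : 0 <= (1 - alpha') * N%:R by rewrite mulr_ge0// subr_ge0; move: alpha_half aa; lra.
have q1 : q%:R <= (1 - alpha') * N%:R by rewrite /q; have := truncn_le ((1 - alpha') * N%:R); rewrite qpos.
have q2 : (1 - alpha') * N%:R < q%:R + 1 by rewrite natr1; exact: truncnS_gt.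
have far : (alpha - alpha') * N%:R / 2 <= q%:R - ir%:R.
  by rewrite irE; move: KD h2 q2; rewrite !mulrBl; lra.
have rq : (ir <= q)%N.
  rewrite -(ler_nat R); apply: le_trans (_ : ir%:R + (alpha - alpha') * N%:R / 2 <= _); last by lra.
  by rewrite lerDl; move: KD (ler0n R K); lra.
have qj : (q < j)%N by rewrite -(ltr_nat R); lra.
have qN : (q <= N)%N by move: qj jN; clear; lia.
have bq := bulk ir1 rq qN ltac:(by rewrite leqnn orbT) ltac:(by rewrite rq orbT) ira q1.
have yq : y q < y j by apply: yhomo; rewrite ?rq ?rj ?orbT//; move: ir1 rq; clear; lia.
have uN : j%:R - ir%:R <= N%:R :> R by move: jNR (ler0n R ir); lra.
by have := eta_far uN far; lra.
Qed.

Lemma boundary_spacing_left j : (1 <= j <= il)%N ->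
  eta * (il%:R - j%:R) / N%:R - om <= y il - y j.
Proof.
move=> /andP[j1 jl]; case/andP: LN => h1 h2.
have ilN : (il <= N)%N by move: hN; clear; lia.
have il1 : (1 <= il)%N by move: hL; clear; lia.
have ila : il%:R <= (1 - alpha') * N%:R by rewrite ilE; move: KD h2 a'N (ler0n R K); rewrite !mulrBl; lra.
have jil : j%:R <= il%:R :> R by rewrite ler_nat.
have [ja|ja] := leP (alpha' * N%:R) (j%:R : R).
  apply: le_trans (bulk j1 jl ilN _ _ ja ila); rewrite ?leqnn ?jl ?orbT//.
  by rewrite lerD2r eta_le// subr_ge0.
pose q := (Num.truncn (alpha' * N%:R)).+1.
have q1 : q%:R <= alpha' * N%:R + 1.
  by rewrite /q -natr1 lerD2r; have := truncn_le (alpha' * N%:R); rewrite (ltW a'N).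
have q2 : alpha' * N%:R < q%:R by exact: truncnS_gt.
have far : (alpha - alpha') * N%:R / 2 <= il%:R - q%:R.
  by rewrite ilE; move: KD h1 q1; rewrite !mulrBl; lra.
have ql : (q <= il)%N.
  rewrite -(ler_nat R); apply: le_trans (_ : il%:R - (alpha - alpha') * N%:R / 2 <= _); first by lra.
  by rewrite gerBl; move: KD (ler0n R K); lra.
have jq : (j < q)%N by rewrite -(ltr_nat R); lra.
have bq := bulk (ltn0Sn _ : (1 <= q)%N) ql ilN ltac:(by rewrite ql) ltac:(by rewrite leqnn) (ltW q2) ila.
have yq : y j < y q by apply: yhomo; rewrite ?ql ?jl//; move: ilN ql; clear; lia.
have uN : il%:R - j%:R <= N%:R :> R.
  by have : il%:R <= N%:R :> R; [rewrite ler_nat|move: (ler0n R j); lra].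
by have := eta_far uN far; lra.
Qed.

(** The ends of [J] are within 1 of classical locations, so one Lipschitz constant of [V], on
    [[A - 1, B + 1]], serves for all boundary conditions. *)
Lemma boundary_range : A - 1 <= y il /\ y ir <= B + 1.
Proof.
have [_ _ _ near] := gb.
have h1 : (1 <= il <= N)%N by move: hL hN; clear; lia.
have h2 : (1 <= ir <= N)%N by move: hL hN; clear; lia.
have := near il (out h1 ltac:(by rewrite leqnn)).
have := near ir (out h2 ltac:(by rewrite leqnn orbT)).
have [/andP[? ?] _] := cl h1; have [/andP[? ?] _] := cl h2.
by rewrite !ler_distl => /andP[? ?] /andP[? ?]; split; lra.
Qed.

End boundary.

(** * Level repulsion *)

Section level_repulsion.
Context {R : realType}.
Variables (beta : R) (V rho : R -> R) (A B xi alpha alpha' delta Crho Lp : R).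
Hypotheses (beta0 : 0 < beta) (mV : measurable_fun setT V).
Hypotheses (eqd : equilibrium_density V rho A B) (Crho0 : 0 < Crho)
  (rhoC : forall x, rho x <= Crho).
Hypotheses (Lp0 : 0 <= Lp) (V_lip : forall s t, A - 1 <= s <= B + 1 -> A - 1 <= t <= B + 1 ->
  `|V s - V t| <= Lp * `|s - t|).
Hypotheses (xi0 : 0 < xi) (xi2 : xi ^+ 2 < 2) (a'0 : 0 < alpha') (aa : alpha' < alpha)
  (delta0 : 0 < delta).
Local Notation c1 := (1 / (4 * Crho)).
Local Notation eta := ((alpha - alpha') / (2 * Crho)).
Local Notation wc := (window_constant beta Lp c1 eta).
Local Notation nu := (xi ^+ 2 * delta / 2).
Local Notation il L K := (L - K.+1)%N.
Local Notation ir L K := (L + K.+1)%N.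

Let c10 : 0 < c1. Proof. by rewrite divr_gt0// mulr_gt0. Qed.

Let eta0 : 0 < eta. Proof. by rewrite divr_gt0 ?subr_gt0// mulr_gt0. Qed.

Let wc0 : 0 <= wc.
Proof. by rewrite /window_constant !addr_ge0// ?mulr_ge0 ?invr_ge0 ?(ltW c10) ?(ltW eta0) ?(ltW beta0). Qed.

(** With [nu = xi ^ 2 * delta / 2] one has [N ^ nu = (N ^ delta) ^ (xi ^ 2 / 2)], which
    [K >= N ^ delta] converts into a power of [K]. *)
Let fluctuation_le (N K : nat) : (0 < N)%N -> (N%:R : R) `^ delta <= K%:R ->
  2 * (N%:R : R) `^ (-1 + nu) <= 2 * K%:R `^ (xi ^+ 2 / 2) / N%:R.
Proof.
move=> N0 NK; have N0' : (0 : R) < N%:R by rewrite ltr0n.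
rewrite powRD; last by rewrite (gt_eqF N0') implybT.
rewrite powR_inv1 ?ler0n// mulrCA mulrC ler_pM2r ?invr_gt0// ler_pM2l//.
have -> : nu = delta * (xi ^+ 2 / 2) by field.
rewrite powRrM; apply: ge0_ler_powR => //; rewrite ?nnegrE ?powR_ge0//.
by rewrite divr_ge0// sqr_ge0.
Qed.

Definition repulsion_hypotheses (N L K : nat) (gamma y : nat -> R) :=
  [/\ alpha * N%:R <= L%:R <= (1 - alpha) * N%:R,
      (N%:R : R) `^ delta <= K%:R <= (N%:R : R) `^ (1 / 4),
      classical_locations rho A B N gamma &
      good_boundary N L K gamma nu alpha' y].

(** Since [xi ^ 2 < 2], the fluctuation [K ^ (xi ^ 2 / 2) / N] of the ends of [J] is small compared
    with [K / N]. Half the length of [J] is then at least [(K + 1) / (2 * Crho * N)], which explains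
    [c1]. *)
Lemma gap_bound_weak_large : exists N0 : nat, forall (N L K : nat) (gamma y : nat -> R),
  (N0 <= N)%N -> repulsion_hypotheses N L K gamma y ->
  forall (i d : nat) (s : R), (il L K <= i)%N -> (i + d <= ir L K)%N -> (0 < d)%N -> 0 < s ->
  P_loc V beta N L K y (gap_event L K y i d (s / N%:R))
  <= 2 * (6 * wc * (K%:R * s * ln N%:R)) `^ (d%:R * beta + 1).
Proof.
have xi21 : xi ^+ 2 / 2 < 1 by rewrite ltr_pdivrMr// mul1r.
(* The factor makes the boundary error at most [K / (4 * Crho * N)], hence at most [l / 2]. *)
have [x0 x01 hx0] := powR_dominated (8 * Crho) xi21.
have Da : 0 < (alpha - alpha') / 2 by move: aa; lra.
have [N0 hN0] := large_N x0 delta0 Da.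
exists N0 => N L K gamma y NN0 [LN KN cl gb] i d s iL iR d0 s0.
have [lnN KN2 xK _] := hN0 N K NN0 KN.
have K1 : 1 <= K%:R :> R by exact: le_trans xK.
have N0' : (0 < N)%N by move: (window_inside_right a'0 LN KN2); clear; lia.
have Npos : (0 : R) < N%:R by rewrite ltr0n.
have hL := window_inside_left a'0 LN KN2.
have hN := window_inside_right a'0 LN KN2.
have [yA yB] := boundary_range a'0 LN KN2 cl gb.
have [yo _ _ _] := gb.
have om := fluctuation_le N0' (proj1 (andP KN)).
have len := boundary_length eqd Crho0 rhoC a'0 LN KN2 cl gb.
have := hx0 _ xK; rewrite powRr1// => Kq.
have om2 : 2 * (N%:R : R) `^ (-1 + nu) <= K%:R / (4 * Crho * N%:R).
  apply: (le_trans om); rewrite ler_pdivrMr//.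
  have -> : K%:R / (4 * Crho * N%:R) * N%:R = K%:R / (4 * Crho) by field; rewrite !gt_eqF.
  rewrite ler_pdivlMr ?mulr_gt0//; lra.
pose l := (y (ir L K) - y (il L K)) / 2.
pose u := (Crho * N%:R)^-1; have u0 : 0 < u by rewrite invr_gt0 mulr_gt0.
have om3 : 2 * (N%:R : R) `^ (-1 + nu) <= K%:R / 4 * u.
  by rewrite (_ : K%:R / 4 * u = K%:R / (4 * Crho * N%:R))// /u; field; rewrite !gt_eqF.
have Ku : u <= K%:R * u by rewrite ler_peMl// ltW.
have lu : (K%:R + 1) / 2 * u <= l.
  by move: len; rewrite -/u /l; lra.
have nE : K.*2.+1%:R = 2 * K%:R + 1 :> R by rewrite -natr1 -muln2 natrM mulrC.
have lM : c1 * K.*2.+1%:R / N%:R <= l.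
  apply: le_trans lu; rewrite nE.
  have -> : c1 * (2 * K%:R + 1) / N%:R = (2 * K%:R + 1) / 4 * u by rewrite /u; field; rewrite !gt_eqF.
  by rewrite ler_pM2r//; lra.
have oml : 2 * (N%:R : R) `^ (-1 + nu) <= l / 2 by lra.
apply: le_trans (gap_bound_weak mV beta0 hL hN yo yA yB Lp0 V_lip c10 eta0 lnN
  (erefl l) lM _ _ iL iR d0 s0) _.
- move=> j jI; apply: le_trans (boundary_spacing_right eqd Crho0 rhoC a'0 aa LN KN2 cl gb jI).
  by rewrite lerB.
- move=> j jI; apply: le_trans (boundary_spacing_left eqd Crho0 rhoC a'0 aa LN KN2 cl gb jI).
  by rewrite lerB.
have ln0 : 0 <= ln N%:R :> R by exact: le_trans lnN.
rewrite ler_wpM2l//; apply: ge0_ler_powR; rewrite ?nnegrE ?mulr_ge0 ?(ltW s0)//.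
  by rewrite addr_ge0// mulr_ge0// ltW.
have -> : 2 * wc * K.*2.+1%:R * ln N%:R * s = wc * (s * ln N%:R) * (2 * K.*2.+1%:R) by ring.
have -> : 6 * wc * (K%:R * s * ln N%:R) = wc * (s * ln N%:R) * (6 * K%:R) by ring.
rewrite ler_wpM2l ?mulr_ge0 ?(ltW s0)//.
by rewrite nE; lra.
Qed.

(** For [xi < 1] a window of about [K ^ xi] particles fits into [J], and as [xi ^ 2 < xi] its
    length, of order [K ^ xi / N], dominates both the rigidity error [K ^ (xi ^ 2) / N] and the
    boundary error. *)
Lemma gap_bound_strong_large (C0 c0 : R) : 0 < C0 -> 0 < c0 -> xi < 1 ->
  exists N0 : nat, forall (N L K : nat) (gamma y : nat -> R),
  (N0 <= N)%N -> repulsion_hypotheses N L K gamma y ->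
  (forall k, in_window L K k ->
     P_loc V beta N L K y (deviation_event L K y k (C0 * K%:R `^ (xi ^+ 2) / N%:R))
     <= C0 * expR (- ((K%:R : R) `^ c0))) ->
  forall (i d : nat) (s : R), (il L K <= i)%N -> (i + d <= ir L K)%N -> (0 < d <= 2)%N ->
  expR (- (K%:R `^ (c0 / 2))) <= s ->
  P_loc V beta N L K y (gap_event L K y i d (s / N%:R))
  <= (2 * wc * (K%:R `^ xi * s * ln N%:R)) `^ (d%:R * beta + 1)
     + (K%:R `^ xi * s * ln N%:R) `^ (d%:R * beta + 1).
Proof.
move=> C00 c00 xi1.
have xi21 : xi ^+ 2 < xi by rewrite expr2 gtr_pMl.
(* Since [2 * tau] plus the boundary error is at most [(2 * C0 + 2) * K ^ (xi ^ 2) / N], this yields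
   the tolerance [(M + 1) * h / 4], the spacing [h] being at least [1 / (2 * Crho * N)]. *)
have [x1 x11 hx1] := powR_dominated (8 * Crho * (2 * C0 + 2)) xi21.
(* Ensures [K ^ xi >= 2], so that the window contains at least [d] particles. *)
have [x2 x21 hx2] := powR_dominated 2 xi0.
pose pm := 2 * beta + 1.
have [x3 x31 hx3] := expR_powR_dominated pm C00 c00.
have Da : 0 < (alpha - alpha') / 2 by move: aa; lra.
have [N0 hN0] := large_N (x1 + x2 + x3) delta0 Da.
exists N0 => N L K gamma y NN0 [LN KN cl gb] dev i d s iL iR /andP[d0 d2] sK.
have [lnN KN2 xK _] := hN0 N K NN0 KN.
have K1 : 1 <= K%:R :> R by lra.
have Kpos : 0 < K%:R :> R by lra.
have N0' : (0 < N)%N by move: (window_inside_right a'0 LN KN2); clear; lia.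
have Npos : (0 : R) < N%:R by rewrite ltr0n.
have hL := window_inside_left a'0 LN KN2.
have hN := window_inside_right a'0 LN KN2.
have [yA yB] := boundary_range a'0 LN KN2 cl gb.
have [yo _ _ _] := gb.
have om := fluctuation_le N0' (proj1 (andP KN)).
have len := boundary_length eqd Crho0 rhoC a'0 LN KN2 cl gb.
have Kx1 := hx1 K%:R ltac:(lra).
have Kx2 := hx2 K%:R ltac:(lra).
have xK3 : x3 <= K%:R by lra.
rewrite powRr0 mulr1 in Kx2.
have s0 : 0 < s by apply: lt_le_trans sK; exact: expR_gt0.
pose M := Num.truncn (K%:R `^ xi : R).
have Mle : M%:R <= K%:R `^ xi :> R.
  by have := truncn_le (K%:R `^ xi : R); rewrite powR_ge0.
have ltM : K%:R `^ xi < M.+1%:R :> R by exact: truncnS_gt.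
have M2 : (2 <= M)%N by rewrite /M truncn_ge_nat.
have MK : (M <= K)%N.
  rewrite -(ler_nat R); apply: (le_trans Mle).
  by rewrite -[leRHS](powRr1 (ltW Kpos)) ler_powR// ltW.
pose u := (Crho * N%:R)^-1; have u0 : 0 < u by rewrite invr_gt0 mulr_gt0.
pose t := K%:R `^ (xi ^+ 2) : R; have t0 : 0 <= t by exact: powR_ge0.
have tu : (2 * C0 + 2) * t / N%:R <= K%:R `^ xi / 8 * u.
  rewrite /u invfM mulrA ler_pM2r ?invr_gt0// ler_pdivlMr//.
  by move: Kx1; rewrite -/t; lra.
have omt : 2 * (N%:R : R) `^ (-1 + nu) <= 2 * t / N%:R.
  apply: (le_trans om); rewrite ler_pM2r ?invr_gt0// ler_pM2l// /t ler_powR//.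
  by rewrite ler_pdivrMr// ler_peMr ?sqr_ge0// ler1n.
have KK : K%:R `^ xi <= K%:R :> R.
  by rewrite -[leRHS](powRr1 (ltW Kpos)) ler_powR// ltW.
set tau := C0 * K%:R `^ (xi ^+ 2) / N%:R in dev.
have tau0 : 0 <= tau by rewrite /tau !mulr_ge0 ?invr_ge0// ltW.
have tolu : 2 * tau + 2 * (N%:R : R) `^ (-1 + nu) <= K%:R `^ xi / 8 * u.
  apply: le_trans tu; rewrite (_ : (2 * C0 + 2) * t / N%:R = 2 * tau + 2 * t / N%:R) ?lerD2l//.
  by rewrite /tau -/t; field; rewrite gt_eqF.
have nE : K.*2.+1%:R = 2 * K%:R + 1 :> R by rewrite -natr1 -muln2 natrM mulrC.
pose h := (y (ir L K) - y (il L K)) / (K.*2.+1%:R + 1).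
have KKu : K%:R `^ xi * u <= K%:R * u by rewrite ler_pM2r.
have hu : u / 2 <= h.
  rewrite /h nE ler_pdivlMr; last by lra.
  have Ku0 : 0 <= K%:R * u by rewrite mulr_ge0// ltW.
  by move: len; rewrite -/u; lra.
have half : alpha - alpha' <= 1.
  case/andP: LN => h1 h2; have := le_trans h1 h2; rewrite ler_pM2r//.
  by move: a'0; lra.
have etah : eta / N%:R <= h.
  apply: le_trans hu.
  have -> : eta / N%:R = (alpha - alpha') * (u / 2) by rewrite /u; field; rewrite !gt_eqF.
  by rewrite ler_piMl// divr_ge0// ltW.
have Mh : M.+1%:R * (u / 2) <= M.+1%:R * h by rewrite ler_pM2l// ltr0n.
have lM : c1 * M%:R / N%:R <= M.+1%:R * h / 2.
  have -> : c1 * M%:R / N%:R = M%:R / 4 * u by rewrite /u; field; rewrite !gt_eqF.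
  have : M%:R * u <= M.+1%:R * u by rewrite ler_pM2r// ler_nat.
  by lra.
have ltMu : K%:R `^ xi * u <= M.+1%:R * u by rewrite ler_pM2r// ltW.
have tol : 2 * tau + 2 * (N%:R : R) `^ (-1 + nu) <= M.+1%:R * h / 4 by lra.
have om0 : 0 <= 2 * (N%:R : R) `^ (-1 + nu) by rewrite mulr_ge0// powR_ge0.
apply: le_trans (gap_bound_strong mV beta0 hL hN yo yA yB Lp0 V_lip c10 eta0 lnN
  (erefl h) d0 (leq_trans d2 M2) MK lM etah tau0 om0 tol
  (fun j => @boundary_spacing_right _ _ _ _ _ _ _ _ _ eqd Crho0 rhoC a'0 aa _ _ _ _ _ LN KN2 cl gb j)
  (fun j => @boundary_spacing_left _ _ _ _ _ _ _ _ _ eqd Crho0 rhoC a'0 aa _ _ _ _ _ LN KN2 cl gb j)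
  dev iL iR s0) _.
have ln0 : 0 <= ln N%:R :> R by exact: le_trans lnN.
set p := d%:R * beta + 1; have p0 : 0 <= p by rewrite addr_ge0// mulr_ge0// ltW.
have ppm : p <= pm by rewrite /p /pm lerD2r ler_pM2r// ler_nat.
have Kxi1 : 1 <= K%:R `^ xi :> R by apply: le_trans Kx2; rewrite ler1n.
have Kxi0 : 0 <= K%:R `^ xi :> R by exact: le_trans Kxi1.
apply: lerD.
  apply: ge0_ler_powR; rewrite ?nnegrE ?mulr_ge0 ?(ltW s0)//.
  have -> : 2 * wc * M%:R * ln N%:R * s = wc * (2 * ln N%:R * s) * M%:R by ring.
  have -> : 2 * wc * (K%:R `^ xi * s * ln N%:R) = wc * (2 * ln N%:R * s) * K%:R `^ xi by ring.
  by rewrite ler_wpM2l ?mulr_ge0 ?(ltW s0).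
pose q := K%:R `^ (c0 / 2) : R.
(* The deviation probability is at most [s ^ p], which is below the second term because
   [K ^ xi * ln N >= 1]. *)
apply: (@le_trans _ _ (s `^ p)); last first.
  apply: ge0_ler_powR; rewrite ?nnegrE ?mulr_ge0 ?(ltW s0)//.
  rewrite mulrAC ler_peMl ?(ltW s0)// -[leLHS](mulr1 1).
  by apply: ler_pM.
apply: (@le_trans _ _ (expR (- q) `^ p)); last first.
  by apply: ge0_ler_powR; rewrite ?nnegrE ?expR_ge0 ?(ltW s0).
apply: le_trans (hx3 _ _ xK3 ppm); rewrite mulrA ler_wpM2r ?expR_ge0// ler_wpM2r ?(ltW C00)//.
by rewrite nE; lra.
Qed.

End level_repulsion.

Unset Implicit Arguments.

(* [xi ^+ 2 < 2] and [alpha' < alpha] make the fluctuation of the two endpoints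
   of [J] small compared with [K / N]: without them [J] may be arbitrarily short
   for admissible [y], and then no bound of the form (i) can hold. *)
Theorem theorem4p3 (R : realType) (beta : R) (V rho : R -> R) (A B : R)
    (hbeta : 0 < beta) (hV : admissible_potential V)
    (hrho : equilibrium_density V rho A B)
    (xi alpha alpha' delta : R)
    (hxi : 0 < xi) (hxi2 : xi ^+ 2 < 2)
    (halpha' : 0 < alpha') (halpha : alpha' < alpha) (hdelta : 0 < delta) :
  (* (i) weak form of level repulsion *)
  (exists (C : R) (N0 : nat), 0 < C /\
    forall (N L K : nat) (gamma y : nat -> R),
      (N0 <= N)%N ->
      alpha * N%:R <= L%:R <= (1 - alpha) * N%:R ->
      (N%:R : R) `^ delta <= K%:R <= (N%:R : R) `^ (1 / 4) ->
      classical_locations rho A B N gamma ->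
      good_boundary N L K gamma (xi ^+ 2 * delta / 2) alpha' y ->
      forall s : R, 0 < s ->
        (forall i, (L - K.+1 <= i <= L + K)%N ->
           P_loc V beta N L K y (gap_event L K y i 1 (s / N%:R))
           <= C * (N%:R * s) `^ (beta + 1)) /\
        (forall i, (L - K.+1 <= i < L + K)%N ->
           P_loc V beta N L K y (gap_event L K y i 2 (s / N%:R))
           <= C * (N%:R * s) `^ (2 * beta + 1))) /\
  (* (ii) strong form of level repulsion *)
  (forall C0 c0 : R, 0 < C0 -> 0 < c0 ->
   exists (theta C : R) (N0 : nat), 0 < theta /\ 0 < C /\
    forall (N L K : nat) (gamma y : nat -> R),
      (N0 <= N)%N ->
      alpha * N%:R <= L%:R <= (1 - alpha) * N%:R ->
      (N%:R : R) `^ delta <= K%:R <= (N%:R : R) `^ (1 / 4) ->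
      classical_locations rho A B N gamma ->
      good_boundary N L K gamma (xi ^+ 2 * delta / 2) alpha' y ->
      (forall k, in_window L K k ->
         P_loc V beta N L K y
           (deviation_event L K y k (C0 * K%:R `^ (xi ^+ 2) / N%:R))
         <= C0 * expR (- ((K%:R : R) `^ c0))) ->
      forall s : R, expR (- (K%:R `^ theta)) <= s ->
        (forall i, (L - K.+1 <= i <= L + K)%N ->
           P_loc V beta N L K y (gap_event L K y i 1 (s / N%:R))
           <= C * (K%:R `^ xi * s * ln N%:R) `^ (beta + 1)) /\
        (forall i, (L - K.+1 <= i < L + K)%N ->
           P_loc V beta N L K y (gap_event L K y i 2 (s / N%:R))
           <= C * (K%:R `^ xi * s * ln N%:R) `^ (2 * beta + 1))).
Proof.
have [hVa _ _] := hV.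
have lipV := real_analytic_locally_lipschitz hVa.
have mV : measurable_fun setT V.
  exact: continuous_measurable_fun (locally_lipschitz_continuous lipV).
have [Lp Lp0 V_lip] := locally_lipschitz_itv (A - 1) (B + 1) lipV.
have [Crho Crho0 rhoC] := equilibrium_density_bounded hrho.
have [N1 weak] := gap_bound_weak_large hbeta mV hrho Crho0 rhoC Lp0 V_lip hxi2
  halpha' halpha hdelta.
set wc := window_constant _ _ _ _ in weak.
have wc0 : 0 <= wc.
  have e0 : 0 < (alpha - alpha') / (2 * Crho) by rewrite divr_gt0 ?subr_gt0// mulr_gt0.
  have c0 : 0 < 1 / (4 * Crho) by rewrite divr_gt0// mulr_gt0.
  by rewrite /wc /window_constant !addr_ge0// ?mulr_ge0 ?invr_ge0 ?(ltW c0) ?(ltW e0) ?(ltW hbeta).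
(* The sum of the two powers provides one constant for [d = 1] and [d = 2]. *)
pose Cw (w : R) := w `^ (beta + 1) + w `^ (2 * beta + 1).
have Cw0 w : 0 <= Cw w by rewrite addr_ge0// powR_ge0.
have CwM w X d : 0 <= w -> 0 <= X -> (0 < d <= 2)%N ->
    (w * X) `^ (d%:R * beta + 1) <= Cw w * X `^ (d%:R * beta + 1).
  move=> w0 X0 d12; rewrite powRM// ler_wpM2r ?powR_ge0// /Cw.
  case: d d12 => [|[|[|]]]// _; first by rewrite mul1r lerDl powR_ge0.
  by rewrite lerDr powR_ge0.
have both (N L K : nat) (y : nat -> R) (s C X : R) :
    (forall i d, (L - K.+1 <= i)%N -> (i + d <= L + K.+1)%N -> (0 < d <= 2)%N ->
      P_loc V beta N L K y (gap_event L K y i d (s / N%:R)) <= C * X `^ (d%:R * beta + 1)) ->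
    (forall i, (L - K.+1 <= i <= L + K)%N ->
       P_loc V beta N L K y (gap_event L K y i 1 (s / N%:R)) <= C * X `^ (beta + 1)) /\
    (forall i, (L - K.+1 <= i < L + K)%N ->
       P_loc V beta N L K y (gap_event L K y i 2 (s / N%:R)) <= C * X `^ (2 * beta + 1)).
  move=> h; split=> i /andP[iL iR].
    have := h i 1%N iL; rewrite mul1r; apply => //; move: iR; clear; lia.
  by apply: (h i 2%N iL) => //; move: iR; clear; lia.
split.
  have [N2 hN2] := large_N 1 hdelta (ltr01 : 0 < 1 :> R).
  (* [K * ln N <= 2 * N] turns [6 * wc * (K * s * ln N)] into [12 * wc * (N * s)]; the summand 1
     makes the constant positive. *)
  exists (1 + 2 * Cw (12 * wc)), (maxn N1 N2); split.
    by rewrite ltr_wpDr// mulr_ge0.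
  move=> N L K gamma y; rewrite geq_max => /andP[N1N N2N] LN KN cl gb s s0.
  have [_ _ _ KlnN] := hN2 N K N2N KN.
  apply: both => i d iL iR d12; have d0 : (0 < d)%N by case/andP: d12.
  have Ns0 : 0 <= N%:R * s by rewrite mulr_ge0// ltW.
  apply: le_trans (weak N L K gamma y N1N (And4 LN KN cl gb) i d s iL iR d0 s0) _.
  apply: (@le_trans _ _ (2 * (12 * wc * (N%:R * s)) `^ (d%:R * beta + 1))).
    have p0 : 0 <= d%:R * beta + 1 by rewrite addr_ge0// mulr_ge0// ltW.
    have ln0 : 0 <= ln N%:R :> R.
      have [lnN _ _ _] := hN2 N K N2N KN; exact: le_trans lnN.
    rewrite ler_wpM2l//; apply: ge0_ler_powR; rewrite ?nnegrE// ?mulr_ge0 ?(ltW s0)//.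
    have -> : 6 * wc * (K%:R * s * ln N%:R) = 6 * wc * s * (K%:R * ln N%:R) by ring.
    have -> : 12 * wc * (N%:R * s) = 6 * wc * s * (2 * N%:R) by ring.
    by rewrite ler_wpM2l// !mulr_ge0// ltW.
  have w12 : 0 <= 12 * wc by rewrite mulr_ge0.
  have := CwM (12 * wc) (N%:R * s) d w12 Ns0 d12.
  by have := powR_ge0 (N%:R * s) (d%:R * beta + 1); rewrite mulrDl mul1r; lra.
move=> C0 c0 C00 c00; have [N2 hN2] := large_N 1 hdelta (ltr01 : 0 < 1 :> R).
have [xi1|xi1] := ltP xi 1.
  have [N3 strong] := gap_bound_strong_large hbeta mV hrho Crho0 rhoC Lp0 V_lip hxi
    halpha' halpha hdelta C00 c00 xi1.
  (* [Cw (2 * wc)] is for the window estimate and 1 for the deviation probability. *)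
  exists (c0 / 2), (1 + Cw (2 * wc)), (maxn N2 N3); split; first by rewrite divr_gt0.
  split; first by rewrite ltr_wpDr.
  move=> N L K gamma y; rewrite geq_max => /andP[N2N N3N] LN KN cl gb dev s sK.
  have [lnN _ _ _] := hN2 N K N2N KN.
  have s0 : 0 <= s by apply: le_trans sK; exact: expR_ge0.
  apply: both => i d iL iR d12.
  apply: le_trans (strong N L K gamma y N3N (And4 LN KN cl gb) dev i d s iL iR d12 sK) _.
  have X0 : 0 <= K%:R `^ xi * s * ln N%:R.
    by rewrite !mulr_ge0 ?powR_ge0// (le_trans _ lnN).
  have w2 : 0 <= 2 * wc by rewrite mulr_ge0.
  by have := CwM (2 * wc) _ d w2 X0 d12; rewrite mulrDl mul1r; lra.
(* For [xi >= 1] one has [K <= K ^ xi], so the weak bound, before [K * ln N] is replaced by [2 * N],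
   already has the required form; any positive [theta] serves. *)
exists 1, (1 + 2 * Cw (6 * wc)), (maxn N1 N2); split => //; split.
  by rewrite ltr_wpDr// mulr_ge0.
move=> N L K gamma y; rewrite geq_max => /andP[N1N N2N] LN KN cl gb _ s sK.
have [lnN _ K1 _] := hN2 N K N2N KN.
have s0 : 0 < s by apply: lt_le_trans sK; exact: expR_gt0.
have ln0 : 0 <= ln N%:R :> R by exact: le_trans lnN.
apply: both => i d iL iR d12; have d0 : (0 < d)%N by case/andP: d12.
apply: le_trans (weak N L K gamma y N1N (And4 LN KN cl gb) i d s iL iR d0 s0) _.
have X0 : 0 <= K%:R `^ xi * s * ln N%:R by rewrite !mulr_ge0 ?powR_ge0 ?(ltW s0).
have w6 : 0 <= 6 * wc by rewrite mulr_ge0.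
apply: (@le_trans _ _ (2 * (6 * wc * (K%:R `^ xi * s * ln N%:R)) `^ (d%:R * beta + 1))).
  have p0 : 0 <= d%:R * beta + 1 by rewrite addr_ge0// mulr_ge0// ltW.
  rewrite ler_wpM2l//; apply: ge0_ler_powR; rewrite ?nnegrE// ?mulr_ge0 ?powR_ge0 ?(ltW s0)//.
  rewrite ler_wpM2l// ler_wpM2r// ler_wpM2r ?(ltW s0)//.
  by rewrite -[leLHS]powRr1 ?ler0n// ler_powR.
have := CwM (6 * wc) _ d w6 X0 d12.
by have := powR_ge0 (K%:R `^ xi * s * ln N%:R) (d%:R * beta + 1); rewrite mulrDl mul1r; lra.
Qed.
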